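(* Let $d\ge2$. Let $\Omega\subset\mathbb{R}^d_+$ be open and bounded with Lipschitz boundary, and let $f:\mathbb{R}^d\to[0,\infty)$ be a probability density such that there is a continuous nondecreasing $m:[0,\infty)\to[0,\infty)$ with $m(0)=0$ and $|f(x)-f(y)|\le m(|x-y|)$ for $x,y\in\Omega$, and $f(x)=0$ for $x\notin\Omega$. Let $X_1,X_2,\dots$ be i.i.d. with density $f$, and let $Y_1,Y_2,\dots$ be i.i.d. with a continuous compactly supported density $g:\mathbb{R}^d\to\mathbb{R}$, independent of the $X_i$. For $\delta>0$ set $Z_i=X_i+\delta Y_i$ and $u_n^\delta(x)=\ell(\{Z_i:1\le i\le n,\ Z_i\leqq x\})$, and $u_n(x)=\ell(\{X_i:1\le i\le n,\ X_i\leqq x\})$. Then there exist constants $C_\delta$, depending only on $\delta$, $f$ and $g$, such that \[\limsup_{n\to\infty}n^{-1/d}\|u_n^\delta-u_n\|_{L^\infty(\mathbb{R}^d)}\le C_\delta\quad\text{almost surely},\] and $C_\delta\to0$ as $\delta\to0$.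
   Context: $x\leqq y$ means $x_i\le y_i$ for all $i$; $\mathbb{R}^d_+=\{x:x_i>0\ \forall i\}$. For a finite set $S\subset\mathbb{R}^d$, $\ell(S)$ is the length of a longest chain (subset totally ordered by $\leqq$) in $S$. *)

(* Defs.v *)
(* R : realType, points of R^d are d.-tuple R
   (with the product = Borel sigma-algebra from measurable_structure). *)
From HB Require Import structures.
From mathcomp Require Import all_boot all_order all_algebra.
From mathcomp Require Import all_classical all_reals all_analysis.
Set Implicit Arguments. Unset Strict Implicit. Unset Printing Implicit Defensive.
Import Order.TTheory GRing.Theory Num.Theory.
Import numFieldNormedType.Exports.
Local Open Scope classical_set_scope.
Local Open Scope ring_scope.

Section Geometry.
Variables (R : realType) (d : nat).
Implicit Types x y e : d.-tuple R.

Definition vadd x y : d.-tuple R := [tuple tnth x i + tnth y i | i < d].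
Definition vsub x y : d.-tuple R := [tuple tnth x i - tnth y i | i < d].
Definition vscale (a : R) x : d.-tuple R := [tuple a * tnth x i | i < d].
Definition dot x y : R := \sum_(i < d) tnth x i * tnth y i.
Definition enorm x : R := Num.sqrt (dot x x).
Definition proj_perp e x : d.-tuple R := vsub x (vscale (dot x e) e).

Definition tle x y : bool := [forall i, tnth x i <= tnth y i].

Definition in_pos_orthant (O : set (d.-tuple R)) : Prop :=
  forall x, O x -> forall i : 'I_d, 0 < tnth x i.
Definition is_open_set (O : set (d.-tuple R)) : Prop :=
  forall x, O x -> exists2 r : R, 0 < r & forall y, enorm (vsub y x) < r -> O y.
Definition is_bounded_set (O : set (d.-tuple R)) : Prop :=
  exists M : R, forall x, O x -> enorm x <= M.
(* boundary point of an open set: not in O, but in its closure *)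
Definition bdry_point (O : set (d.-tuple R)) p : Prop :=
  ~ O p /\ forall r : R, 0 < r -> exists x, O x /\ enorm (vsub x p) < r.
(* Lipschitz boundary: near every boundary point p, after choosing a unit
   "vertical" direction e (i.e. rotating coordinates), O is the strict
   supergraph of a Lipschitz function gamma of the remaining (e^perp)
   coordinates. *)
Definition lipschitz_boundary (O : set (d.-tuple R)) : Prop :=
  forall p, bdry_point O p ->
  exists2 r : R, 0 < r &
  exists e, enorm e = 1 /\
  exists gamma : d.-tuple R -> R, exists L : R,
    (forall a b, `|gamma a - gamma b| <= L * enorm (vsub a b)) /\
    (forall x, enorm (vsub x p) < r ->
       (O x <-> gamma (proj_perp e (vsub x p)) < dot (vsub x p) e)).

Definition chain_len (s : seq (d.-tuple R)) : nat :=
  \max_(b : (size s).-tuple bool |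
          all2rel (fun a c => tle a c || tle c a) (mask b s))
     size (undup (mask b s)).

Definition continuous_Rd (g : d.-tuple R -> R) : Prop :=
  forall x (eps : R), 0 < eps -> exists2 eta : R, 0 < eta &
    forall y, enorm (vsub y x) < eta -> `|g y - g x| < eps.
Definition compact_support (g : d.-tuple R -> R) : Prop :=
  exists M : R, forall x, M < enorm x -> g x = 0.
End Geometry.

(* iterated Lebesgue integral over R^n (equal to the integral w.r.t.
   n-dimensional Lebesgue measure for nonnegative measurable F, by Tonelli) *)
Fixpoint iint (R : realType) (n : nat) : (n.-tuple R -> \bar R) -> \bar R :=
  match n with
  | 0 => fun F => F [tuple]
  | n'.+1 => fun F =>
      (\int[@lebesgue_measure R]_t iint (fun x => F (cons_tuple t x)))%E
  end.

Section Prob.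
Variables (R : realType) (d : nat) (dT : measure_display) (T : measurableType dT).
Variable P : probability T R.

Definition has_density (W : T -> d.-tuple R) (h : d.-tuple R -> R) : Prop :=
  measurable_fun setT W /\
  forall A : set (d.-tuple R), measurable A ->
    P (W @^-1` A) = iint (fun x => (\1_A x)%:E * (h x)%:E)%E.

Definition mutually_independent (I : eqType) (W : I -> T -> d.-tuple R) : Prop :=
  forall (J : seq I) (A : I -> set (d.-tuple R)), uniq J ->
    (forall j, measurable (A j)) ->
    P (\bigcap_(j in [set j | j \in J]) (W j @^-1` A j)) =
      (\prod_(j <- J) P (W j @^-1` A j))%E.
End Prob.

Definition chain_count (R : realType) (d : nat) (W : nat -> d.-tuple R) (n : nat)
  (x : d.-tuple R) : nat :=
  chain_len [seq W i | i <- iota 0 n & tle (W i) x].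

Definition supdiff (R : realType) (d : nat) (u v : d.-tuple R -> nat) : \bar R :=
  ereal_sup [set (`|(u x)%:R - (v x)%:R| : R)%:E | x in [set: d.-tuple R]].

(* Main.v *)
(** The chain length is compared through a grid of very thin cells: since ties are
    unlikely, it is the longest chain of the set of cells that are hit.  The cube
    is divided into finitely many macroscopic boxes.  Because the boundary is
    Lipschitz, each box admits a small translation, depending only on the box, that
    moves Omega into itself; by the modulus of continuity of f, and since delta Y is
    small, it turns the law of X on the box into the law of Z up to a small density
    error (and conversely).  Hence the two samples can be coupled so that few points
    violate the translation, in the sense that a first moment bound controls the
    longest chain of the violating points.  Translating the boxes separately destroys
    a chain only near the places where it changes box; these lie in few thin slabs,
    where chains are short by the same first moment bound.  So one chain count
    exceeds the other by at most a small multiple of n^(1/d), once it is replaced by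
    its mean: by the Efron-Stein inequality the variance is at most the mean, and
    Borel-Cantelli along n = K^(2d) together with monotonicity in n gives the almost
    sure bound.  Finally C delta is the infimum of the admissible constants. *)
From HB Require Import structures.
From mathcomp Require Import all_boot all_order all_algebra.
From mathcomp Require Import ring lra zify.
Set Implicit Arguments. Unset Strict Implicit. Unset Printing Implicit Defensive.
Import Order.TTheory GRing.Theory Num.Theory.
Local Open Scope ring_scope.

(** * Words over a finite alphabet *)

(** Pairing X_i with Z_i = X_i + delta Y_i is useless for chains: the noise moves points by about
    delta, whereas the order inside a chain is decided at scale n^(-1/d). The coupling lives on an
    auxiliary alphabet of pairs of cells and need not be realised on the given probability space: it
    shows that one count rarely exceeds the mean of the other by more than the loss, and
    concentration about that same mean is then applied to the actual second sample. For fixed n all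
    probabilities are thus finite sums over words, defined by recursion on the length. The loss is
    the number of places where a chain may be cut, which depends on the number m of boxes per axis,
    times the chain length in one slab. Hence the boxes are fixed before anything else, by the
    geometry of the boundary; slabs can then be made thin without increasing the number of cuts, and
    delta is chosen last. *)

Fixpoint Ew (R : realFieldType) (D : finType) (p : D -> R) (n : nat)
    (phi : seq D -> R) : R :=
  match n with
  | 0 => phi [::]
  | n'.+1 => \sum_c p c * Ew p n' (fun s => phi (c :: s))
  end.

Definition Prw (R : realFieldType) (D : finType) (p : D -> R) (n : nat)
    (b : pred (seq D)) : R := Ew p n (fun s => (b s)%:R).

(** The increment at a position compares [phi] with and without that letter: deletion takes the
    place of resampling, so [phi] is also evaluated on shorter words. *)
Fixpoint sqincr (R : realFieldType) (D : finType) (phi : seq D -> R)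
    (s : seq D) : R :=
  if s is c :: s' then
    (phi s - phi s') ^+ 2 + sqincr (fun u => phi (c :: u)) s'
  else 0.

Section Words.
Variables (R : realFieldType) (D : finType) (p : D -> R).
Hypothesis p_ge0 : forall c, 0 <= p c.
Implicit Types (phi psi : seq D -> R) (b : pred (seq D)).

Lemma eq_Ew n phi psi : (forall s, size s = n -> phi s = psi s) ->
  Ew p n phi = Ew p n psi.
Proof.
elim: n phi psi => [|n IH] phi psi e /=; first exact: e.
by apply: eq_bigr => c _; congr (_ * _); apply: IH => s sn; apply: e; rewrite /= sn.
Qed.

Lemma le_Ew n phi psi : (forall s, size s = n -> phi s <= psi s) ->
  Ew p n phi <= Ew p n psi.
Proof.
elim: n phi psi => [|n IH] phi psi e /=; first exact: e.
apply: ler_sum => c _; apply: ler_wpM2l => //.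
by apply: IH => s sn; apply: e; rewrite /= sn.
Qed.

Lemma EwD n phi psi : Ew p n (fun s => phi s + psi s) = Ew p n phi + Ew p n psi.
Proof.
elim: n phi psi => //= n IH phi psi; rewrite -big_split /=.
by apply: eq_bigr => c _; rewrite IH mulrDr.
Qed.

Lemma EwZ n a phi : Ew p n (fun s => a * phi s) = a * Ew p n phi.
Proof.
elim: n phi => //= n IH phi; rewrite mulr_sumr.
by apply: eq_bigr => c _; rewrite IH mulrCA.
Qed.

Lemma Ew_sum n (I : Type) (r : seq I) (Q : pred I) (F : I -> seq D -> R) :
  Ew p n (fun s => \sum_(i <- r | Q i) F i s) =
  \sum_(i <- r | Q i) Ew p n (F i).
Proof.
elim: r => [|i r IH].
  rewrite big_nil -[RHS](mul0r (Ew p n (fun=> 0))) -EwZ.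
  by apply: eq_Ew => s _; rewrite big_nil mul0r.
rewrite big_cons -IH.
case Qi: (Q i).
  by rewrite -EwD; apply: eq_Ew => s _; rewrite big_cons Qi.
by apply: eq_Ew => s _; rewrite big_cons Qi.
Qed.

Lemma Ew_ge0 n phi : (forall s, size s = n -> 0 <= phi s) -> 0 <= Ew p n phi.
Proof.
move=> h; rewrite -[leLHS](mul0r (Ew p n (fun=> 0))) -EwZ.
by apply: le_Ew => s sn; rewrite mul0r h.
Qed.

Lemma le_Prw n b b' : (forall s, size s = n -> b s -> b' s) ->
  Prw p n b <= Prw p n b'.
Proof.
move=> h; apply: le_Ew => s sn; rewrite ler_nat.
by case: (b s) (h s sn) => // ->.
Qed.

Lemma Prw_ge0 n b : 0 <= Prw p n b.
Proof. by apply: Ew_ge0. Qed.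

Lemma PrwU n b b' : Prw p n (fun s => b s || b' s) <= Prw p n b + Prw p n b'.
Proof.
rewrite -EwD; apply: le_Ew => s _; rewrite -natrD ler_nat.
by case: (b s); case: (b' s).
Qed.

Lemma Prw_exists n (I : finType) (b : I -> pred (seq D)) :
  Prw p n (fun s => [exists i, b i s]) <= \sum_i Prw p n (b i).
Proof.
rewrite -Ew_sum; apply: le_Ew => s _.
case: existsP => [[i bi]|_]; last by apply: sumr_ge0.
by rewrite (bigD1 i) //= bi lerDl; apply: sumr_ge0.
Qed.

Hypothesis p_sum1 : \sum_c p c = 1.

Lemma Ew_cst n a : Ew p n (fun=> a) = a.
Proof.
elim: n => //= n IH.
by under eq_bigr do rewrite IH; rewrite -mulr_suml p_sum1 mul1r.
Qed.

Lemma Ew_cat n k phi psi theta :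
  (forall s t, size s = n -> size t = k -> theta (s ++ t) <= phi s + psi t) ->
  Ew p (n + k) theta <= Ew p n phi + Ew p k psi.
Proof.
elim: n phi theta => [|n IH] phi theta h /=.
  by rewrite -[phi [::]](Ew_cst k) -EwD; apply: le_Ew => s sk; apply: (h [::]).
have -> : \sum_c p c * Ew p n (fun s => phi (c :: s)) + Ew p k psi =
  \sum_c p c * (Ew p n (fun s => phi (c :: s)) + Ew p k psi).
  under [RHS]eq_bigr do rewrite mulrDr.
  by rewrite big_split /= -mulr_suml p_sum1 mul1r.
apply: ler_sum => c _; apply: ler_wpM2l => //; apply: IH => s t sn tk.
by rewrite -cat_cons h //= sn.
Qed.

Definition Varw n phi := Ew p n (fun s => phi s ^+ 2) - Ew p n phi ^+ 2.

Lemma VarwE n phi a :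
  Ew p n (fun s => (phi s - a) ^+ 2) = Varw n phi + (Ew p n phi - a) ^+ 2.
Proof.
rewrite (@eq_Ew _ _ (fun s => phi s ^+ 2 + ((- (2 * a)) * phi s + a ^+ 2))); last first.
  by move=> s _; ring.
by rewrite EwD EwD EwZ Ew_cst /Varw; ring.
Qed.

Lemma Varw_ge0 n phi : 0 <= Varw n phi.
Proof.
have := VarwE n phi (Ew p n phi); rewrite subrr expr0n addr0 => <-.
by apply: Ew_ge0 => s _; apply: sqr_ge0.
Qed.

Lemma sqr_Ew_le n phi : Ew p n phi ^+ 2 <= Ew p n (fun s => phi s ^+ 2).
Proof. by rewrite -subr_ge0; apply: Varw_ge0. Qed.

(** Total variance over the first letter. The variance of the conditional mean [mu] is at most its
    second moment about any constant; with [m0], the mean over words one letter shorter, [mu c - m0]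
    is the average increment of the first letter, and Jensen bounds its square. *)
Lemma efron_stein n phi : Varw n phi <= Ew p n (sqincr phi).
Proof.
elim: n phi => [|n IH] phi; first by rewrite /Varw /= subrr.
pose mu c := Ew p n (fun s => phi (c :: s)).
pose m0 := Ew p n phi.
have dec : Varw n.+1 phi + (\sum_c p c * mu c - m0) ^+ 2 =
    \sum_c p c * (Varw n (fun s => phi (c :: s)) + (mu c - m0) ^+ 2).
  rewrite -(VarwE n.+1 phi m0) /=; apply: eq_bigr => c _.
  by rewrite (VarwE n (fun s => phi (c :: s))).
have : Varw n.+1 phi <=
    \sum_c p c * (Varw n (fun s => phi (c :: s)) + (mu c - m0) ^+ 2).
  by rewrite -dec lerDl sqr_ge0.
move/le_trans; apply => /=; apply: ler_sum => c _; apply: ler_wpM2l => //.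
rewrite EwD addrC; apply: lerD; last exact: IH.
have -> : mu c - m0 = Ew p n (fun s => phi (c :: s) - phi s).
  rewrite (@eq_Ew _ (fun s => phi (c :: s) - phi s)
             (fun s => phi (c :: s) + (-1) * phi s)); last by move=> s _; ring.
  by rewrite EwD EwZ mulN1r.
exact: sqr_Ew_le.
Qed.

Lemma chebyshev_word n phi a : 0 < a ->
  Prw p n (fun s => a <= `|phi s - Ew p n phi|) <= Varw n phi / a ^+ 2.
Proof.
move=> a0; rewrite ler_pdivlMr ?exprn_gt0 // mulrC -EwZ.
have -> : Varw n phi = Ew p n (fun s => (phi s - Ew p n phi) ^+ 2).
  by rewrite VarwE subrr expr0n addr0.
apply: le_Ew => s _ /=.
case: (boolP (a <= _)) => [h|_]; last by rewrite mulr0 sqr_ge0.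
by rewrite mulr1 -[X in _ <= X]real_normK ?num_real // ler_sqr ?nnegrE // ltW.
Qed.

End Words.

Lemma Ew_map (R : realFieldType) (D E : finType) (f : D -> E) (p : D -> R) n
    (phi : seq E -> R) :
  Ew p n (fun s => phi (map f s)) =
  Ew (fun e => \sum_(c | f c == e) p c) n phi.
Proof.
elim: n phi => //= n IH phi.
under eq_bigr do rewrite (IH (fun s => phi (f _ :: s))).
rewrite (partition_big f predT) //=; apply: eq_bigr => e _.
by rewrite mulr_suml; apply: eq_bigr => c /eqP ->.
Qed.

(** * Chains of cells *)

Notation cell d G := {ffun 'I_d -> 'I_G}.

(** A letter sent to [None] hits nothing. This lets the first moment bounds apply to a marked subset
    of the letters, such as the unmatched points of a coupling. *)
Definition hits (D : finType) (C : finType) (f : D -> option C) (s : seq D) :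
  {set C} := [set c | Some c \in map f s].

Section Chains.
Variables (d G : nat).
Implicit Types (a b c : cell d G) (U V E S : {set cell d G}).

(** Strict in every coordinate: all points of the smaller cell then lie below all points of the
    larger one, and a chain is determined by its coordinate projections. *)
Definition slt a b := [forall i, (a i < b i)%N].

Definition chain U :=
  [forall a in U, forall b in U, (a != b) ==> (slt a b || slt b a)].

Definition lc E : nat := \max_(U : {set cell d G} | chain U && (U \subset E)) #|U|.

Lemma chainP U :
  reflect {in U &, forall a b, a != b -> slt a b || slt b a} (chain U).
Proof.
apply: (iffP forall_inP) => [h a b aU bU|h a aU].
  by have /forall_inP/(_ b bU)/implyP := h a aU.
by apply/forall_inP => b bU; apply/implyP; apply: h.
Qed.

Lemma chainS U V : U \subset V -> chain V -> chain U.
Proof.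
by move=> /subsetP UV /chainP cV; apply/chainP => a b /UV aV /UV bV; apply: cV.
Qed.

Lemma chain0 : chain set0.
Proof. by apply/chainP => a b; rewrite inE. Qed.

Lemma leq_lc U E : chain U -> U \subset E -> (#|U| <= lc E)%N.
Proof. by move=> cU UE; apply: leq_bigmax_cond; rewrite cU. Qed.

Lemma lc_leqP E k :
  reflect (forall U, chain U -> U \subset E -> #|U| <= k)%N (lc E <= k)%N.
Proof.
apply: (iffP (bigmax_leqP _ _ _)) => [h U cU UE|h U /andP[]]; last exact: h.
by apply: h; rewrite cU.
Qed.

Lemma lc_ex E : exists U, [/\ chain U, U \subset E & #|U| = lc E].
Proof.
have := @eq_bigmax_cond _ (fun U => chain U && (U \subset E)) (fun U => #|U|).
case=> [|U /andP[cU UE] e]; last by exists U; rewrite -e.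
by apply/card_gt0P; exists set0; rewrite unfold_in sub0set chain0.
Qed.

Lemma lcS E E' : E \subset E' -> (lc E <= lc E')%N.
Proof.
by move=> EE; apply/lc_leqP => U cU UE; apply: leq_lc => //; apply: subset_trans EE.
Qed.

Lemma lcU E E' : (lc (E :|: E') <= lc E + lc E')%N.
Proof.
apply/lc_leqP => U cU UE; rewrite -(cardsID E U); apply: leq_add; apply: leq_lc.
- by apply: chainS cU; apply: subsetIl.
- exact: subsetIr.
- by apply: chainS cU; apply: subsetDl.
- apply/subsetP => x; rewrite inE => /andP[xE /(subsetP UE)].
  by rewrite inE (negbTE xE).
Qed.

Lemma lc_bigcup (I : finType) (P : pred I) (E : I -> {set cell d G}) :
  (lc (\bigcup_(i | P i) E i) <= \sum_(i | P i) lc (E i))%N.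
Proof.
apply: (big_ind2 (fun (E : {set cell d G}) n => (lc E <= n)%N)) => //.
  by apply/lc_leqP => U _; rewrite subset0 => /eqP ->; rewrite cards0.
by move=> E1 n1 E2 n2 h1 h2; apply: leq_trans (lcU _ _) (leq_add h1 h2).
Qed.

Lemma lc_leq_card E : (lc E <= #|E|)%N.
Proof. by apply/lc_leqP => U _; apply: subset_leq_card. Qed.

Lemma lc1 c : (lc [set c] <= 1)%N.
Proof. by apply: leq_trans (lc_leq_card _) _; rewrite cards1. Qed.

(** * Self-bounding property of the longest chain *)

Section SelfBounding.
Variables (R : realFieldType) (S : {set cell d G}).

Lemma eq_sqincr (D : finType) (phi psi : seq D -> R) s :
  phi =1 psi -> sqincr phi s = sqincr psi s.
Proof.
elim: s phi psi => //= c s IH phi psi e; rewrite !e; congr (_ + _).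
by apply: IH => u; rewrite e.
Qed.

Let L E (s : seq (cell d G)) : R := (lc ((E :|: [set x in s]) :&: S))%:R.

(* Removing a letter lowers the longest chain by at most 1, and lowers it only
   if the letter belongs to the fixed optimal chain [U] and occurs once. *)
Lemma sqincr_lc_le U E s : chain U -> U \subset (E :|: [set x in s]) :&: S ->
  #|U| = lc ((E :|: [set x in s]) :&: S) ->
  sqincr (L E) s <= #|(U :&: [set x in s]) :\: E|%:R.
Proof.
elim: s E => [|c s IH] E cU UE Uo /=; first exact: ler0n.
have eE : E :|: [set x in c :: s] = (c |: E) :|: [set x in s].
  by apply/setP => x; rewrite !inE orbCA orbA.
have -> : sqincr (fun u => L E (c :: u)) s = sqincr (L (c |: E)) s.
  apply: eq_sqincr => u; congr (lc (_ :&: S))%:R.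
  by apply/setP => x; rewrite !inE orbCA orbA.
rewrite eE in UE Uo.
have {}IH := IH _ cU UE Uo.
have le1 : (lc ((E :|: [set x in s]) :&: S) <= lc ((E :|: [set x in c :: s]) :&: S))%N.
  by apply: lcS; rewrite eE; apply: setSI; apply: setSU; apply: subsetUr.
have le2 : (lc ((E :|: [set x in c :: s]) :&: S) <=
            lc ((E :|: [set x in s]) :&: S) + 1)%N.
  rewrite eE -setUA setIUl addnC.
  by apply: leq_trans (lcU _ _) _; rewrite leq_add2r (leq_trans _ (lc1 c)) ?lcS ?subsetIl.
case: (boolP ((c \in U) && (c \notin E :|: [set x in s]))) => [/andP[cU' cE]|h].
  have cc : (#|(U :&: [set x in s]) :\: (c |: E)| + 1 <= #|(U :&: [set x in c :: s]) :\: E|)%N.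
    rewrite addn1 [ltnRHS](cardsD1 c).
    have -> : c \in (U :&: [set x in c :: s]) :\: E.
      by move: cE; rewrite !inE eqxx cU' !negb_or => /andP[->].
    rewrite add1n ltnS; apply: subset_leq_card; apply/subsetP => x.
    rewrite !inE negb_or => /andP[/andP[-> ->]] /andP[-> ->].
    by rewrite orbT.
  have dle : L E (c :: s) - L E s <= 1.
    by rewrite lerBlDr /L -[1]/(1%:R) -natrD ler_nat addnC.
  have d0 : 0 <= L E (c :: s) - L E s by rewrite subr_ge0 ler_nat.
  move: cc; rewrite -(ler_nat R) natrD => cc.
  have := IH; set q := sqincr _ _; move: d0 dle; set y := (_ - _) => d0 dle qle.
  have : y ^+ 2 <= 1 by rewrite expr_le1.
  lra.
have -> : L E (c :: s) = L E s.
  congr (_%:R); apply/eqP; rewrite eqn_leq le1 andbT.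
  rewrite {1}eE -Uo; apply: leq_lc => //; apply/subsetP => x xU.
  have := subsetP UE x xU; rewrite !inE => /andP[+ ->]; rewrite andbT => /orP[/orP[/eqP xc|->//]|->].
    by move: h; rewrite -xc xU /= negbK !inE.
  by rewrite orbT.
rewrite subrr expr0n add0r; apply: le_trans IH _; rewrite ler_nat.
apply: subset_leq_card; apply/subsetP => x; rewrite !inE negb_or.
by case/andP=> /andP[_ ->] /andP[-> ->]; rewrite orbT.
Qed.

Lemma sqincr_lc (s : seq (cell d G)) :
  sqincr (fun s => (lc ([set x in s] :&: S))%:R : R) s <=
  (lc ([set x in s] :&: S))%:R.
Proof.
have -> : sqincr (fun s => (lc ([set x in s] :&: S))%:R : R) s = sqincr (L set0) s.
  by apply: eq_sqincr => u; rewrite /L set0U.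
have [U [cU US Uo]] := lc_ex ([set x in s] :&: S).
apply: le_trans (sqincr_lc_le cU _ _) _; rewrite ?set0U //.
by rewrite setD0 -Uo ler_nat; apply: subset_leq_card; apply: subsetIl.
Qed.

End SelfBounding.
End Chains.

(** * First moment bounds *)

Lemma hits_cons (D C : finType) (f : D -> option C) x s c :
  (c \in hits f (x :: s)) = (f x == Some c) || (c \in hits f s).
Proof. by rewrite !inE [_ == f x]eq_sym. Qed.

Lemma leq_binomial2 n k : (n ^ k.+1 + k.+1 * n ^ k <= n.+1 ^ k.+1)%N.
Proof.
elim: k => [|k IH]; first by rewrite !expn1 expn0 muln1 addn1.
rewrite [leqRHS]expnS; apply: leq_trans (leq_mul (leqnn _) IH).
rewrite 2!expnS; move: (n ^ k)%N => x; nia.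
Qed.

Lemma leq_bin_exp2 n k : ('C(n, k) <= 2 ^ n)%N.
Proof.
rewrite -{1}[n]card_ord -card_draws -[X in (_ <= 2 ^ X)%N]card_ord -cardsT.
rewrite -card_powerset; apply: subset_leq_card; apply/subsetP => A _.
by rewrite powersetT inE.
Qed.

(** A crude Stirling bound: k^k is at most the falling factorial of 2k of length k, which is C(2k,
    k) k!, and C(2k, k) is at most 2^(2k). *)
Lemma leq_expn_fact k : (k ^ k <= 4 ^ k * k`!)%N.
Proof.
have h j : (j <= k -> k ^ j <= (k + k) ^_ j)%N.
  elim: j => // j IH jk; rewrite expnSr ffactnSr; apply: leq_mul; first exact/IH/ltnW.
  by rewrite -addnBA ?leq_addr // ltnW.
apply: leq_trans (h k _) _ => //; rewrite -bin_ffact leq_mul2r; apply/orP; right.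
by rewrite -[4%N]/(2 ^ 2)%N -expnM mul2n -addnn leq_bin_exp2.
Qed.

Lemma leq_bin_expn a k : ('C(a, k) * k ^ k <= (4 * a) ^ k)%N.
Proof.
apply: leq_trans (leq_mul (leqnn _) (leq_expn_fact k)) _.
rewrite mulnCA bin_ffact expnMn leq_mul2l; apply/orP; right.
rewrite ffact_prod -[k in (_ ^ k)%N]card_ord -prod_nat_const.
by apply: leq_prod => i _; apply: leq_subr.
Qed.

(** Induction on the length: either the rest of the word hits all of U, or the first letter supplies
    one missing cell c and the rest hits [U :\ c]. The two contributions are the first two terms in
    the expansion of ((n + 1) F)^#|U|. *)
Lemma prob_hits (R : realFieldType) (D C : finType) (p : D -> R)
    (f : D -> option C) (F : R) (n : nat) (U : {set C}) :
  (forall x, 0 <= p x) -> \sum_x p x = 1 -> 0 <= F ->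
  (forall c, \sum_(x | f x == Some c) p x <= F) ->
  Prw p n (fun s => U \subset hits f s) <= (n%:R * F) ^+ #|U|.
Proof.
move=> p0 p1 F0 pF; elim: n U => [|n IH] U.
  rewrite mul0r /Prw /=; have -> : hits f [::] = set0 by apply/setP => c; rewrite !inE.
  by rewrite subset0; case: eqP => [->|_]; rewrite ?cards0 ?expr0 // exprn_ge0.
pose Q (V : {set C}) := Prw p n (fun s => V \subset hits f s).
have step : Prw p n.+1 (fun s => U \subset hits f s) <=
    Q U + \sum_(c in U) F * Q (U :\ c).
  apply: (@le_trans _ _ (\sum_x p x * (Q U + \sum_(c in U | f x == Some c) Q (U :\ c)))).
    apply: ler_sum => x _; apply: ler_wpM2l => //; rewrite -Ew_sum -EwD.
    apply: le_Ew => // s _.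
    case: (boolP (U \subset hits f s)) => [h|h].
      by rewrite (le_trans (y := 1)) ?lerDl ?sumr_ge0 //; case: (_ \subset _).
    case: (boolP (U \subset _)) => [|_]; last by rewrite addr_ge0 // sumr_ge0.
    move=> /subsetP UU; case/subsetPn: h => c cU cs.
    have fx : f x == Some c.
      by have := UU c cU; rewrite hits_cons (negbTE cs) orbF.
    rewrite add0r (bigD1 c) /= ?cU // (_ : _ \subset _); first by rewrite lerDl sumr_ge0.
    apply/subsetP => c'; rewrite !inE => /andP[cc' /UU].
    rewrite hits_cons inE (eqP fx) => /orP[/eqP[e]|//].
    by rewrite e eqxx in cc'.
  under eq_bigr do rewrite mulrDr mulr_sumr.
  rewrite big_split /= -mulr_suml p1 mul1r lerD2l.
  rewrite (exchange_big_dep (mem U)) /=; last by move=> x c _ /andP[].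
  apply: ler_sum => c cU; rewrite cU /= -mulr_suml ler_wpM2r //.
  exact: Prw_ge0.
apply: le_trans step _; case k: #|U| => [|k'].
  rewrite (cards0_eq k) big_set0 addr0 (le_trans (IH _)) //.
  by rewrite cards0 !expr0.
apply: (@le_trans _ _ ((n%:R * F) ^+ k'.+1 + \sum_(c in U) F * (n%:R * F) ^+ k')).
  apply: lerD; first by rewrite -k; apply: IH.
  apply: ler_sum => c cU; apply: ler_wpM2l => //.
  have -> : k' = #|U :\ c| by move: k; rewrite (cardsD1 c) cU add1n => -[].
  exact: IH.
rewrite sumr_const k !exprMn [F ^+ k'.+1]exprS.
have -> : n%:R ^+ k'.+1 * (F * F ^+ k') + F * (n%:R ^+ k' * F ^+ k') *+ k'.+1 =
   (n ^ k'.+1 + k'.+1 * n ^ k')%:R * (F * F ^+ k') :> R.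
  rewrite natrD natrM !natrX -mulr_natl; ring.
rewrite -natrX ler_wpM2r ?mulr_ge0 ?exprn_ge0 // ler_nat.
exact: leq_binomial2.
Qed.

Section ChainCount.
Variables (d G : nat).
Hypothesis d_gt0 : (0 < d)%N.
Implicit Types (U V : {set cell d G}) (c : cell d G).

Definition box (I : 'I_d -> {set 'I_G}) : {set cell d G} :=
  [set c : cell d G | [forall i, c i \in I i]].

Let proj i U : {set 'I_G} := [set c i | c : cell d G in U].

Lemma chain_coord_inj U i : chain U -> {in U &, injective (fun c : cell d G => c i)}.
Proof.
move=> /chainP cU a b aU bU e; apply/eqP/negPn/negP => /(cU a b aU bU).
by case/orP => /forallP/(_ i); rewrite e ltnn.
Qed.

Let chain_rank U i c : chain U -> c \in U ->
  #|[set v in proj i U | (v < c i)%N]| = #|[set b in U | slt b c]|.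
Proof.
move=> cU cc; rewrite -(@card_in_imset _ _ (fun c : cell d G => c i)
  [set b in U | slt b c]); last first.
  by move=> a b; rewrite !inE => /andP[aU _] /andP[bU _]; apply: (chain_coord_inj cU).
apply: eq_card => v; rewrite !inE; apply/andP/imsetP => [[/imsetP[b bU ->] bc]|].
  exists b => //; rewrite inE bU /=.
  have bnc : b != c by apply: contraTneq bc => ->; rewrite ltnn.
  move/chainP: cU => /(_ b c bU cc bnc)/orP[//|/forallP/(_ i)].
  by rewrite ltnNge ltnW.
case=> b; rewrite inE => /andP[bU /forallP/(_ i) bc] ->; split => //.
by apply/imsetP; exists b.
Qed.

(* A chain is determined by its d coordinate projections: the r-th element of
   the chain has as coordinates the r-th elements of the projections. *)
Lemma chain_proj_inj U V : chain U -> chain V ->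
  (forall i, proj i U = proj i V) -> U \subset V.
Proof.
move=> cU cV e; apply/subsetP => c cc.
pose i0 := Ordinal d_gt0.
have : c i0 \in proj i0 V by rewrite -e; apply/imsetP; exists c.
case/imsetP => c' c'V e0; suff -> : c = c' by [].
apply/ffunP => i.
have rk : #|[set v in proj i U | (v < c i)%N]| = #|[set v in proj i U | (v < c' i)%N]|.
  by rewrite (chain_rank _ cU cc) -(chain_rank i0 cU cc) (e i) (chain_rank _ cV c'V)
     -(chain_rank i0 cV c'V) e e0.
have ci : c i \in proj i U by apply/imsetP; exists c.
have c'i : c' i \in proj i U by rewrite e; apply/imsetP; exists c'.
have key (x y : 'I_G) : x \in proj i U -> (x < y)%N ->
  (#|[set v in proj i U | (v < x)%N]| < #|[set v in proj i U | (v < y)%N]|)%N.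
  move=> xU xy; apply: proper_card; apply/properP; split.
    by apply/subsetP => v; rewrite !inE => /andP[-> vx]; apply: ltn_trans xy.
  by exists x; rewrite inE ?xU ?xy // ltnn andbF.
apply: val_inj; case: (ltngtP (c i) (c' i)) => // lt.
  by have := key _ _ ci lt; rewrite rk ltnn.
by have := key _ _ c'i lt; rewrite rk ltnn.
Qed.

(** The projections send these chains to tuples of k-subsets of the sets I i, injectively by
    [chain_proj_inj]. *)
Lemma card_chains (I : 'I_d -> {set 'I_G}) k :
  (#|[set U : {set cell d G} | [&& chain U, U \subset box I & #|U| == k]]| <=
   \prod_i 'C(#|I i|, k))%N.
Proof.
pose P i := [set A : {set 'I_G} | (A \subset I i) && (#|A| == k)].
have -> : (\prod_i 'C(#|I i|, k) =
    #|family (fun i : 'I_d => mem (P i))|)%N.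
  rewrite card_family foldrE big_map big_enum /=.
  by apply: eq_bigr => i _; rewrite -cards_draws.
pose g U : {ffun 'I_d -> {set 'I_G}} := [ffun i => proj i U].
rewrite -(@card_in_imset _ _ g).
  apply: subset_leq_card; apply/subsetP => A /imsetP[U]; rewrite inE.
  case/and3P=> cU /subsetP UI /eqP Uk ->; apply/familyP => i; rewrite ffunE inE.
  rewrite -Uk card_in_imset ?eqxx ?andbT; last exact: chain_coord_inj.
  apply/subsetP => v /imsetP[c /UI]; rewrite inE => /forallP h ->; exact: h.
move=> U V; rewrite !inE => /and3P[cU _ _] /and3P[cV _ _] /ffunP e.
have {}e i : proj i U = proj i V by have := e i; rewrite !ffunE.
by apply/eqP; rewrite eqEsubset !chain_proj_inj.
Qed.

Lemma lc_geqP k (E : {set cell d G}) : (k <= lc E)%N ->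
  exists U, [/\ chain U, U \subset E & #|U| = k].
Proof.
have [U [cU UE <-]] := lc_ex E => /card_geqP[s [us <- sU]].
exists [set x in s]; have sE : [set x in s] \subset U.
  by apply/subsetP => x; rewrite inE; apply: sU.
split; [exact: chainS cU|exact: subset_trans UE|].
by rewrite cardsE; apply/card_uniqP.
Qed.

Variables (R : realFieldType) (D : finType) (p : D -> R) (f : D -> option (cell d G)).
Hypotheses (p_ge0 : forall x, 0 <= p x) (p_sum1 : \sum_x p x = 1).

(** First moment over the chains with k elements, using C(a, k) <= (4a/k)^k in each coordinate. The
    constant 8 is 4 * 2: the factor 4^d pays for the binomials, and the factor 2^d leaves 2^(-d) <=
    1/2 per element of the chain. *)
Lemma lc_tail (F : R) (I : 'I_d -> {set 'I_G}) n k :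
  0 <= F -> (forall c, \sum_(x | f x == Some c) p x <= F) ->
  8 ^+ d * (n%:R * F * \prod_i #|I i|%:R) <= k%:R ^+ d ->
  Prw p n (fun s => (k <= lc (hits f s :&: box I))%N) <= 2^-1 ^+ k.
Proof.
move=> F0 pF hk.
case: k hk => [|k] hk.
  by rewrite expr0 -(Ew_cst p_sum1 n 1); apply: le_Ew.
set K := k.+1 in hk *.
pose W := [set U : {set cell d G} | [&& chain U, U \subset box I & #|U| == K]].
apply: (@le_trans _ _ (\sum_(U in W) Prw p n (fun s => U \subset hits f s))).
  rewrite -Ew_sum; apply: le_Ew => // s _.
  case: (boolP (K <= lc _)%N) => [|_]; last by apply: sumr_ge0.
  move/lc_geqP => [U [cU /subsetIP[UE UI] UK]].
  by rewrite (bigD1 U) ?inE ?cU ?UI ?UK //= UE lerDl sumr_ge0.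
apply: (@le_trans _ _ (\sum_(U in W) (n%:R * F) ^+ K)).
  apply: ler_sum => U; rewrite inE => /and3P[_ _ /eqP UK].
  by rewrite -UK; apply: prob_hits.
rewrite sumr_const -[leLHS]mulr_natl.
apply: (@le_trans _ _ ((\prod_i 'C(#|I i|, K))%:R * (n%:R * F) ^+ K)).
  by apply: ler_wpM2r; rewrite ?exprn_ge0 ?mulr_ge0 // ler_nat card_chains.
rewrite natr_prod; set X := \prod_i _.
have X0 : 0 <= X by apply: prodr_ge0.
have XK : X * K%:R ^+ d ^+ K <= 4 ^+ d ^+ K * (\prod_i #|I i|%:R) ^+ K.
  rewrite -[d in K%:R ^+ d]card_ord -[d in 4 ^+ d]card_ord.
  rewrite exprAC [4 ^+ _ ^+ _]exprAC -prodr_const -[4 ^+ K ^+ _]prodr_const.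
  rewrite -prodrXl -!big_split /=; apply: ler_prod => i _.
  rewrite mulr_ge0 ?exprn_ge0 //=.
  by rewrite -exprMn -!natrX -!natrM -natrX ler_nat leq_bin_expn.
have K0 : 0 < K%:R ^+ d ^+ K :> R by rewrite !exprn_gt0 // ltr0n.
rewrite -(ler_pM2r K0).
rewrite mulrAC; apply: (le_trans (ler_wpM2r _ XK)); first by rewrite exprn_ge0 ?mulr_ge0.
rewrite -!exprMn; apply: (@le_trans _ _ ((2^-1 ^+ d * K%:R ^+ d) ^+ K)).
  apply: lerXn2r; rewrite ?nnegrE ?mulr_ge0 ?exprn_ge0 ?prodr_ge0 ?invr_ge0 //.
  have -> : 4 ^+ d = 2^-1 ^+ d * 8 ^+ d :> R by rewrite -exprMn; congr (_ ^+ d); lra.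
  rewrite -!mulrA ler_wpM2l ?exprn_ge0 ?invr_ge0 //.
  by rewrite [\prod_i _ * _]mulrC mulrA in hk *.
rewrite !exprMn ler_wpM2r ?exprn_ge0 // lerXn2r ?nnegrE ?exprn_ge0 ?invr_ge0 //.
by rewrite -[leRHS]expr1 ler_wiXn2l ?invr_ge0 // invf_le1 // ler1n.
Qed.

(** The mean is at most k plus the sum of the tails above k; the condition of [lc_tail] persists for
    larger k, so these tails form a geometric series of sum at most 1. *)
Lemma Ew_lc (F : R) (I : 'I_d -> {set 'I_G}) n k :
  0 <= F -> (forall c, \sum_(x | f x == Some c) p x <= F) ->
  8 ^+ d * (n%:R * F * \prod_i #|I i|%:R) <= k%:R ^+ d ->
  Ew p n (fun s => (lc (hits f s :&: box I))%:R) <= k%:R + 1.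
Proof.
move=> F0 pF hk.
pose N := #|cell d G|.
apply: (@le_trans _ _ (Ew p n (fun s => k%:R + \sum_(j < N)
   (k + j < lc (hits f s :&: box I))%N%:R))).
  apply: le_Ew => // s _; rewrite -natr_sum -natrD ler_nat.
  set l := lc _; have lN : (l <= N)%N.
    by apply: leq_trans (lc_leq_card _) _; apply: max_card.
  rewrite -leq_subLR; move: lN; move: l => l lN.
  rewrite -big_mkcond /= sum1_card; apply: leq_trans (_ : (#|'I_(l - k)| <= _)%N).
    by rewrite card_ord.
  have lk : (l - k <= N)%N by apply: leq_trans (leq_subr _ _) lN.
  have winj : injective (widen_ord lk) by move=> i j /(congr1 val) /= /val_inj.
  rewrite -(card_codom winj).
  apply: subset_leq_card; apply/subsetP => j /codomP[i ->].
  by rewrite unfold_in /=; have := ltn_ord i; lia.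
rewrite EwD Ew_cst // Ew_sum lerD2l.
apply: (@le_trans _ _ (\sum_(j < N) 2^-1 ^+ (j.+1))).
  apply: ler_sum => j _; apply: le_trans (lc_tail (k := (k + j).+1) F0 pF _) _.
    apply: (le_trans hk); rewrite lerXn2r ?nnegrE // ler_nat; lia.
  rewrite ler_wiXn2l ?invr_ge0 ?invf_le1 ?ler1n //; lia.
suff -> : \sum_(j < N) 2^-1 ^+ j.+1 = 1 - 2^-1 ^+ N :> R.
  by rewrite gerBl exprn_ge0 // invr_ge0.
elim: N => [|N IH]; first by rewrite big_ord0 expr0 subrr.
by rewrite big_ord_recr /= IH exprS; field.
Qed.

End ChainCount.

(** * Deformation of chains *)

Section Deformation.
Local Open Scope nat_scope.
Variables (d G w q m : nat).
Hypotheses (d_gt0 : 0 < d) (w_gt0 : 0 < w) (q_gt0 : 0 < q) (GE : G = w * q * m).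
Implicit Types (U V : {set cell d G}) (a b c : cell d G).

(** Three scales on each edge of the cube: w cells form a slab, q slabs a macroscopic box, m boxes
    the edge. *)
Definition slab (i : 'I_d) (j : nat) : {set cell d G} := [set c : cell d G | c i %/ w == j].

Definition macro c (i : 'I_d) : nat := c i %/ (w * q).

(** Neither in the first nor in the last slab of its box in any direction, which leaves room for a
    shift by fewer than w cells. *)
Definition interior_cell c := [forall i, 0 < (c i %/ w) %% q < q.-1].

Definition below (y : 'I_d -> nat) : {set cell d G} :=
  [set c : cell d G | [forall i, c i < w * y i]].

Lemma macro_lt c i : macro c i < m.
Proof. by rewrite /macro ltn_divLR ?muln_gt0 ?w_gt0 // mulnC -GE ltn_ord. Qed.

(** Nondecreasing along a chain, constant only while the box stays the same ([rk_eq]), and at most d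
    * m: this bounds the number of box changes along a chain. *)
Let rk c := \sum_i macro c i.

Let rk_le c : rk c <= d * m.
Proof.
rewrite -{1}[d]card_ord -sum_nat_const; apply: leq_sum => i _.
exact/ltnW/macro_lt.
Qed.

Let macro_mono a b i : slt a b -> macro a i <= macro b i.
Proof. by move/forallP/(_ i)/ltnW => ab; apply: leq_div2r. Qed.

Let rk_mono a b : slt a b -> rk a <= rk b.
Proof. by move=> ab; apply: leq_sum => i _; apply: macro_mono. Qed.

Let rk_eq a b : slt a b -> rk a = rk b -> macro a =1 macro b.
Proof.
move=> ab e i; have /leqif_sum : forall i, true ->
  macro a i <= macro b i ?= iff (macro a i == macro b i).
  by move=> k _; apply/leqifP; case: eqP => // /eqP ne; rewrite ltn_neqAle ne macro_mono.
by case=> _; rewrite -/(rk a) -/(rk b) e eqxx => /esym/forallP/(_ i)/eqP.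
Qed.

(* The chain is cut at each change of macroscopic box: the points of the new box
   that are too close to the lower-rank part of the chain are dropped; they lie
   in few thin axis-parallel slabs, and the remaining points stay ordered after
   the different boxes are shifted independently. *)
Lemma chain_deformation (Phi : cell d G -> cell d G) (tau k : nat)
    (y : 'I_d -> nat) U :
  2 * tau < w ->
  (forall c i, c \in U -> Phi c i <= c i + tau) ->
  (forall c i, c \in U -> c i <= Phi c i + tau) ->
  (forall a b, a \in U -> b \in U -> macro a =1 macro b -> slt a b ->
     slt (Phi a) (Phi b)) ->
  chain U -> U \subset below y ->
  (forall i j, #|U :&: slab i j| <= k) ->
  exists V, [/\ chain V, V \subset Phi @: U, V \subset below y &
    #|U| <= #|V| + (2 * d * (d * m).+1 + d) * k].
Proof.
move=> tw up dn ord cU Uy Uk.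
(* [e v i] is the height in direction i reached by the part of the chain of rank less than v. [D1]
   collects the points of rank v that two displacements by tau could bring level with that part,
   [D2] the points that could leave [below y]. *)
pose e v i := \max_(c in U | rk c < v) c i.
pose D1 i v := [set c in U | (rk c == v) && (c i <= e v i + 2 * tau)].
pose D2 i := [set c in U | w * y i <= c i + tau].
pose B := (\bigcup_i \bigcup_(v < (d * m).+1) D1 i v) :|: \bigcup_i D2 i.
pose U1 := U :\: B.
(* A window of 2 tau + 1 <= w consecutive cells meets at most two slabs. *)
have win i x : #|[set c in U | x <= c i <= x + 2 * tau]| <= 2 * k.
  apply: (@leq_trans #|(U :&: slab i (x %/ w)) :|: (U :&: slab i (x %/ w).+1)|).
    apply: subset_leq_card; apply/subsetP => c; rewrite !inE => /andP[-> /andP[xc cx]] /=.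
    have h1 := leq_div2r w xc.
    have h2 : c i %/ w <= (x %/ w).+1.
      have -> : (x %/ w).+1 = (x + w) %/ w by rewrite divnDr // divnn w_gt0 addn1.
      apply: leq_div2r; lia.
    lia.
  apply: leq_trans (leq_card_setU _ _) _; rewrite mul2n -addnn.
  by apply: leq_add; apply: Uk.
have D1k i v : #|D1 i v| <= 2 * k.
  apply: leq_trans (win i (e v i)); apply: subset_leq_card; apply/subsetP => c.
  rewrite !inE => /andP[cc /andP[/eqP rc ->]]; rewrite cc andbT /=.
  apply/bigmax_leqP => a /andP[aU ra].
  have ac : a != c by apply: contraTneq ra => ->; rewrite rc ltnn.
  move/chainP: cU => /(_ a c aU cc ac)/orP[/forallP/(_ i)/ltnW //|/rk_mono].
  by rewrite rc leqNgt ra.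
(* Below the threshold w * y i but within tau < w of it: all these points are in the slab just under
   it. *)
have D2k i : #|D2 i| <= k.
  apply: leq_trans (Uk i (y i).-1); apply: subset_leq_card; apply/subsetP => c.
  rewrite !inE => /andP[cc h]; rewrite cc /=.
  have := subsetP Uy c cc; rewrite inE => /forallP/(_ i) lt.
  case: (y i) h lt => [|y'] h lt; first by rewrite muln0 in lt.
  have wy : y' * w <= c i by rewrite mulnS in h; lia.
  rewrite eqn_leq leq_divRL // wy andbT -ltnS ltn_divLR //.
  by rewrite mulnC.
have Bk : #|B| <= (2 * d * (d * m).+1 + d) * k.
  apply: leq_trans (leq_card_setU _ _) _; rewrite mulnDl; apply: leq_add.
    apply: (@leq_trans (\sum_(i < d) \sum_(v < (d * m).+1) 2 * k)).
      elim/big_ind2: _ => [|A n A' n' h h'|i _]; first by rewrite cards0.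
        exact: leq_trans (leq_card_setU _ _) (leq_add h h').
      elim/big_ind2: _ => [|A n A' n' h h'|v _]; first by rewrite cards0.
        exact: leq_trans (leq_card_setU _ _) (leq_add h h').
      exact: D1k.
    by rewrite !sum_nat_const !card_ord; lia.
  apply: (@leq_trans (\sum_(i < d) k)).
    elim/big_ind2: _ => [|A n A' n' h h'|i _]; first by rewrite cards0.
      exact: leq_trans (leq_card_setU _ _) (leq_add h h').
    exact: D2k.
  by rewrite sum_nat_const card_ord.
have U1U c : c \in U1 -> c \in U by rewrite inE => /andP[].
have key a b : a \in U1 -> b \in U1 -> slt a b -> slt (Phi a) (Phi b).
  move=> aU bU ab; have [lt|ge] := ltnP (rk a) (rk b); last first.
    apply: ord => //; try exact: U1U.
    by apply: rk_eq => //; apply/eqP; rewrite eqn_leq rk_mono.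
  apply/forallP => i.
  have ae : a i <= e (rk b) i.
    by apply: (leq_bigmax_cond a); rewrite U1U.
  have be : e (rk b) i + 2 * tau < b i.
    have bU' := U1U _ bU.
    rewrite ltnNge; apply: contraTN bU => h; rewrite !inE negb_and; apply/orP; left.
    rewrite negbK; apply/orP; left; apply/bigcupP; exists i => //.
    apply/bigcupP; exists (Ordinal (rk_le b : rk b < (d * m).+1)) => //.
    by rewrite inE bU' eqxx.
  have := up a i (U1U _ aU); have := dn b i (U1U _ bU); lia.
have sltI a b : slt a b -> a != b.
  by move/forallP/(_ (Ordinal d_gt0)); apply: contraTneq => ->; rewrite ltnn.
have pinj : {in U1 &, injective Phi}.
  move=> a b aU bU e'; apply/eqP/negPn/negP => ab.
  move/chainP: cU => /(_ a b (U1U _ aU) (U1U _ bU) ab)/orP[|] /key.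
    by move=> /(_ aU bU)/sltI; rewrite e' eqxx.
  by move=> /(_ bU aU)/sltI; rewrite e' eqxx.
exists (Phi @: U1); split.
- apply/chainP => _ _ /imsetP[a aU ->] /imsetP[b bU ->] ab.
  have {}ab : a != b by apply: contraNneq ab => ->.
  by move/chainP: cU => /(_ a b (U1U _ aU) (U1U _ bU) ab)/orP[|] /key -> //; rewrite orbT.
- by apply: imsetS; apply: subsetDl.
- apply/subsetP => _ /imsetP[a aU ->]; rewrite inE; apply/forallP => i.
  have : a i + tau < w * y i.
    have aU' := U1U _ aU.
    rewrite ltnNge; apply: contraTN aU => h; rewrite !inE negb_and; apply/orP; left.
    rewrite negbK; apply/orP; right; apply/bigcupP; exists i => //.
    by rewrite inE aU'.
  by apply: leq_ltn_trans; apply: up; apply: U1U.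
- rewrite card_in_imset // -(cardsID B U) addnC leq_add2l.
  by apply: leq_trans Bk; apply: subset_leq_card; apply: subsetIr.
Qed.

End Deformation.

(** * Coupling *)

(** The mass min(p a, q (Phi a)) is put on the pair (a, Phi a) for each good a, and the residual
    masses [pr] and [qr], of equal total S, are coupled independently. For a good a the unmatched
    mass is at most [pr a], hence at most eps. *)
Lemma partial_matching_coupling (R : realFieldType) (C : finType) (p q : C -> R)
    (good : pred C) (Phi : C -> C) (eps : R) :
  (forall c, 0 <= p c) -> (forall c, 0 <= q c) ->
  \sum_c p c = 1 -> \sum_c q c = 1 ->
  {in good &, injective Phi} -> 0 <= eps ->
  (forall c, good c -> p c <= q (Phi c) + eps) ->
  exists pi : C * C -> R,
    [/\ forall x, 0 <= pi x, forall a, \sum_b pi (a, b) = p a,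
        forall b, \sum_a pi (a, b) = q b &
        forall a, good a -> \sum_(b | b != Phi a) pi (a, b) <= eps].
Proof.
move=> p0 q0 p1 q1 inj eps0 pq.
pose mn a := if good a then Num.min (p a) (q (Phi a)) else 0.
pose pr a := p a - mn a.
pose qr b := q b - \sum_(a | Phi a == b) mn a.
have mn0 a : 0 <= mn a by rewrite /mn; case: ifP; rewrite // le_min p0 q0.
have pr0 a : 0 <= pr a.
  by rewrite subr_ge0 /mn; case: ifP => // _; rewrite ge_min lexx.
have qr0 b : 0 <= qr b.
  rewrite subr_ge0 (bigID good) /= [X in _ + X]big1 ?addr0; last first.
    by move=> a /andP[_ /negbTE ga]; rewrite /mn ga.
  case: (pickP (fun a => (Phi a == b) && good a)) => [a /andP[/eqP ab ga]|h]; last first.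
    by rewrite big_pred0.
  rewrite (bigD1 a) /=; last by rewrite ab eqxx.
  rewrite big1 => [|a' /andP[/andP[/eqP a'b ga'] a'a]]; last first.
    by case/eqP: a'a; apply: inj => //; rewrite ab.
  by rewrite addr0 /mn ga ab ge_min lexx orbT.
pose S := \sum_a pr a.
have Sq : \sum_b qr b = S.
  rewrite /S /qr /pr !sumrB p1 q1; congr (_ - _).
  by rewrite [RHS](partition_big Phi predT).
pose pi (x : C * C) := mn x.1 * (x.2 == Phi x.1)%:R + pr x.1 * qr x.2 / S.
have S0 : 0 <= S by apply: sumr_ge0.
(* If S = 0 all residual masses vanish, so dividing by S is harmless. *)
have prS a : pr a * S / S = pr a.
  have [/eqP|Sn] := eqVneq S 0; last by rewrite mulfK.
  by rewrite psumr_eq0 // => /allP/(_ a (mem_index_enum a))/eqP ->; rewrite !mul0r.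
have qrS b : S * qr b / S = qr b.
  have [/eqP|Sn] := eqVneq S 0; last by rewrite mulrAC mulfV ?mul1r.
  by rewrite -Sq psumr_eq0 // => /allP/(_ b (mem_index_enum b))/eqP ->; rewrite mulr0 mul0r.
exists pi; split.
- by move=> x; rewrite addr_ge0 ?mulr_ge0 ?invr_ge0 //.
- move=> a; rewrite /pi /= big_split /= -mulr_suml -[X in _ + X / _]mulr_sumr Sq prS.
  rewrite -mulr_sumr (bigD1 (Phi a)) //= eqxx big1 ?addr0 ?mulr1 /pr; first by rewrite addrC subrK.
  by move=> b /negbTE ->.
- move=> b; rewrite /pi /= big_split /= -!mulr_suml qrS /qr.
  rewrite [X in X + _](_ : _ = \sum_(a | Phi a == b) mn a); first by rewrite addrC subrK.
  by rewrite [RHS]big_mkcond; apply: eq_bigr => a _; rewrite eq_sym; case: eqP; rewrite ?mulr1 ?mulr0.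
- move=> a ga; apply: (@le_trans _ _ (\sum_b pr a * qr b / S)).
    rewrite [leRHS](bigID (fun b => b != Phi a)) /= -[leLHS]addr0; apply: lerD.
      by apply: ler_sum => b /negbTE bP; rewrite /pi /= bP mulr0 add0r.
    by apply: sumr_ge0 => b _; rewrite !mulr_ge0 ?invr_ge0.
  rewrite -mulr_suml -mulr_sumr Sq prS /pr /mn ga lerBlDr.
  by rewrite [eps + _]addrC addr_minl le_min pq // lerDl eps0.
Qed.

(** * Translation of cells, box by box *)

Section Shift.
Local Open Scope nat_scope.
Variables (d G w q m tau : nat).
Hypotheses (w_gt0 : 0 < w) (q_gt0 : 0 < q) (GE : G = w * q * m) (tauw : 2 * tau < w).
Variable T : {ffun 'I_d -> nat} -> 'I_d -> nat.
Hypothesis T_le : forall M i, T M i <= 2 * tau.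
Implicit Types (a b c : cell d G).

Definition macrof c : {ffun 'I_d -> nat} := [ffun i => macro w q c i].

(* On interior cells this is the translation by the vector [T (macrof c) - tau],
   which depends only on the macroscopic box. *)
Definition shift_cell c : cell d G :=
  [ffun i => insubd (c i) (c i + T (macrof c) i - tau)].

Lemma interior_bounds c i : interior_cell w q c ->
  macro w q c i * (w * q) + w <= c i /\ c i + w < (macro w q c i).+1 * (w * q).
Proof.
clear q_gt0 GE tauw T_le; move=> /forallP/(_ i); rewrite /macro divnMA.
set s := c i %/ w; move=> /andP[s0 s1].
have e : s = s %/ q * q + s %% q by rewrite -divn_eq.
have ce : c i = s * w + c i %% w :> nat by rewrite -divn_eq.
have cw : c i %% w < w by rewrite ltn_mod.
move: e s0 s1 ce cw; set A := s %/ q; set B := s %% q => e s0 s1 ce cw.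
have Bw : w <= B * w by rewrite leq_pmull.
have qw : (B + 2) * w <= q * w by rewrite leq_mul2r; apply/orP; right; lia.
have eA : A * (w * q) = A * q * w by rewrite mulnCA mulnA mulnC mulnA mulnC mulnA.
rewrite mulSn eA [w * q]mulnC ce e mulnDl; split; lia.
Qed.

(** An interior cell is at least w > 2 tau cells away from the faces of its box, so neither the
    default value of [insubd] nor the truncation of the subtraction occurs. *)
Lemma shift_cellE c i : interior_cell w q c ->
  shift_cell c i = c i + T (macrof c) i - tau :> nat /\ tau <= c i.
Proof.
move=> ci; have [h1 h2] := interior_bounds i ci.
have := T_le (macrof c) i; move=> hT; have mc := macro_lt w_gt0 q_gt0 GE c i.
have hG : (macro w q c i).+1 * (w * q) <= G by rewrite [leqRHS]GE [leqRHS]mulnC leq_mul2r mc orbT.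
rewrite ffunE; split; last by lia.
by rewrite insubdK // unfold_in; lia.
Qed.

Lemma macrof_shift c : interior_cell w q c -> macrof (shift_cell c) = macrof c.
Proof.
move=> ci; apply/ffunP => i; rewrite !ffunE /macro -/(macro w q c i).
have [-> h0] := shift_cellE i ci; have [h1 h2] := interior_bounds i ci.
have := T_le (macrof c) i; set M := macro w q c i in h1 h2 *; move=> hT.
apply/eqP; rewrite eqn_leq -ltnS ltn_divLR ?leq_divRL ?muln_gt0 ?w_gt0 //.
by apply/andP; split; lia.
Qed.

(** The image stays in the same box, so the translation vector can be read off from it and
    undone. *)
Lemma shift_cell_inj : {in interior_cell w q &, injective shift_cell}.
Proof.
move=> a b ai bi e; have eM : macrof a = macrof b by rewrite -macrof_shift // e macrof_shift.
apply/ffunP => i; apply/val_inj => /=.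
have [ha h0a] := shift_cellE i ai; have [hb h0b] := shift_cellE i bi.
by move: ha hb; rewrite e eM => -> ; lia.
Qed.

Lemma shift_cell_slt a b : interior_cell w q a -> interior_cell w q b ->
  macrof a = macrof b -> slt a b -> slt (shift_cell a) (shift_cell b).
Proof.
move=> ai bi e /forallP ab; apply/forallP => i.
have [ha h0a] := shift_cellE i ai; have [hb h0b] := shift_cellE i bi.
by rewrite ha hb e; have := ab i; lia.
Qed.

End Shift.

(** * Comparison of two cell laws *)

Lemma hits_Some (C : finType) (s : seq C) : hits Some s = [set x in s].
Proof. by apply/setP => c; rewrite !inE mem_map // => a b []. Qed.

Section SlabTail.
Variables (R : realFieldType) (d G w : nat).
Hypotheses (d_gt0 : (0 < d)%N) (w_gt0 : (0 < w)%N).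
Variables (D : finType) (p : D -> R) (f : D -> option (cell d G)).
Hypotheses (p_ge0 : forall x, 0 <= p x) (p_sum1 : \sum_x p x = 1).
Variable F : R.
Hypotheses (F_ge0 : 0 <= F) (pF : forall c, \sum_(x | f x == Some c) p x <= F).

Lemma box_setT : box (fun _ : 'I_d => [set: 'I_G]) = setT.
Proof. by apply/setP => c; rewrite !inE; apply/forallP => i; rewrite inE. Qed.

Lemma lc_tail_cube n k : 8 ^+ d * (n%:R * F * G%:R ^+ d) <= k%:R ^+ d ->
  Prw p n (fun s => (k <= lc (hits f s))%N) <= 2^-1 ^+ k.
Proof.
move=> hk; rewrite /Prw (@eq_Ew _ _ _ _ _
  (fun s => (k <= lc (hits f s :&: box (fun=> setT)))%N%:R)); last first.
  by move=> s _; rewrite box_setT setIT.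
apply: (lc_tail d_gt0 p_ge0 p_sum1 F_ge0 pF).
by rewrite prodr_const cardsT !card_ord.
Qed.

Lemma card_slab_coord j : (#|[set v : 'I_G | v %/ w == j]| <= w)%N.
Proof.
rewrite -[leqRHS]card_ord.
pose g (v : 'I_G) : 'I_w := Ordinal (ltn_pmod v w_gt0).
rewrite -(@card_in_imset _ _ g); first exact: max_card.
move=> a b; rewrite !inE => /eqP ja /eqP jb /(congr1 val) /= e.
by apply: val_inj => /=; rewrite (divn_eq a w) (divn_eq b w) ja jb e.
Qed.

Lemma lc_tail_slab n k i j : 8 ^+ d * (n%:R * F * (w%:R * G%:R ^+ d.-1)) <= k%:R ^+ d ->
  Prw p n (fun s => (k <= lc (hits f s :&: slab G w i j))%N) <= 2^-1 ^+ k.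
Proof.
move=> hk; pose I i' := if i' == i then [set v : 'I_G | v %/ w == j]%N else setT.
have -> : slab G w i j = box I.
  apply/setP => c; rewrite !inE; apply/idP/forallP => [h i'|/(_ i)].
    by rewrite /I; case: eqP => [->|]; rewrite inE.
  by rewrite /I eqxx inE.
apply: (lc_tail d_gt0 p_ge0 p_sum1 F_ge0 pF); apply: le_trans hk.
do 2 (apply: ler_wpM2l; first by rewrite ?mulr_ge0 ?exprn_ge0).
rewrite (bigD1 i) //= /I eqxx.
apply: ler_pM => //; first exact: prodr_ge0; first by rewrite ler_nat card_slab_coord.
rewrite (eq_bigr (fun=> G%:R)) => [|i' /negbTE ->]; last by rewrite cardsT card_ord.
by rewrite prodr_const cardC1 card_ord.
Qed.

Lemma Ew_lc_below n k y : 8 ^+ d * (n%:R * F * G%:R ^+ d) <= k%:R ^+ d ->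
  Ew p n (fun s => (lc (hits f s :&: below G w y))%:R) <= k%:R + 1.
Proof.
move=> hk.
have -> : below G w y = box (fun i : 'I_d => [set v : 'I_G | v < w * y i]%N).
  by apply/setP => c; rewrite !inE; apply: eq_forallb => i; rewrite inE.
apply: (Ew_lc d_gt0 p_ge0 p_sum1 F_ge0 pF); apply: le_trans hk.
do 2 (apply: ler_wpM2l; first by rewrite ?mulr_ge0 ?exprn_ge0).
rewrite -[d in leRHS]card_ord -prodr_const; apply: ler_prod => i _.
by rewrite ler0n ler_nat -[leqRHS]card_ord max_card.
Qed.

End SlabTail.

Section Comparison.
Variables (R : realFieldType) (d w q m tau : nat).
Let G := (w * q * m)%N.
Hypotheses (d_gt0 : (0 < d)%N) (w_gt0 : (0 < w)%N) (q_gt0 : (0 < q)%N).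
Hypothesis tauw : (2 * tau < w)%N.
Variable T : {ffun 'I_d -> nat} -> 'I_d -> nat.
Hypothesis T_le : forall M i, (T M i <= 2 * tau)%N.
Let GE : G = (w * q * m)%N := erefl.
Let Phi : cell d G -> cell d G := @shift_cell d G w q tau T.

(** Marks the coupled pairs whose first cell is interior but whose second cell is not its shift.
    Cells that are not interior are handled through the slabs. *)
Let fN (x : cell d G * cell d G) : option (cell d G) :=
  if interior_cell w q x.1 && (x.2 != Phi x.1) then Some x.1 else None.

(* In this order: points in the slabs bordering the macroscopic boxes, points that
   the coupling does not match with their shift, points dropped by the deformation. *)
Definition chain_loss (ks kN : nat) : nat :=
  (2 * d * m * ks + kN + (2 * d * (d * m).+1 + d) * ks)%N.

(** A chain of first components splits into boundary cells [Ub], unmatched cells [Un] and matched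
    interior cells [Um]. Shifting [Um] gives second components of the same word, and
    [chain_deformation] extracts from them a chain that lost little. *)
Lemma lc_matched_words (s : seq (cell d G * cell d G)) (ks : nat) y :
  (forall i j, (lc ([set x in map fst s] :&: slab G w i j) <= ks)%N) ->
  (lc ([set x in map fst s] :&: below G w y) <=
   lc ([set x in map snd s] :&: below G w y) +
   chain_loss ks (lc (hits fN s)))%N.
Proof.
set E1 := [set x in map fst s]; set E2 := [set x in map snd s].
move=> sk; apply/lc_leqP => U cU /subsetIP[UE Uy].
pose Ub := U :\: [set c | interior_cell w q c].
pose Un := U :&: hits fN s.
pose Um := (U :&: [set c | interior_cell w q c]) :\: hits fN s.
have UU : U \subset Ub :|: Un :|: Um.
  by apply/subsetP => c cc; rewrite !inE cc; case: interior_cell => //=; case: (_ \in _).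
have Ubk : (#|Ub| <= 2 * d * m * ks)%N.
  (* The first and the last slab of each of the m layers of boxes in each direction: 2 d m slabs in
     all. *)
  pose B := \bigcup_(i < d) \bigcup_(M < m) ((E1 :&: slab G w i (M * q)) :|: (E1 :&: slab G w i (M * q + q.-1))).
  have UB : Ub \subset B.
    apply/subsetP => c; rewrite inE => /andP[+ cc]; rewrite inE negb_forall => /existsP[i ci].
    apply/bigcupP; exists i => //.
    have Mm := macro_lt w_gt0 q_gt0 GE c i.
    apply/bigcupP; exists (Ordinal Mm) => //=.
    have cE := subsetP UE c cc.
    rewrite in_setU !in_setI cE /= !inE /macro divnMA.
    move: ci; set sl := (c i %/ w)%N; have := ltn_pmod sl q_gt0; have := divn_eq sl q.
    by set r := (sl %% q)%N; set t := (_ %/ q * q)%N; lia.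
  apply: leq_trans (leq_lc (chainS (subsetDl _ _) cU) UB) _.
  apply: leq_trans (lc_bigcup _ _) _.
  apply: (@leq_trans (\sum_(i < d) \sum_(M < m) 2 * ks)); last first.
    by rewrite !sum_nat_const !card_ord; lia.
  apply: leq_sum => i _; apply: leq_trans (lc_bigcup _ _) _; apply: leq_sum => M _.
  by apply: leq_trans (lcU _ _) _; rewrite mul2n -addnn leq_add.
have Unk : (#|Un| <= lc (hits fN s))%N.
  by apply: leq_lc; [apply: chainS cU; apply: subsetIl | apply: subsetIr].
have UmU : Um \subset U by apply: subset_trans (subsetDl _ _) (subsetIl _ _).
have Umi c : c \in Um -> interior_cell w q c by rewrite !inE => /andP[_ /andP[]].
have [c i cc|c i cc|a b aU bU e|||i j|V [cV VU Vy Uk]] :=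
  @chain_deformation d G w q m d_gt0 w_gt0 q_gt0 GE Phi tau ks y Um tauw.
- by have [-> _] := shift_cellE w_gt0 q_gt0 GE tauw T_le i (Umi c cc);
    have := T_le (macrof w q c) i; lia.
- by have [-> ?] := shift_cellE w_gt0 q_gt0 GE tauw T_le i (Umi c cc); lia.
- apply: (shift_cell_slt w_gt0 q_gt0 GE tauw T_le); [exact: Umi|exact: Umi|].
  by apply/ffunP => i; rewrite !ffunE.
- exact: chainS cU.
- exact: subset_trans Uy.
- apply: leq_trans (sk i j); apply: leq_lc.
    by apply: chainS cU; apply: subset_trans (subsetIl _ _) UmU.
  by apply: setSI; apply: subset_trans UmU UE.
have VE : V \subset E2 :&: below G w y.
  rewrite subsetI Vy andbT; apply: subset_trans VU _.
  apply/subsetP => _ /imsetP[a aU ->].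
  have aE : a \in E1 by apply: (subsetP UE); apply: (subsetP UmU).
  have ai := Umi a aU; move: aU; rewrite inE => /andP[aN _].
  move: aE; rewrite inE => /mapP[[a' b] ab /= e]; rewrite -e in ab.
  suff -> : Phi a = b by rewrite inE; apply/mapP; exists (a, b).
  apply/eqP/negPn/negP => ne; case/negP: aN; rewrite inE.
  apply/mapP; exists (a, b) => //=; rewrite /fN /= ai /= eq_sym ne //.
apply: leq_trans (subset_leq_card UU) _.
apply: leq_trans (leq_card_setU _ _) _.
apply: leq_trans (leq_add (leq_card_setU _ _) (leqnn _)) _.
have := leq_lc cV VE; rewrite /chain_loss; lia.
Qed.

Variables (p p' : cell d G -> R) (F eps : R).
Hypotheses (p_ge0 : forall c, 0 <= p c) (p'_ge0 : forall c, 0 <= p' c).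
Hypotheses (p_sum1 : \sum_c p c = 1) (p'_sum1 : \sum_c p' c = 1).
Hypotheses (pF : forall c, p c <= F) (p'F : forall c, p' c <= F) (eps_ge0 : 0 <= eps).
Hypothesis pp' : forall c, interior_cell w q c -> p c <= p' (Phi c) + eps.

(** Levels for the longest chain in one slab, among the unmatched points and in the whole cube, each
    in the form required by [lc_tail]. *)
Variables (n ks kN kG : nat).
Hypothesis hks : 8 ^+ d * (n%:R * F * (w%:R * G%:R ^+ d.-1)) <= ks%:R ^+ d.
Hypothesis hkN : 8 ^+ d * (n%:R * eps * G%:R ^+ d) <= kN%:R ^+ d.
Hypothesis hkG : 8 ^+ d * (n%:R * F * G%:R ^+ d) <= kG%:R ^+ d.

Let phi y (s : seq (cell d G)) : R := (lc ([set x in s] :&: below G w y))%:R.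

Lemma lc_concentration y lam : 0 < lam ->
  Prw p' n (fun s => lam <= `|phi y s - Ew p' n (phi y)|) <= (kG%:R + 1) / lam ^+ 2.
Proof.
move=> lam0; apply: le_trans (chebyshev_word p'_ge0 p'_sum1 _ _ lam0) _.
rewrite ler_wpM2r ?invr_ge0 ?sqr_ge0 //.
apply: le_trans (efron_stein p'_ge0 p'_sum1 _ _) _.
have F0 : 0 <= F.
  rewrite leNgt; apply/negP => Fn; have := oner_neq0 R; rewrite -p'_sum1 big1 ?eqxx // => c _.
  by have := p'_ge0 c; have := p'F c; lra.
apply: le_trans (_ : Ew p' n (fun s => (lc (hits Some s :&: below G w y))%:R) <= _).
  by apply: le_Ew => // s _; rewrite hits_Some sqincr_lc.
apply: (Ew_lc_below _ d_gt0 p'_ge0 p'_sum1 F0) => [c|]; last exact: hkG.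
by rewrite (big_pred1 c).
Qed.

(** The word of law p is realised as the first components of a coupled word. Outside three rare
    events its count is at most the count of the second components plus the loss, and the latter
    count is close to its mean; the coupling disappears from the conclusion. *)
Lemma lc_comparison y lam : 0 < lam ->
  Prw p n (fun s => (chain_loss ks kN)%:R + lam + Ew p' n (phi y) <= phi y s) <=
  (d * (q * m))%:R * 2^-1 ^+ ks.+1 + 2^-1 ^+ kN.+1 + (kG%:R + 1) / lam ^+ 2.
Proof.
move=> lam0.
have F0 : 0 <= F.
  rewrite leNgt; apply/negP => Fn; have := oner_neq0 R; rewrite -p_sum1 big1 ?eqxx // => c _.
  by have := p_ge0 c; have := pF c; lra.
have inj := shift_cell_inj w_gt0 q_gt0 GE tauw T_le.
have [pi [pi0 pi1 pi2 pin]] :=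
  partial_matching_coupling p_ge0 p'_ge0 p_sum1 p'_sum1 inj eps_ge0 pp'.
have pifst a : \sum_(x | x.1 == a) pi x = p a.
  rewrite -pi1 big_mkcond.
  rewrite (eq_bigr (fun x => if x.1 == a then pi (x.1, x.2) else 0)); last by case.
  rewrite -(pair_bigA _ (fun a' b => if a' == a then pi (a', b) else 0)) /=.
  rewrite (bigD1 a) //= [X in _ + X]big1 ?addr0; first by rewrite eqxx.
  by move=> a' /negbTE ->; rewrite big1.
have pisnd b : \sum_(x | x.2 == b) pi x = p' b.
  rewrite -pi2 big_mkcond.
  rewrite (eq_bigr (fun x => if x.2 == b then pi (x.1, x.2) else 0)); last by case.
  rewrite -(pair_bigA _ (fun a b' => if b' == b then pi (a, b') else 0)) /=.
  by apply: eq_bigr => a _; rewrite -big_mkcond big_pred1_eq.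
have pisum : \sum_x pi x = 1.
  by rewrite (partition_big fst predT) //= -p_sum1; apply: eq_bigr => a _; apply: pifst.
have Ewfst (b : pred (seq (cell d G))) : Prw p n b = Prw pi n (fun s => b (map fst s)).
  rewrite /Prw (Ew_map fst pi n (fun s => (b s)%:R)).
  apply: esym; elim: n (fun s => (b s)%:R : R) => //= k IH u; apply: eq_bigr => c _.
  by rewrite pifst IH.
have Ewsnd (b : pred (seq (cell d G))) : Prw p' n b = Prw pi n (fun s => b (map snd s)).
  rewrite /Prw (Ew_map snd pi n (fun s => (b s)%:R)).
  apply: esym; elim: n (fun s => (b s)%:R : R) => //= k IH u; apply: eq_bigr => c _.
  by rewrite pisnd IH.
have hitsfst s : hits (fun x : cell d G * cell d G => Some x.1) s = [set x in map fst s].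
  by apply/setP => c; rewrite !inE (map_comp Some fst) mem_map // => a b [].
(* The exceptional events: a long chain in some slab, a long chain of unmatched points, a deviation
   of the second count from its mean. *)
pose A1 s := [exists x : 'I_d * 'I_(q * m),
  (ks.+1 <= lc (hits (fun x : cell d G * cell d G => Some x.1) s :&: slab G w x.1 x.2))%N].
pose A2 s := (kN.+1 <= lc (hits fN s))%N.
pose A3 (s : seq (cell d G * cell d G)) := lam <= `|phi y (map snd s) - Ew p' n (phi y)|.
rewrite Ewfst; apply: (@le_trans _ _ (Prw pi n (fun s => (A1 s || A2 s) || A3 s))).
  apply: le_Prw => // s _ h; apply/negPn/negP; rewrite !negb_or.
  case/andP => /andP[/existsPn n1 n2] n3.
  have sk i j : (lc ([set x in map fst s] :&: slab G w i j) <= ks)%N.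
    have [jq|jq] := ltnP j (q * m).
      by have := n1 (i, Ordinal jq); rewrite /= hitsfst -leqNgt.
    rewrite (_ : slab G w i j = set0) ?setI0; last first.
      apply/setP => c; rewrite !inE; apply/negbTE; rewrite neq_ltn.
      apply/orP; left; apply: leq_trans jq.
      by rewrite ltn_divLR // mulnC mulnA ltn_ord.
    by apply: leq_trans (lc_leq_card _) _; rewrite cards0.
  have := lc_matched_words y sk.
  have : (lc (hits fN s) <= kN)%N by rewrite -ltnS ltnNge.
  move: n3; rewrite /A3 -ltNge ltr_norml => /andP[_ n3] hN hl.
  have {}hl : (lc ([set x in map fst s] :&: below G w y) <=
      lc ([set x in map snd s] :&: below G w y) + chain_loss ks kN)%N.
    by apply: leq_trans hl _; rewrite leq_add2l /chain_loss; lia.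
  move: hl h; rewrite -(ler_nat R) natrD -/(phi y _) -/(phi y (map fst s)); lra.
apply: le_trans (PrwU pi0 _ _ _) _; apply: lerD; last first.
  by rewrite -(Ewsnd (fun s => lam <= `|phi y s - Ew p' n (phi y)|)) lc_concentration.
apply: le_trans (PrwU pi0 _ _ _) _; apply: lerD; last first.
  apply: (lc_tail_cube d_gt0 pi0 pisum eps_ge0) => [c|]; last first.
    by apply: le_trans hkN _; rewrite lerXn2r ?nnegrE // ler_nat.
  case: (boolP (interior_cell w q c)) => [ci|/negbTE ci]; last first.
    rewrite big1 // => x; rewrite /fN; case: ifP => // /andP[xi _] /eqP[xc].
    by rewrite xc ci in xi.
  apply: le_trans (pin c ci).
  rewrite [leLHS]big_mkcond.
  rewrite (eq_bigr (fun x => if (x.1 == c) && (x.2 != Phi c) then pi (x.1, x.2) else 0)); last first.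
    case=> a b _ /=; rewrite /fN /=; have [->|ac] := eqVneq a c.
      by rewrite ci /=; case: (b != Phi c) => //=; rewrite eqxx.
    case: (_ && _) => //=; have [[e]|//] := @eqP _ (Some a) (Some c).
    by rewrite e eqxx in ac.
  rewrite -(pair_bigA _ (fun a b => if (a == c) && (b != Phi c) then pi (a, b) else 0)) /=.
  rewrite (bigD1 c) //= [X in _ + X]big1 ?addr0.
    by rewrite eqxx /= -big_mkcond.
  by move=> a' /negbTE ->; rewrite big1.
apply: le_trans (Prw_exists pi0 _ _) _.
rewrite -[d in leRHS]card_ord -[(q * m)%N in leRHS]card_ord -card_prod mulr_natl -sumr_const.
apply: ler_sum => x _.
apply: (lc_tail_slab d_gt0 w_gt0 pi0 pisum F0) => [c|]; last first.
  by apply: le_trans hks _; rewrite lerXn2r ?nnegrE // ler_nat.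
by rewrite (eq_bigl (fun x => x.1 == c)) ?pifst.
Qed.
End Comparison.

Require Import Defs.
From mathcomp Require Import all_classical all_reals all_analysis measurable_realfun.
Import numFieldNormedType.Exports.
Local Open Scope classical_set_scope.
Local Open Scope ring_scope.

(** * Independent samples as random words *)

Section IidWords.
Variables (R : realType) (dT : measure_display) (T : measurableType dT).
Variable P : probability T R.

Lemma set_const_bool (b : bool) : [set _ : T | b] = if b then setT else set0.
Proof. by case: b; apply/seteqP; split. Qed.

Lemma probability_partition (C : finType) (X : T -> C) (E : set T) :
  measurable E -> (forall c, measurable (X @^-1` [set c])) ->
  P E = (\sum_c P (E `&` X @^-1` [set c]))%E.
Proof.
move=> mE mX.
have {1}-> : E = \bigcup_(c in [set` index_enum C]) (E `&` X @^-1` [set c]).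
  apply/seteqP; split => [t Et|t [c _ []] //]; exists (X t) => //=.
  exact: mem_index_enum.
rewrite measure_fin_bigcup //; last by move=> c _; apply: measurableI.
  by rewrite -fsbig_seq // index_enum_uniq.
by move=> a b _ _ [t [[_ <-] [_ <-]]].
Qed.

Variables (C : finType) (X : nat -> T -> C) (p : C -> R).
Hypothesis mX : forall i c, measurable (X i @^-1` [set c]).

Definition word_at (n : nat) (t : T) : seq C := [seq X i t | i <- iota 0 n].

Lemma measurable_words (b : pred (seq C)) k n :
  measurable [set t | b [seq X i t | i <- iota k n]].
Proof.
elim: n k b => [|n IH] k b.
  by rewrite /= set_const_bool; case: ifP.
have -> : [set t | b [seq X i t | i <- iota k n.+1]] =
    \bigcup_(c in [set` index_enum C]) (X k @^-1` [set c] `&`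
       [set t | b (c :: [seq X i t | i <- iota k.+1 n])]).
  apply/seteqP; split => [t bt|t [c _ [<-]] //].
  by exists (X k t) => //=; exact: mem_index_enum.
apply: fin_bigcup_measurable => [|c _]; first exact: finite_seq.
apply: measurableI => //; exact: (IH k.+1 (fun s => b (c :: s))).
Qed.

Hypothesis p_ge0 : forall c, 0 <= p c.
Hypothesis X_indep : forall (n : nat) (u : nat -> C),
  P (\bigcap_(i < n) (X i @^-1` [set u i])) = (\prod_(i < n) p (u i))%:E.

(** The prescribed prefix makes the induction on n possible: conditioning on the next letter
    lengthens the prefix, and independence is only invoked when no free letter remains. *)
Lemma prob_words_prefix (b : pred (seq C)) (k n : nat) (u : nat -> C) :
  P (\bigcap_(i < k) (X i @^-1` [set u i]) `&`
     [set t | b [seq X i t | i <- iota k n]]) =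
  ((\prod_(i < k) p (u i)) * Prw p n b)%:E.
Proof.
have mcap j (v : nat -> C) : measurable (\bigcap_(i < j) (X i @^-1` [set v i])).
  by apply: bigcap_measurableType => i _.
elim: n k b u => [|n IH] k b u.
  rewrite /Prw /= set_const_bool; case: (b [::]); first by rewrite setIT mulr1 X_indep.
  by rewrite setI0 measure0 mulr0.
rewrite (@probability_partition C (X k)) //; last first.
  by apply: measurableI => //; apply: measurable_words.
rewrite /Prw /= mulr_sumr -sumEFin; apply: eq_bigr => c _.
pose v i := if (i < k)%N then u i else c.
have vu : \prod_(i < k) p (u i) = \prod_(i < k) p (v i).
  by apply: eq_bigr => i _; rewrite /v ltn_ord.
have -> : \bigcap_(i < k) (X i @^-1` [set u i]) `&`
    [set t | b [seq X i t | i <- iota k n.+1]] `&` X k @^-1` [set c] =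
  \bigcap_(i < k.+1) (X i @^-1` [set v i]) `&`
    [set t | b (c :: [seq X i t | i <- iota k.+1 n])].
  apply/seteqP; split => t /=.
    move=> [[h1 h2] h3]; split; last by rewrite -h3.
    move=> i /=; rewrite ltnS leq_eqVlt => /orP[/eqP ->|ik].
      by rewrite /v ltnn.
    by rewrite /v ik; exact: h1.
  move=> [h1 h2]; have h3 : X k t = c.
    by have := h1 k (ltnSn k); rewrite /v ltnn.
  split; last by []; split; last by rewrite h3.
  move=> i /= ik; have := h1 i (ltnW ik : (i < k.+1)%N); by rewrite /v ik.
rewrite (IH k.+1 (fun s => b (c :: s))) big_ord_recr /= /v ltnn vu /Prw mulrA.
by [].
Qed.

Lemma prob_words (b : pred (seq C)) n :
  P [set t | b (word_at n t)] = (Prw p n b)%:E.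
Proof.
(* An empty alphabet offers no letter for the empty prefix; it forces n = 0 or contradicts total
   mass 1. *)
have [c0 _|C0] := pickP (@predT C); last first.
  case: n => [|n].
    by rewrite /word_at /Prw /= set_const_bool; case: (b [::]); rewrite ?probability_setT ?measure0.
  have := @probability_partition C (X 0) setT measurableT (mX 0).
  by rewrite big_pred0 // => /eqP; rewrite probability_setT onee_eq0.
have := prob_words_prefix b 0 n (fun=> c0).
rewrite big_ord0 mul1r => <-; congr (P _); apply/seteqP; split => [t bt|t [_ //]].
by split.
Qed.

Lemma sum_marginal : \sum_c p c = 1.
Proof.
have := prob_words predT 1; rewrite /word_at /Prw /= set_const_bool.
rewrite probability_setT => -[e]; rewrite [RHS]e; apply: eq_bigr => c _.
by rewrite mulr1.
Qed.

End IidWords.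

(** * Borel-Cantelli with a telescoping bound *)

Section BorelCantelli.
Variables (R : realType) (dT : measure_display) (T : measurableType dT).
Variable P : probability T R.

Lemma borel_cantelli (F : nat -> set T) (c : R) :
  (forall k, measurable (F k)) -> 0 <= c ->
  (forall k, P (F k) <= (c * (k.+1%:R^-1 - k.+2%:R^-1))%:E)%E ->
  {ae P, forall t, exists K, forall k, (K <= k)%N -> ~ F k t}.
Proof.
move=> mF c0 PF.
have sumle : (\sum_(0 <= k <oo) P (F k) <= c%:E)%E.
  apply: lime_le; first by apply: is_cvg_nneseries => k _ _.
  apply: nearW => n; apply: le_trans (lee_sum _ (fun k _ => PF k)) _.
  rewrite sumEFin lee_fin -mulr_sumr ler_piMr //.
  have -> : \sum_(0 <= k < n) (k.+1%:R^-1 - k.+2%:R^-1 : R) = 1 - n.+1%:R^-1.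
    elim: n => [|n IH]; first by rewrite big_geq // invr1 subrr.
    by rewrite big_nat_recr //= IH; ring.
  by rewrite gerBl invr_ge0.
exists (lim_sup_set F); split.
- apply: bigcap_measurable => // k _; apply: bigcup_measurable => //.
- apply: lim_sup_set_cvg0 => //; apply: le_lt_trans sumle _; exact: ltry.
- move=> t /= nK n _; apply: contrapT => h; apply: nK; exists n => k nk Fk.
  by apply: h; exists k.
Qed.
End BorelCantelli.

(** * Discretisation of a cube *)

Definition tied (d G : nat) (s : seq (cell d G)) : bool :=
  [exists i : 'I_d, ~~ uniq [seq c i | c : cell d G <- s]].

(** Union bound over coordinates and pairs of letters: a new letter shares its i-th index with one
    of k earlier ones with probability at most k a. *)
Lemma prob_tied (R : realFieldType) (d G : nat) (p : cell d G -> R) (a : R) n :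
  (forall c, 0 <= p c) -> \sum_c p c = 1 ->
  (forall i v, \sum_(c : cell d G | c i == v) p c <= a) ->
  Prw p n (@tied d G) <= d%:R * n%:R ^+ 2 * a.
Proof.
move=> p0 p1 pa.
have hit i v k : Prw p k (fun s => v \in [seq c i | c : cell d G <- s]) <= k%:R * a.
  elim: k => [|k IH]; first by rewrite /Prw /= mul0r.
  rewrite -natr1 mulrDl mul1r addrC; rewrite /Prw.
  apply: (@le_trans _ _ (\sum_c p c * ((c i == v)%:R + Prw p k (fun s => v \in [seq c i | c : cell d G <- s])))).
    apply: ler_sum => c _; apply: ler_wpM2l => //.
    rewrite -[X in X + _](Ew_cst p1 k) -EwD; apply: le_Ew => // s _ /=.
    by rewrite inE eq_sym -natrD ler_nat; case: (_ == _); case: (_ \in _).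
  under eq_bigr do rewrite mulrDr.
  rewrite big_split /= -mulr_suml p1 mul1r; apply: lerD => //.
  apply: le_trans (pa i v); rewrite [leRHS]big_mkcond; apply: ler_sum => c _.
  by case: eqP; rewrite ?mulr1 ?mulr0.
have rep i k : Prw p k (fun s => ~~ uniq [seq c i | c : cell d G <- s]) <= k%:R ^+ 2 * a.
  have a0 : 0 <= a.
    have [c0 _|C0] := pickP (@predT (cell d G)).
      by apply: le_trans (pa i (c0 i)); apply: sumr_ge0.
    by move: p1; rewrite big_pred0 // => /eqP; rewrite eq_sym oner_eq0.
  elim: k => [|k IH]; first by rewrite /Prw /= expr0n mul0r.
  apply: (@le_trans _ _ (k%:R * a + k%:R ^+ 2 * a)); last first.
    rewrite -mulrDl ler_wpM2r // -natrX -natrD -natrX ler_nat; lia.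
  rewrite /Prw /=.
  apply: (@le_trans _ _ (\sum_c p c * (k%:R * a + k%:R ^+ 2 * a))); last first.
    by rewrite -mulr_suml p1 mul1r.
  apply: ler_sum => c _; apply: ler_wpM2l => //.
  apply: le_trans (lerD (hit i (c i) k) IH).
  apply: le_trans (PrwU p0 _ _ _); apply: le_Prw => // s _ /=.
  by rewrite negb_and negbK.
apply: le_trans (Prw_exists p0 _ _) _.
apply: (@le_trans _ _ (\sum_(i < d) n%:R ^+ 2 * a)).
  by apply: ler_sum => i _; apply: rep.
by rewrite sumr_const card_ord -[leLHS]mulr_natl mulrA.
Qed.

Section CellIndex.
Variables (R : realType) (d G : nat) (M : R).
Hypotheses (M_gt0 : 0 < M) (G_gt0 : (0 < G)%N).

Lemma cidx_subproof (k : nat) : (minn k G.-1 < G)%N.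
Proof. by rewrite gtn_min [X in _ || X]ltn_predL G_gt0 orbT. Qed.

Let h := 2 * M / G%:R.

(** Clamped at both ends, by [minn] above and because [Num.truncn] sends negative reals to 0. The
    index is thus monotone on the whole line, and thresholds x outside the cube need no separate
    treatment. *)
Definition cidx (t : R) : 'I_G := Ordinal (cidx_subproof (Num.truncn ((t + M) / h))).

Definition cellmap (x : d.-tuple R) : cell d G := [ffun i => cidx (tnth x i)].

Let h_gt0 : 0 < h.
Proof. by rewrite !mulr_gt0 ?invr_gt0 ?ltr0n. Qed.

Lemma cidx_mono s t : s <= t -> (cidx s <= cidx t)%N.
Proof.
move=> st /=; rewrite leq_min geq_minr andbT; apply: leq_trans (geq_minl _ _) _.
by apply: le_truncn; rewrite ler_pM2r ?invr_gt0 // lerD2r.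
Qed.

Lemma cidx_lt s t : (cidx s < cidx t)%N -> s < t.
Proof. by apply: contraTT; rewrite -leNgt -leqNgt; apply: cidx_mono. Qed.

Lemma cidxE t (j : 'I_G) : - M <= t < M ->
  (cidx t == j) = (- M + j%:R * h <= t < - M + j%:R * h + h).
Proof.
move=> /andP[Mt tM].
have t0 : 0 <= (t + M) / h by apply: divr_ge0; [lra|exact: ltW].
have tG : (Num.truncn ((t + M) / h) < G)%N.
  rewrite truncn_lt_nat // ltr_pdivrMr // /h mulrCA divff ?mulr1 ?pnatr_eq0 -?lt0n //.
  by lra.
rewrite -val_eqE /=.
have -> : minn (Num.truncn ((t + M) / h)) G.-1 = Num.truncn ((t + M) / h).
  by apply/minn_idPl; rewrite -ltnS prednK.
rewrite truncn_eq // ler_pdivlMr // ltr_pdivrMr // -natr1 mulrDl mul1r.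
by apply/andP/andP => -[a b]; split; lra.
Qed.

Lemma measurable_cellmap (c : cell d G) : measurable (cellmap @^-1` [set c]).
Proof.
have -> : cellmap @^-1` [set c] =
    \bigcap_(i in [set: 'I_d]) ((fun x : d.-tuple R => tnth x i) @^-1` (cidx @^-1` [set c i])).
  apply/seteqP; split => [x /= <- i _ /=|x /= h']; first by rewrite ffunE.
  by apply/ffunP => i; rewrite ffunE h'.
apply: fin_bigcap_measurable => [|i _]; first exact: finite_finset.
rewrite -[X in measurable X]setTI; apply: measurable_tnth => //.
apply: is_interval_measurable => s t /= es et z /andP[sz zt].
apply/val_inj/eqP; rewrite eqn_leq -{1}et -es.
by rewrite (cidx_mono zt) (cidx_mono sz).
Qed.

Variable w : nat.
Implicit Types (pts : seq (d.-tuple R)) (x : d.-tuple R).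

(** Comparable points have comparable indices, and equality of two indices would be a tie; so a
    chain of points maps injectively to a chain of cells. *)
Lemma chain_len_le pts s x y : (0 < d)%N -> ~~ tied (map cellmap pts) ->
  {subset s <= pts} -> all (fun a => tle a x) s ->
  (forall i, cidx (tnth x i) < w * y i)%N ->
  (chain_len s <= lc ([set c in map cellmap pts] :&: below G w y))%N.
Proof.
move=> d0 nt sp sx xy; apply/bigmax_leqP => b.
set u := undup _ => bc; have uc : {in u &, forall a c, tle a c || tle c a}.
  move=> a c; rewrite !mem_undup => ab cb.
  by move/allrelP: bc; apply.
have us a : a \in u -> a \in s by rewrite mem_undup; apply: mem_mask.
have inj i : {in pts &, injective (fun a => cidx (tnth a i))}.
  move=> a c ap cp e; move: nt; rewrite negb_exists => /forallP/(_ i).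
  rewrite negbK -map_comp => uq.
  have [ia ic] : ((index a pts < size pts) /\ (index c pts < size pts))%N by rewrite !index_mem.
  rewrite -(nth_index a ap) -(nth_index a cp); congr (nth a pts _); apply/eqP.
  rewrite -(nth_uniq (cidx 0) _ _ uq) ?size_map // !(nth_map a) //= !ffunE !nth_index //.
  by rewrite e.
have i0 := Ordinal d0.
have injc : {in u &, injective cellmap}.
  move=> a c /us/sp ap /us/sp cp /ffunP/(_ i0); rewrite !ffunE; exact: inj.
rewrite -[size u]/(size u) -(size_map cellmap u).
have uu : uniq (map cellmap u) by rewrite map_inj_in_uniq // undup_uniq.
rewrite -(card_uniqP uu) -cardsE; apply: leq_lc.
  apply/chainP => _ _ /[!inE] /mapP[a au ->] /mapP[c cu ->] ne.
  have key a' c' : a' \in u -> c' \in u -> cellmap a' != cellmap c' -> tle a' c' ->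
      slt (cellmap a') (cellmap c').
    move=> au' cu' ne' /forallP tac; apply/forallP => i; rewrite !ffunE ltn_neqAle cidx_mono // andbT.
    apply: contraNneq ne' => e; apply/eqP; congr cellmap.
    by apply: (inj i); [exact/sp/us|exact/sp/us|exact: val_inj].
  by case/orP: (uc a c au cu) => h'; apply/orP; [left|right]; apply: key => //; rewrite eq_sym.
apply/fintype.subsetP => _ /[!inE] /mapP[a au ->]; apply/andP; split.
  by apply/mapP; exists a => //; exact/sp/us.
apply/forallP => i; rewrite ffunE; apply: leq_ltn_trans (xy i).
by apply: cidx_mono; have /allP/(_ a (us a au))/forallP/(_ i) := sx.
Qed.

(** Strictly ordered indices come from strictly ordered reals ([cidx_lt]), so one representative per
    cell turns a chain of cells into a chain of points. *)
Lemma lc_le_chain_len pts x y : (forall i, w * y i <= cidx (tnth x i))%N ->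
  (lc ([set c in map cellmap pts] :&: below G w y) <=
   chain_len [seq a <- pts | tle a x])%N.
Proof.
move=> xy; apply/lc_leqP => U cU /fintype.subsetP US.
have ex c : c \in U -> exists2 a, a \in pts & cellmap a = c.
  by move/US; rewrite !inE => /andP[/mapP[a ap ->] _]; exists a.
pose rep c := nth [tuple of nseq d 0] [seq a <- pts | cellmap a == c] 0.
have repP c : c \in U -> rep c \in pts /\ cellmap (rep c) = c.
  move=> /ex[a ap ac].
  have : rep c \in [seq a <- pts | cellmap a == c].
    apply: mem_nth; rewrite size_filter -has_count.
    by apply/hasP; exists a; rewrite //= ac.
  by rewrite mem_filter => /andP[/eqP].
set s := [seq a <- pts | tle a x].
pose sel := [seq rep c | c <- enum U].
have selx a : a \in sel -> a \in s.
  case/mapP => c; rewrite mem_enum => cc ->; have [rp rc] := repP c cc.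
  rewrite mem_filter rp andbT; apply/forallP => i.
  have := US c cc; rewrite inE => /andP[_]; rewrite inE => /forallP/(_ i) cy.
  apply/ltW/cidx_lt; apply: leq_trans (xy i); move: cy.
  by rewrite -{1}rc ffunE.
have bs : size [seq a \in sel | a <- s] == size s by rewrite size_map.
apply: (@leq_trans (size (undup (mask (Tuple bs) s)))); last first.
  apply: leq_bigmax_cond; apply/allrelP => a c.
  rewrite -filter_mask !mem_filter => /andP[/mapP[a' + ->] _] /andP[/mapP[c' + ->] _].
  rewrite !mem_enum => aU cU'.
  have [->|ne] := eqVneq a' c'; first by apply/orP; left; apply/forallP.
  have key b b' : b \in U -> b' \in U -> slt b b' -> tle (rep b) (rep b').
    move=> bU b'U /forallP bb; apply/forallP => i; apply/ltW/cidx_lt.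
    by have := bb i; rewrite -{1}(repP b bU).2 -{1}(repP b' b'U).2 !ffunE.
  by move/chainP: cU => /(_ a' c' aU cU' ne)/orP[] /key -> //; rewrite orbT.
rewrite cardE -(size_map rep) -/sel; apply: uniq_leq_size.
  rewrite map_inj_in_uniq ?enum_uniq // => a c; rewrite !mem_enum => aU cU' e.
  by rewrite -(repP a aU).2 -(repP c cU').2 e.
by move=> a asel; rewrite mem_undup -filter_mask mem_filter asel selx.
Qed.

End CellIndex.

Lemma card_box (d G : nat) (I : 'I_d -> {set 'I_G}) :
  #|box I| = (\prod_i #|I i|)%N.
Proof.
have -> : #|box I| = #|family (fun i : 'I_d => mem (I i))|.
  apply: eq_card => c; rewrite !inE; apply/forallP/familyP => h i; exact: h.
by rewrite card_family foldrE big_map big_enum.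
Qed.

Definition rbox (R : realType) (d : nat) (lo : 'I_d -> R) (h : R) : set (d.-tuple R) :=
  [set x | forall i, lo i <= tnth x i < lo i + h].

Lemma measurable_coords (R : realType) (d : nat) (A : 'I_d -> set R) :
  (forall i, measurable (A i)) ->
  measurable [set x : d.-tuple R | forall i, A i (tnth x i)].
Proof.
move=> mA; have -> : [set x : d.-tuple R | forall i, A i (tnth x i)] =
    \bigcap_(i in [set: 'I_d]) ((fun x : d.-tuple R => tnth x i) @^-1` A i).
  by apply/seteqP; split => [x h i _|x h i]; [exact: h|exact: (h i)].
apply: fin_bigcap_measurable => [|i _]; first exact: finite_finset.
by rewrite -[X in measurable X]setTI; apply: measurable_tnth.
Qed.

Lemma measurable_rbox (R : realType) (d : nat) (lo : 'I_d -> R) (h : R) :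
  measurable (rbox lo h).
Proof.
apply: (measurable_coords (A := fun i => [set t | lo i <= t < lo i + h])) => i.
have -> : [set t | lo i <= t < lo i + h] = [set` `[lo i, lo i + h[]; last exact: measurable_itv.
by apply/seteqP; split => t; rewrite /= in_itv.
Qed.

(** * Law of a sample on the grid *)

Section Law.
Variables (R : realType) (d : nat) (dT : measure_display) (T : measurableType dT).
Variable P : probability T R.

Definition iid (W : nat -> T -> d.-tuple R) : Prop :=
  [/\ forall i, measurable_fun setT (W i),
      forall i A, measurable A -> P (W i @^-1` A) = P (W 0 @^-1` A) &
      forall n (A : nat -> set (d.-tuple R)), (forall i, measurable (A i)) ->
        P (\bigcap_(i < n) (W i @^-1` A i)) = (\prod_(i < n) P (W i @^-1` A i))%E].

Definition cube (M : R) : set (d.-tuple R) := [set x | forall i, - M <= tnth x i < M].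

Lemma measurable_cube M : measurable (cube M).
Proof.
apply: (measurable_coords (A := fun i => [set t | - M <= t < M])) => i.
have -> : [set t | - M <= t < M] = [set` `[- M, M[]; last exact: measurable_itv.
by apply/seteqP; split => t; rewrite /= in_itv.
Qed.

Variables (W : nat -> T -> d.-tuple R) (M F : R) (G : nat).
Hypotheses (iidW : iid W) (M_gt0 : 0 < M) (G_gt0 : (0 < G)%N) (F_ge0 : 0 <= F).
Hypothesis d_gt0 : (0 < d)%N.
Hypothesis W_cube : P (W 0 @^-1` ~` cube M) = 0%E.
Hypothesis W_box : forall lo (h : R), 0 < h -> (P (W 0 @^-1` rbox lo h) <= (F * h ^+ d)%:E)%E.
Let h := 2 * M / G%:R.

Definition cell_law (c : cell d G) : R := fine (P (W 0 @^-1` (cellmap M G_gt0 @^-1` [set c]))).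

Definition cell_corner (c : cell d G) (i : 'I_d) : R := - M + (c i)%:R * h.

Definition cell_at i t : cell d G := cellmap M G_gt0 (W i t).

(** Clamping makes the preimages of extreme cells unbounded, but almost surely [W 0] lies in the
    cube, where each preimage is a half-open box of side h. *)
Lemma cell_lawE c : (cell_law c)%:E = P (W 0 @^-1` rbox (cell_corner c) h).
Proof.
have [mW _ _] := iidW.
have mpre A : measurable A -> measurable (W 0 @^-1` A).
  by move=> mA; rewrite -[X in measurable X]setTI; apply: mW.
have mc := measurable_cellmap M_gt0 G_gt0 c.
have mr := measurable_rbox (cell_corner c) h.
have mN := mpre _ (measurableC (measurable_cube M)).
rewrite /cell_law fineK ?fin_num_measure //; last exact: mpre.
have key A : measurable A -> P (W 0 @^-1` A) = P (W 0 @^-1` (A `&` cube M)).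
  move=> mA; apply/eqP; rewrite eq_le; apply/andP; split; last first.
    apply: le_measure; rewrite ?inE; [apply: mpre; apply: measurableI => //; exact: measurable_cube|exact: mpre|].
    by move=> t [].
  have mAc : measurable (W 0 @^-1` (A `&` cube M)).
    by apply: mpre; apply: measurableI => //; exact: measurable_cube.
  rewrite -[leRHS]adde0 -W_cube.
  apply: (@le_trans _ _ (P (W 0 @^-1` (A `&` cube M) `|` W 0 @^-1` (~` cube M)))); last first.
    exact: measureU2.
  apply: le_measure; rewrite ?inE; [exact: mpre|exact: measurableU|].
  by move=> t At; have [ct|ct] := pselect (cube M (W 0 t)); [left|right].
rewrite key // [RHS]key //; congr (P (W 0 @^-1` _)).
apply/seteqP; split => x [/= hx cx]; split => //.
  by move=> i; rewrite -cidxE // -hx ffunE.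
apply/ffunP => i; rewrite ffunE; apply/eqP; rewrite (cidxE M_gt0 G_gt0 _ (cx i)).
exact: hx.
Qed.

Lemma cell_law_ge0 c : 0 <= cell_law c.
Proof. by apply: fine_ge0. Qed.

Let h_gt0 : 0 < h.
Proof. by rewrite !mulr_gt0 ?invr_gt0 ?ltr0n. Qed.

Lemma cell_law_le c : cell_law c <= F * h ^+ d.
Proof. by rewrite -lee_fin cell_lawE W_box. Qed.

Lemma measurable_cell_at i c : measurable (cell_at i @^-1` [set c]).
Proof.
have [mW _ _] := iidW.
rewrite -[X in measurable X]setTI.
apply: (mW i measurableT _ (measurable_cellmap M_gt0 G_gt0 c)).
Qed.

Lemma cell_at_indep n (u : nat -> cell d G) :
  P (\bigcap_(i < n) (cell_at i @^-1` [set u i])) = (\prod_(i < n) cell_law (u i))%:E.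
Proof.
have [mW W0 Wn] := iidW.
rewrite (Wn n (fun i => cellmap M G_gt0 @^-1` [set u i])); last first.
  by move=> i; exact: measurable_cellmap.
rewrite -prodEFin; apply: eq_bigr => i _; rewrite W0; last exact: measurable_cellmap.
rewrite /cell_law fineK // fin_num_measure // -[X in measurable X]setTI.
exact: (mW 0 measurableT _ (measurable_cellmap M_gt0 G_gt0 (u i))).
Qed.

Lemma prob_cell_words (b : pred (seq (cell d G))) n : P [set t | b (word_at cell_at n t)] = (Prw cell_law n b)%:E.
Proof. by apply: prob_words; [exact: measurable_cell_at|exact: cell_at_indep]. Qed.

Lemma cell_law_sum1 : \sum_c cell_law c = 1.
Proof. by apply: sum_marginal; [exact: measurable_cell_at|exact: cell_at_indep]. Qed.

Lemma cell_law_slice i v : \sum_(c : cell d G | c i == v) cell_law c <= F * h * (2 * M) ^+ d.-1.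
Proof.
pose I i' : {set 'I_G} := if i' == i then [set v]%SET else [set: 'I_G]%SET.
have -> : \sum_(c : cell d G | c i == v) cell_law c = \sum_(c in box I) cell_law c.
  apply: eq_bigl => c; rewrite inE; apply/eqP/forallP => [cv i'|/(_ i)].
    by rewrite /I; case: eqP => [->|_]; rewrite inE ?cv.
  by rewrite /I eqxx inE => /eqP.
apply: le_trans (ler_sum _ (fun c _ => cell_law_le c)) _.
rewrite sumr_const card_box (bigD1 i) //= {1}/I eqxx cards1 mul1n.
rewrite (eq_bigr (fun=> G)); last by move=> i' /negbTE; rewrite /I => ->; rewrite cardsT card_ord.
rewrite prod_nat_const cardC1 card_ord -[leLHS]mulr_natl natrX.
have hG : G%:R * h = 2 * M by rewrite /h mulrC divfK // pnatr_eq0 -lt0n.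
have -> : (2 * M) ^+ d.-1 = G%:R ^+ d.-1 * h ^+ d.-1 by rewrite -exprMn hG.
have -> : h ^+ d = h * h ^+ d.-1 by rewrite -exprS prednK.
set g := G%:R ^+ _; set k := h ^+ _.
by rewrite le_eqVlt; apply/orP; left; apply/eqP; ring.
Qed.

End Law.

(** * Comparison along one sample size *)

Section Block.
Variables (R : realType) (d : nat) (dT : measure_display) (T : measurableType dT).
Variable P : probability T R.
Variables (W1 W2 : nat -> T -> d.-tuple R) (M F eps : R) (w q m : nat).
Let G := (w * q * m)%N.
Let w0 := 2 * M / (q * m)%:R.
Let h := 2 * M / G%:R.
Hypotheses (d_gt0 : (0 < d)%N) (w_ge8 : (8 <= w)%N) (q_gt0 : (0 < q)%N) (G_gt0 : (0 < G)%N).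
Hypotheses (M_gt0 : 0 < M) (F_ge0 : 0 <= F) (eps_ge0 : 0 <= eps).
Hypotheses (iid1 : iid P W1) (iid2 : iid P W2).
Hypotheses (cube1 : P (W1 0 @^-1` ~` cube M) = 0%E) (cube2 : P (W2 0 @^-1` ~` cube M) = 0%E).
Hypothesis box1 : forall lo (h : R), 0 < h -> (P (W1 0 @^-1` rbox lo h) <= (F * h ^+ d)%:E)%E.
Hypothesis box2 : forall lo (h : R), 0 < h -> (P (W2 0 @^-1` rbox lo h) <= (F * h ^+ d)%:E)%E.
Variable e : {ffun 'I_d -> nat} -> 'I_d -> R.
Hypothesis e_le : forall k i, `|e k i| <= w0 / 8.
(** The tolerance h on [lo'] absorbs the rounding of the translation [e k] to a whole number of
    cells. *)
Hypothesis box_shift : forall (k : {ffun 'I_d -> nat}) (lo lo' : 'I_d -> R),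
  (forall i, (k i < m)%N) ->
  (forall i, - M + (k i)%:R * (q%:R * w0) <= lo i /\
             lo i + h <= - M + (k i).+1%:R * (q%:R * w0)) ->
  (forall i, `|lo' i - lo i - e k i| <= h) ->
  (P (W1 0 @^-1` rbox lo h) <= P (W2 0 @^-1` rbox lo' h) + (eps * h ^+ d)%:E)%E.

(** The translation is at most w0 / 8 = (w / 8) h, hence at most tau cells, while 2 tau < w as the
    deformation requires. Adding tau before truncating keeps the rounded number of cells in [nat];
    [Tr k i - tau] is the signed shift. *)
Let tau := (w %/ 4)%N.
Let Tr (k : {ffun 'I_d -> nat}) (i : 'I_d) : nat := Num.truncn (e k i / h + tau%:R).
Let p1 := cell_law P W1 M G_gt0.
Let p2 := cell_law P W2 M G_gt0.

Let GE : G = (w * q * m)%N := erefl.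
Let w_gt0 : (0 < w)%N. Proof. by apply: leq_trans w_ge8. Qed.
Let qm_gt0 : (0 < q * m)%N.
Proof. by move: G_gt0; rewrite /G -mulnA muln_gt0 => /andP[]. Qed.
Let tauw : (2 * tau < w)%N.
Proof. by rewrite /tau; have := leq_trunc_div w 4; lia. Qed.
Let h_gt0 : 0 < h.
Proof. by rewrite !mulr_gt0 ?invr_gt0 ?ltr0n. Qed.
Let wh : w0 = w%:R * h.
Proof.
have Y0 : (q * m)%:R != 0 :> R by rewrite pnatr_eq0 -lt0n.
have wn0 : w%:R != 0 :> R by rewrite pnatr_eq0 -lt0n.
rewrite /w0 /h /G -mulnA [X in _ = _ * (_ / X)]natrM.
by move: Y0 wn0; move: (_%:R) => Y; move: (_%:R) => V Y0 wn0; field; rewrite Y0 wn0.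
Qed.
Let w0_gt0 : 0 < w0. Proof. by rewrite wh mulr_gt0 // ltr0n. Qed.
Let Gh : G%:R * h = 2 * M.
Proof. by rewrite /h mulrC divfK // pnatr_eq0 -lt0n. Qed.

Let e_h k i : `|e k i / h| <= tau%:R.
Proof.
rewrite normrM [`|h^-1|]gtr0_norm ?invr_gt0 // ler_pdivrMr //.
apply: le_trans (e_le k i) _; rewrite wh.
have : w%:R <= (8 * tau)%:R :> R by rewrite ler_nat /tau; lia.
rewrite natrM => /(ler_wpM2r (ltW h_gt0)); lra.
Qed.

Let Tr_le k i : (Tr k i <= 2 * tau)%N.
Proof.
rewrite /Tr truncn_le_nat; have := e_h k i; rewrite ler_norml => /andP[_ h2].
rewrite -natr1 natrM; lra.
Qed.

Lemma cell_law_shift c : interior_cell w q c ->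
  p1 c <= p2 (shift_cell w q tau Tr c) + eps * h ^+ d.
Proof.
move=> ci; rewrite -lee_fin EFinD.
rewrite (cell_lawE iid1 M_gt0 G_gt0 cube1) (cell_lawE iid2 M_gt0 G_gt0 cube2).
apply: (box_shift (k := macrof w q c)) => i.
  by rewrite ffunE; apply: macro_lt.
  rewrite /cell_corner -/h ffunE.
  have [h1 h2] := interior_bounds w_gt0 i ci.
  rewrite wh; move: h1 h2; set k := macro w q c i => h1 h2.
  have {}h1 : (k * (w * q))%:R <= (c i)%:R :> R by rewrite ler_nat; lia.
  have {}h2 : (c i).+1%:R <= (k.+1 * (w * q))%:R :> R by rewrite ler_nat; lia.
  have e1 : k%:R * (q%:R * (w%:R * h)) = (k * (w * q))%:R * h by rewrite !natrM; ring.
  have e2 : k.+1%:R * (q%:R * (w%:R * h)) = (k.+1 * (w * q))%:R * h by rewrite !natrM; ring.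
  rewrite e1 e2; split; first by rewrite lerD2l ler_wpM2r // ltW.
  by rewrite -addrA lerD2l -[X in _ + X]mul1r -mulrDl natr1 ler_wpM2r // ltW.
rewrite /cell_corner -/h.
have [-> tc] := shift_cellE w_gt0 q_gt0 GE tauw Tr_le i ci.
rewrite natrB; last by apply: leq_trans (leq_addr _ _).
rewrite natrD; set k := macrof w q c; have := e_h k i; rewrite ler_norml => /andP[h1 h2].
have t0 : 0 <= e k i / h + tau%:R by lra.
have /andP[l1 l2] := truncn_itv t0.
have ee : e k i = e k i / h * h by rewrite divfK // gt_eqF.
rewrite [X in _ - X]ee; rewrite -/(Tr k i) in l1 l2 *.
set E := e k i / h in t0 h1 h2 l1 l2 *.
have -> : - M + ((c i)%:R + (Tr k i)%:R - tau%:R) * h - (- M + (c i)%:R * h) - E * h =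
  ((Tr k i)%:R - tau%:R - E) * h by ring.
rewrite normrM (gtr0_norm h_gt0); apply: ler_piMl; first exact: ltW.
rewrite ler_norml.
rewrite -natr1 in l2; apply/andP; split; lra.
Qed.

(** After multiplication by n^(1/d) and up to the factor 8, these are the sizes of a longest chain
    in one slab, among the unmatched points and in the whole cube; their d-th powers dominate the
    corresponding masses. *)
Variables (bs bN b : R).
Hypotheses (bs_ge0 : 0 <= bs) (bN_ge0 : 0 <= bN) (b_ge0 : 0 <= b).
Hypotheses (hbs : F * w0 * (2 * M) ^+ d.-1 <= bs ^+ d)
  (hbN : eps * (2 * M) ^+ d <= bN ^+ d) (hb : F * (2 * M) ^+ d <= b ^+ d).

Let index := {ffun 'I_d -> 'I_(q * m)}.
Let phi (y : index) (s : seq (cell d G)) : R :=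
  (lc ([set c in s]%SET :&: below G w (fun i => (y i).+1)))%:R.

(** Thresholds are rounded to the grid of slabs, so the supremum over x costs a union over (q m)^d
    values of y, a number that does not grow with n. This event and [bad_lower] compare both samples
    with means under the second law [p2]. *)
Definition bad_upper (n ks kN : nat) (lam : R) : pred (seq (cell d G)) := fun s =>
  [exists y : index, (chain_loss d m ks kN)%:R + lam + Ew p2 n (phi y) <= phi y s] || tied s.

Definition bad_lower (n ks : nat) (lam : R) : pred (seq (cell d G)) := fun s =>
  [exists y : index, lam <= `|phi y s - Ew p2 n (phi y)|] ||
  [exists x : 'I_d * 'I_(q * m), (ks < lc ([set c in s]%SET :&: slab G w x.1 x.2))%N].

Let slab_cond n ks : n%:R * (8 * bs) ^+ d <= ks%:R ^+ d ->
  8 ^+ d * (n%:R * (F * h ^+ d) * (w%:R * G%:R ^+ d.-1)) <= ks%:R ^+ d.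
Proof.
move=> hk; apply: le_trans hk; rewrite [in leRHS]exprMn.
have -> : n%:R * (F * h ^+ d) * (w%:R * G%:R ^+ d.-1) = n%:R * (F * w0 * (2 * M) ^+ d.-1).
  rewrite wh -Gh [(G%:R * h) ^+ _]exprMn -[in h ^+ d](prednK d_gt0) [h ^+ _.+1]exprS.
  by move: (h ^+ _) (G%:R ^+ _) => x y; ring.
by rewrite mulrCA; do 2 (apply: ler_wpM2l; first by rewrite ?exprn_ge0).
Qed.

Let cube_cond n k a b' : 0 <= a -> a * (2 * M) ^+ d <= b' ^+ d -> n%:R * (8 * b') ^+ d <= k%:R ^+ d ->
  8 ^+ d * (n%:R * (a * h ^+ d) * G%:R ^+ d) <= k%:R ^+ d.
Proof.
move=> a0 hb' hk; apply: le_trans hk; rewrite [in leRHS]exprMn.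
have -> : n%:R * (a * h ^+ d) * G%:R ^+ d = n%:R * (a * (2 * M) ^+ d).
  by rewrite -Gh [(G%:R * h) ^+ _]exprMn; ring.
by rewrite mulrCA; do 2 (apply: ler_wpM2l; first by rewrite ?exprn_ge0).
Qed.

Let p1_ge0 c : 0 <= p1 c. Proof. exact: cell_law_ge0. Qed.
Let p2_ge0 c : 0 <= p2 c. Proof. exact: cell_law_ge0. Qed.
Let p1_sum1 : \sum_c p1 c = 1. Proof. exact: cell_law_sum1. Qed.
Let p2_sum1 : \sum_c p2 c = 1. Proof. exact: cell_law_sum1. Qed.
Let p1_le c : p1 c <= F * h ^+ d. Proof. exact: cell_law_le. Qed.
Let p2_le c : p2 c <= F * h ^+ d. Proof. exact: cell_law_le. Qed.
Let Fh_ge0 : 0 <= F * h ^+ d. Proof. by rewrite mulr_ge0 // exprn_ge0 // ltW. Qed.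
Let eh_ge0 : 0 <= eps * h ^+ d. Proof. by rewrite mulr_ge0 // exprn_ge0 // ltW. Qed.

Lemma prob_bad_upper n ks kN kG lam : 0 < lam ->
  n%:R * (8 * bs) ^+ d <= ks%:R ^+ d -> n%:R * (8 * bN) ^+ d <= kN%:R ^+ d ->
  n%:R * (8 * b) ^+ d <= kG%:R ^+ d ->
  Prw p1 n (bad_upper n ks kN lam) <=
  #|{: index}|%:R * ((d * (q * m))%:R * 2^-1 ^+ ks.+1 + 2^-1 ^+ kN.+1 + (kG%:R + 1) / lam ^+ 2)
  + d%:R * n%:R ^+ 2 * (F * h * (2 * M) ^+ d.-1).
Proof.
move=> lam0 hks hkN hkG.
apply: le_trans (PrwU p1_ge0 _ _ _) _; apply: lerD; last first.
  by apply: prob_tied => //; apply: cell_law_slice.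
apply: le_trans (Prw_exists p1_ge0 _ _) _.
rewrite mulr_natl -sumr_const; apply: ler_sum => y _.
exact: (lc_comparison d_gt0 w_gt0 q_gt0 tauw Tr_le p1_ge0 p2_ge0 p1_sum1 p2_sum1
  p1_le p2_le eh_ge0 cell_law_shift (slab_cond hks) (cube_cond eps_ge0 hbN hkN)
  (cube_cond F_ge0 hb hkG)).
Qed.

Lemma prob_bad_lower n ks kG lam : 0 < lam ->
  n%:R * (8 * bs) ^+ d <= ks%:R ^+ d -> n%:R * (8 * b) ^+ d <= kG%:R ^+ d ->
  Prw p2 n (bad_lower n ks lam) <=
  #|{: index}|%:R * ((kG%:R + 1) / lam ^+ 2) + (d * (q * m))%:R * 2^-1 ^+ ks.+1.
Proof.
move=> lam0 hks hkG.
apply: le_trans (PrwU p2_ge0 _ _ _) _; apply: lerD.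
  apply: le_trans (Prw_exists p2_ge0 _ _) _.
  rewrite mulr_natl -sumr_const; apply: ler_sum => y _.
  exact: (lc_concentration d_gt0 p2_ge0 p2_sum1 p2_le (cube_cond F_ge0 hb hkG)).
apply: le_trans (Prw_exists p2_ge0 _ _) _.
apply: (@le_trans _ _ (\sum_(x : 'I_d * 'I_(q * m)) 2^-1 ^+ ks.+1)); last first.
  by rewrite sumr_const card_prod !card_ord -[leLHS]mulr_natl.
apply: ler_sum => x _; under eq_fun do rewrite -hits_Some.
apply: (lc_tail_slab d_gt0 w_gt0 p2_ge0 p2_sum1 Fh_ge0).
  by move=> c; rewrite (big_pred1 c).
by apply: le_trans (slab_cond hks) _; rewrite lerXn2r ?nnegrE // ler_nat.
Qed.

(** Everything is monotone in n and x: the first sample is enlarged to N1 points and x rounded up,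
    the second reduced to N2 points and x rounded down. The roundings differ by one slab per
    direction, the sample sizes by N1 - N2 points, whose mean chain length is at most kD + 1. *)
Lemma block_comparison (n N1 N2 ks kN kD : nat) (lam : R) (t : T) :
  (N2 <= n)%N -> (n <= N1)%N -> (N1 - N2)%:R * (8 * b) ^+ d <= kD%:R ^+ d ->
  ~~ bad_upper N1 ks kN lam (word_at (cell_at W1 M G_gt0) N1 t) ->
  ~~ bad_lower N2 ks lam (word_at (cell_at W2 M G_gt0) N2 t) ->
  forall x, (chain_count (fun i => W1 i t) n x)%:R <=
    (chain_count (fun i => W2 i t) n x)%:R +
    ((chain_loss d m ks kN)%:R + 2 * lam + kD%:R + 1 + (d * ks)%:R) :> R.
Proof.
move=> N2n nN1 hD badA badB x.
have yP i : (cidx M G_gt0 (tnth x i) %/ w < q * m)%N.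
  by rewrite ltn_divLR // mulnC mulnA ltn_ord.
pose y : index := [ffun i => Ordinal (yP i)].
pose pts1 := [seq W1 i t | i <- iota 0 N1]; pose pts2 := [seq W2 i t | i <- iota 0 N2].
have e1 : word_at (cell_at W1 M G_gt0) N1 t = map (cellmap M G_gt0) pts1 by rewrite -map_comp.
have e2 : word_at (cell_at W2 M G_gt0) N2 t = map (cellmap M G_gt0) pts2 by rewrite -map_comp.
rewrite e1 in badA; rewrite e2 in badB.
move: badA; rewrite negb_or => /andP[/existsPn/(_ y) A1 A2].
move: badB; rewrite negb_or => /andP[/existsPn/(_ y) B1 /existsPn B2].
have up : (chain_count (fun i => W1 i t) n x)%:R <= phi y (map (cellmap M G_gt0) pts1).
  rewrite ler_nat; apply: (chain_len_le M_gt0 (x := x)) => //.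
  - move=> _ /mapP[i + ->]; rewrite mem_filter mem_iota => /andP[_ /andP[_ ilt]].
    by apply/mapP; exists i => //; rewrite mem_iota /= (leq_trans ilt).
  - by apply/allP => _ /mapP[i + ->]; rewrite mem_filter => /andP[].
  - by move=> i; rewrite ffunE /= mulnC -ltn_divLR.
have down : phi y (map (cellmap M G_gt0) pts2) <=
    (chain_count (fun i => W2 i t) n x)%:R + (d * ks)%:R.
  rewrite -natrD ler_nat.
  have sub : ([set c in map (cellmap M G_gt0) pts2] :&: below G w (fun i => (y i).+1))%SET
     \subset ([set c in map (cellmap M G_gt0) pts2] :&: below G w (fun i => y i) :|:
       \bigcup_(i < d) ([set c in map (cellmap M G_gt0) pts2] :&: slab G w i (y i)))%SET.
    apply/fintype.subsetP => c; rewrite finset.in_setI finset.in_setU => /andP[cp].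
    rewrite finset.in_setI cp inE => /forallP cy /=.
    case: (boolP (c \in below G w (fun i => y i))) => //= nb; apply/finset.bigcupP.
    move: nb; rewrite inE negb_forall => /existsP[i ci]; exists i => //.
    rewrite finset.in_setI cp inE /= eqn_leq -ltnS ltn_divLR // mulnC cy /=.
    by rewrite leq_divRL // mulnC leqNgt.
  apply: leq_trans (lcS sub) _; apply: leq_trans (lcU _ _) _; apply: leq_add.
    pose ptsn := [seq W2 i t | i <- iota 0 n].
    apply: (@leq_trans (lc ([set c in map (cellmap M G_gt0) ptsn] :&: below G w (fun i => y i))%SET)).
      apply: lcS; apply: finset.setSI; apply/fintype.subsetP => c; rewrite !inE.
      case/mapP => _ /mapP[i + ->] ->; rewrite mem_iota => /andP[_ ilt].
      by rewrite map_f //; apply/mapP; exists i => //; rewrite mem_iota /= (leq_trans ilt).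
    have le i : (w * y i <= cidx M G_gt0 (tnth x i))%N.
      by rewrite ffunE /= mulnC leq_trunc_div.
    by have := lc_le_chain_len M_gt0 ptsn le; rewrite filter_map.
  apply: leq_trans (lc_bigcup _ _) _.
  rewrite -[d in (_ <= d * _)%N]card_ord -sum_nat_const; apply: leq_sum => i _.
  by have := B2 (i, y i); rewrite -leqNgt.
(* Longest chains are subadditive under concatenation of words, so the two means differ at most by
   the mean for the additional letters. *)
have Ecat : Ew p2 N1 (phi y) <= Ew p2 N2 (phi y) + (kD%:R + 1).
  rewrite -{1}(subnKC (leq_trans N2n nN1)).
  apply: le_trans (Ew_cat (phi := phi y) (psi := phi y) p2_ge0 p2_sum1 _) _.
    move=> s s' _ _; rewrite -natrD ler_nat.
    apply: leq_trans (lcU _ _); apply: lcS; apply/fintype.subsetP => c.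
    by rewrite !inE mem_cat andb_orl.
  rewrite lerD2l.
  rewrite (_ : phi y = fun s => (lc (hits Some s :&: below G w (fun i => (y i).+1)))%:R).
    apply: (Ew_lc_below _ d_gt0 p2_ge0 p2_sum1 Fh_ge0); last exact: (cube_cond F_ge0 hb hD).
    by move=> c; rewrite (big_pred1 c).
  by apply/funext => s; rewrite hits_Some.
move: A1 B1; rewrite -!ltNge ltr_norml => A1 /andP[B1 _].
lra.
Qed.

End Block.

(** * Almost sure comparison *)

Lemma leq_sqr_exp2 K : (K ^ 2 <= 2 ^ K.+1)%N.
Proof.
have [K3|] := leqP K 2; first by case: K K3 => [|[|[|]]].
elim: K => // K IH; rewrite ltnS leq_eqVlt => /orP[/eqP <- //|K2].
rewrite [leqRHS]expnS; apply: leq_trans (leq_mul (leqnn 2) (IH K2)); nia.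
Qed.

Lemma leq_expSn K e : (0 < K -> K.+1 ^ e.+1 <= K ^ e.+1 + (2 ^ e.+1 - 1) * K ^ e)%N.
Proof.
move=> K0; elim: e => [|e IH]; first by rewrite !expn1 expn0; lia.
rewrite [leqLHS]expnS; apply: leq_trans (leq_mul (leqnn _) IH) _.
have le : (K ^ e <= K ^ e.+1)%N by rewrite expnS leq_pmull.
rewrite [(K ^ e.+2)%N]expnS [(2 ^ e.+2)%N]expnS.
have := expn_gt0 2 e.+1; move: (2 ^ e.+1)%N => a /= a0.
have KK : (K * K ^ e = K ^ e.+1)%N by rewrite expnS.
move: le KK; move: (K ^ e)%N (K ^ e.+1)%N => x y xy KK.
have [b ->] : exists b, a = b.+1 by exists a.-1; lia.
rewrite subSS subn0 mulSn mulnDr mulnCA KK.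
have : (b * x <= b * y)%N by rewrite leq_mul2l xy orbT.
nia.
Qed.

Section AlmostSure.
Variables (R : realType) (d : nat) (dT : measure_display) (T : measurableType dT).
Variable P : probability T R.
Variables (W1 W2 : nat -> T -> d.-tuple R) (M F eps : R) (q m : nat).
Let w0 := 2 * M / (q * m)%:R.
Hypotheses (d_gt0 : (0 < d)%N) (q_gt0 : (0 < q)%N) (m_gt0 : (0 < m)%N).
Hypotheses (M_gt0 : 0 < M) (F_ge0 : 0 <= F) (eps_ge0 : 0 <= eps).
Hypotheses (iid1 : iid P W1) (iid2 : iid P W2).
Hypotheses (cube1 : P (W1 0 @^-1` ~` cube M) = 0%E) (cube2 : P (W2 0 @^-1` ~` cube M) = 0%E).
Hypothesis box1 : forall lo (h : R), 0 < h -> (P (W1 0 @^-1` rbox lo h) <= (F * h ^+ d)%:E)%E.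
Hypothesis box2 : forall lo (h : R), 0 < h -> (P (W2 0 @^-1` rbox lo h) <= (F * h ^+ d)%:E)%E.
Variables (e : {ffun 'I_d -> nat} -> 'I_d -> R) (h0 : R).
Hypotheses (e_le : forall k i, `|e k i| <= w0 / 8) (h0_gt0 : 0 < h0).
Hypothesis box_shift : forall (h : R) (k : {ffun 'I_d -> nat}) (lo lo' : 'I_d -> R),
  0 < h -> h <= h0 -> (forall i, (k i < m)%N) ->
  (forall i, - M + (k i)%:R * (q%:R * w0) <= lo i /\
             lo i + h <= - M + (k i).+1%:R * (q%:R * w0)) ->
  (forall i, `|lo' i - lo i - e k i| <= h) ->
  (P (W1 0 @^-1` rbox lo h) <= P (W2 0 @^-1` rbox lo' h) + (eps * h ^+ d)%:E)%E.
Variables (bs bN b : R).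
Hypotheses (bs_gt0 : 0 < bs) (bN_ge0 : 0 <= bN) (b_ge0 : 0 <= b).
Hypotheses (hbs : F * w0 * (2 * M) ^+ d.-1 <= bs ^+ d)
  (hbN : eps * (2 * M) ^+ d <= bN ^+ d) (hb : F * (2 * M) ^+ d <= b ^+ d).

(** The coefficient of [ks] in [chain_loss], plus d for the rounding of x. In [loss_const], 17 comes
    from ks <= 17 bs K^2, and the remaining terms are at most 5 bs K^2 + 16 bN K^2. Neither constant
    depends on q. *)
Definition loss_count : nat := 2 * d * m + 2 * d * (d * m).+1 + 2 * d.
Definition loss_const : R := 17 * loss_count%:R + 21.

(* Along [N K = K^(2d)] the scale [n^(1/d)] is [K^2] and consecutive terms are
   asymptotically equal; the cells are so thin that with summable error no two
   sample points lie in the same cell interval of some coordinate. *)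
Let w (K : nat) : nat := (K ^ (4 * d + 2))%N.
Let N (K : nat) : nat := (K ^ (2 * d))%N.
Let up (x : R) : nat := (Num.truncn x).+1.
(** The extra summand K, here and in [kN], makes the tails 2^(-ks) and 2^(-kN) summable, even when
    bN = 0, and is of lower order than K^2. *)
Let ks (K : nat) : nat := (up (8 * bs * K.+1%:R ^+ 2) + K)%N.
Let kN (K : nat) : nat := (up (8 * bN * K.+1%:R ^+ 2) + K)%N.
Let kG (K : nat) : nat := up (8 * b * K.+1%:R ^+ 2).
Let kD (K : nat) : nat := up (bs * K%:R ^+ 2).
Let lam (K : nat) : R := bs * K%:R ^+ 2.

Let up_gt x : x <= (up x)%:R. Proof. exact/ltW/truncnS_gt. Qed.
Let up_le x : 0 <= x -> (up x)%:R <= x + 1.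
Proof. by move=> x0; rewrite /up -natr1 lerD2r truncn_le. Qed.

Let w0_gt0 : 0 < w0.
Proof. by rewrite !mulr_gt0 ?invr_gt0 ?ltr0n // muln_gt0 q_gt0. Qed.

Let G_gt0 K : (0 < K)%N -> (0 < w K * q * m)%N.
Proof. by move=> K0; rewrite !muln_gt0 expn_gt0 K0 q_gt0 m_gt0. Qed.

Let scale_cond (n K k : nat) (x : R) : 0 <= x -> (n <= K.+1)%N ->
  8 * x * K.+1%:R ^+ 2 <= k%:R -> (N n)%:R * (8 * x) ^+ d <= k%:R ^+ d.
Proof.
move=> x0 nK xk; apply: le_trans (_ : (8 * x * K.+1%:R ^+ 2) ^+ d <= _).
  rewrite [leRHS]exprMn mulrC ler_wpM2l ?exprn_ge0 ?mulr_ge0 //.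
  by rewrite -exprM -natrX ler_nat leq_exp2r // muln_gt0.
by rewrite lerXn2r ?nnegrE ?mulr_ge0 ?exprn_ge0.
Qed.

(** Consecutive sample sizes differ by at most 4^d K^(2d-1), one power of K less than K^(2d); for
    large K the factor bs^d K therefore absorbs 4^d (8b)^d = (32b)^d. *)
Let kD_cond K : (0 < K)%N -> (32 * b) ^+ d <= bs ^+ d * K%:R ->
  (N K.+1 - N K)%:R * (8 * b) ^+ d <= (kD K)%:R ^+ d.
Proof.
move=> K0 hK.
have [f fE] : exists f, (2 * d = f.+1)%N by exists (2 * d).-1; rewrite prednK // muln_gt0.
apply: le_trans (_ : (4 ^ d * K ^ f)%:R * (8 * b) ^+ d <= _).
  rewrite ler_wpM2r ?exprn_ge0 ?mulr_ge0 // ler_nat leq_subLR /N fE.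
  apply: leq_trans (leq_expSn f K0) _; rewrite leq_add2l leq_mul2r; apply/orP; right.
  by rewrite -fE expnM leq_subr.
apply: le_trans (_ : (bs * K%:R ^+ 2) ^+ d <= _); last first.
  by rewrite lerXn2r ?nnegrE ?up_gt // mulr_ge0 ?exprn_ge0 // ltW.
rewrite natrM !natrX -mulrA mulrCA -exprMn.
have -> : 4 * (8 * b) = 32 * b by ring.
by rewrite [leRHS]exprMn -exprM fE exprS mulrA [leLHS]mulrC ler_wpM2r ?exprn_ge0.
Qed.

Let bad (k K0 : nat) (K0_gt0 : (0 < K0)%N) : set T :=
  let K := (k + K0)%N in
  let GK := G_gt0 (ltn_addl k K0_gt0 : (0 < K)%N) in
  [set t | bad_upper P W2 M GK (N K.+1) (ks K) (kN K) (lam K)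
             (word_at (cell_at W1 M GK) (N K.+1) t)] `|`
  [set t | bad_lower P W2 M GK (N K) (ks K) (lam K)
             (word_at (cell_at W2 M GK) (N K) t)].

Lemma chain_count_comparison :
  {ae P, forall t, exists n0, forall n, (n0 <= n)%N -> forall x,
    (chain_count (fun i => W1 i t) n x)%:R <=
    (chain_count (fun i => W2 i t) n x)%:R +
      loss_const * (bs + bN) * n%:R `^ (d%:R)^-1 :> R}.
Proof.
(* Three thresholds for K: cells no wider than h0, K + 1 <= bs K^2, and the premise of [kD_cond]. *)
pose B0 : R := w0 / h0 + 2 / bs + (32 * b) ^+ d / bs ^+ d.
have B00 : 0 <= w0 / h0 by rewrite divr_ge0 ?ltW.
have B01 : 0 <= 2 / bs by rewrite divr_ge0 ?ltW.
have B02 : 0 <= (32 * b) ^+ d / bs ^+ d by rewrite divr_ge0 ?exprn_ge0 ?mulr_ge0 // ltW.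
have [K0 K0_gt0 large] : exists2 K0 : nat, (0 < K0)%N & forall k, let K := (k + K0)%N in
    [/\ (3 <= K)%N, w0 <= h0 * K%:R, 2 <= bs * K%:R & (32 * b) ^+ d <= bs ^+ d * K%:R].
  pose K0 := (up B0 + 3)%N; exists K0; first by rewrite addn_gt0 orbT.
  move=> k K; have KB : B0 <= K%:R.
    by apply: (le_trans (up_gt B0)); rewrite ler_nat /K /K0 addnC -addnA leq_addr.
  split; first by rewrite /K /K0 addnA leq_addl.
  - by rewrite [leRHS]mulrC -ler_pdivrMr //; rewrite /B0 in KB; lra.
  - by rewrite [leRHS]mulrC -ler_pdivrMr //; rewrite /B0 in KB; lra.
  - by rewrite [leRHS]mulrC -ler_pdivrMr ?exprn_gt0 //; rewrite /B0 in KB; lra.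
pose Y : R := #|{: {ffun 'I_d -> 'I_(q * m)}}|%:R.
pose D : R := (d * (q * m))%:R.
pose V : R := (16 * b + 2) / bs ^+ 2.
(* C / K^2 bounds the sum of the two failure probabilities: every exponential tail is at most 2 /
   K^2, each deviation term V / K^2, and the tie probability is (K + 1)^(4d) / K^(4d+2) up to a
   constant. *)
pose C : R := Y * (D * 2 + 2 + V) + d%:R * 16 ^+ d * (F * w0 * (2 * M) ^+ d.-1) + (Y * V + D * 2).
have V0 : 0 <= V by rewrite divr_ge0 ?sqr_ge0 // addr_ge0 ?mulr_ge0.
have C0 : 0 <= C.
  have FF : 0 <= d%:R * 16 ^+ d * (F * w0 * (2 * M) ^+ d.-1) :> R.
    by rewrite !mulr_ge0 ?exprn_ge0 ?mulr_ge0 // ltW.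
  have Y0 : 0 <= Y by apply: ler0n.
  have D0 : 0 <= D by apply: ler0n.
  have D2 : 0 <= D * 2 by apply: mulr_ge0.
  have S0 : 0 <= D * 2 + 2 + V by rewrite !addr_ge0.
  by apply: addr_ge0; apply: addr_ge0 => //; apply: mulr_ge0.
have hK k : let K := (k + K0)%N in
    [/\ (0 < K)%N, (8 <= w K)%N, 2 * M / (w K * q * m)%:R <= h0 & 0 < lam K].
  move=> K; have [K3 wh0 _ _] := large k; rewrite -/K in K3 wh0.
  have K1 : (0 < K)%N by apply: leq_trans K3.
  have Kw : (K ^ 2 <= w K)%N by apply: leq_pexp2l => //; apply: leq_addl.
  split => //.
  - by apply: leq_trans Kw; apply: (@leq_trans (3 ^ 2)); rewrite ?leq_exp2r.
  - have -> : 2 * M / (w K * q * m)%:R = w0 / (w K)%:R.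
      by rewrite /w0 -mulnA [(w K * _)%:R]natrM invfM mulrCA mulrC.
    rewrite ler_pdivrMr ?ltr0n ?expn_gt0 ?K1 //.
    apply: le_trans wh0 _; rewrite ler_pM2l // ler_nat.
    by apply: leq_trans Kw; rewrite -{1}[K]expn1 leq_pexp2l.
  - by rewrite mulr_gt0 // exprn_gt0 // ltr0n.
have inv_sqr k : ((k + K0)%:R ^+ 2)^-1 <= 2 * (k.+1%:R^-1 - k.+2%:R^-1) :> R.
  have k1 : 0 < k.+1%:R :> R by rewrite ltr0n.
  have e2 : k.+2%:R = k.+1%:R + 1 :> R by rewrite -natr1.
  apply: (@le_trans _ _ ((k.+1%:R ^+ 2)^-1)).
    rewrite lef_pV2 ?posrE ?exprn_gt0 ?ltr0n ?addn_gt0 ?K0_gt0 ?orbT //.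
    by rewrite lerXn2r ?nnegrE // ler_nat -addn1 leq_add2l.
  have k1' : 1 <= k.+1%:R :> R by rewrite ler1n.
  rewrite e2; move: k1 k1'; move: (k.+1%:R) => x x0 x1.
  have -> : 2 * (x^-1 - (x + 1)^-1) = 2 / (x * (x + 1)) by field; apply/andP; split; lra.
  rewrite ler_pdivlMr ?mulr_gt0 //; last by lra.
  rewrite mulrC ler_pdivrMr ?exprn_gt0 //; nra.
have mW i (W : nat -> T -> d.-tuple R) K (K_gt0 : (0 < K)%N) c : iid P W ->
    measurable (cell_at W M (G_gt0 K_gt0) i @^-1` [set c]).
  by move=> iW; exact: (measurable_cell_at iW M_gt0).
have mbad k : measurable (bad k K0_gt0).
  by apply: measurableU; apply: measurable_words => i c; apply: mW.
have Pbad k : (P (bad k K0_gt0) <= (C * 2 * (k.+1%:R^-1 - k.+2%:R^-1))%:E)%E.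
  rewrite /bad; set K := (k + K0)%N; set GK := G_gt0 _.
  have [K3 wh0 bsK b32] := large k; have [K1 w8 hh lam0] := hK k; rewrite -/K in K3 wh0 bsK b32 K1 w8 hh lam0.
  have mA (b' : pred (seq (cell d (w K * q * m)))) W n : iid P W -> measurable [set t | b' (word_at (cell_at W M GK) n t)].
    by move=> iW; apply: measurable_words => i c; apply: mW.
  set A1 := [set t | _]; set A2 := [set t | _].
  have PU : (P (A1 `|` A2) <= P A1 + P A2)%E.
    by apply: measureU2; [exact: mA iid1|exact: mA iid2].
  apply: le_trans PU _; rewrite /A1 /A2.
  rewrite (prob_cell_words iid1 M_gt0 GK (bad_upper P W2 M GK (N K.+1) (ks K) (kN K) (lam K))).
  rewrite (prob_cell_words iid2 M_gt0 GK (bad_lower P W2 M GK (N K) (ks K) (lam K))).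
  rewrite -EFinD lee_fin.
  have K2 : 0 < K%:R ^+ 2 :> R by rewrite exprn_gt0 // ltr0n.
  have bsn0 : bs != 0 by rewrite gt_eqF.
  have Kn0 : K%:R != 0 :> R by rewrite pnatr_eq0 -lt0n.
  have ksP : 8 * bs * K.+1%:R ^+ 2 <= (ks K)%:R.
    by apply: le_trans (up_gt _) _; rewrite ler_nat leq_addr.
  have kNP : 8 * bN * K.+1%:R ^+ 2 <= (kN K)%:R.
    by apply: le_trans (up_gt _) _; rewrite ler_nat leq_addr.
  have kGP : 8 * b * K.+1%:R ^+ 2 <= (kG K)%:R by apply: up_gt.
  have half j : (K <= j)%N -> 2^-1 ^+ j.+1 <= 2 / K%:R ^+ 2 :> R.
    move=> Kj; apply: (@le_trans _ _ (2^-1 ^+ K)).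
      by apply: ler_wiXn2l; rewrite ?invr_ge0 ?invf_le1 ?ler1n // leqW.
    rewrite ler_pdivlMr // exprVn mulrC ler_pdivrMr ?exprn_gt0 //.
    by rewrite -exprS -!natrX ler_nat leq_sqr_exp2.
  have kGV : ((kG K)%:R + 1) / lam K ^+ 2 <= V / K%:R ^+ 2.
    have KK : K.+1%:R ^+ 2 <= 2 * K%:R ^+ 2 :> R.
      by rewrite -!natrX -natrM ler_nat; move: K3; clear; nia.
    have kGle : (kG K)%:R + 1 <= (16 * b + 2) * K%:R ^+ 2.
      apply: le_trans (lerD (up_le _) (lexx 1)) _; first by rewrite !mulr_ge0 ?exprn_ge0.
      have : 1 <= K%:R ^+ 2 :> R by rewrite -natrX ler1n expn_gt0 K1.
      have := ler_wpM2l b_ge0 KK; set x := K%:R ^+ 2; set y := K.+1%:R ^+ 2.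
      by rewrite -mulrA; set z := b * y; nra.
    have l2 : lam K ^+ 2 = bs ^+ 2 * K%:R ^+ 2 * K%:R ^+ 2 by rewrite /lam exprMn; ring.
    rewrite /V l2 ler_pdivrMr ?mulr_gt0 ?exprn_gt0 ?ltr0n //.
    have -> : (16 * b + 2) / bs ^+ 2 / K%:R ^+ 2 * (bs ^+ 2 * K%:R ^+ 2 * K%:R ^+ 2) =
        (16 * b + 2) * K%:R ^+ 2.
      by field; rewrite ?bsn0 ?Kn0.
    exact: kGle.
  have tie : d%:R * (N K.+1)%:R ^+ 2 * (F * (2 * M / (w K * q * m)%:R) * (2 * M) ^+ d.-1) <=
      d%:R * 16 ^+ d * (F * w0 * (2 * M) ^+ d.-1) / K%:R ^+ 2.
    have -> : 2 * M / (w K * q * m)%:R = w0 / (w K)%:R.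
      by rewrite /w0 -mulnA [(w K * _)%:R]natrM invfM mulrCA mulrC.
    have wK : (w K)%:R = K%:R ^+ (4 * d) * K%:R ^+ 2 :> R by rewrite natrX exprD.
    have NK : (N K.+1)%:R ^+ 2 <= 16 ^+ d * K%:R ^+ (4 * d) :> R.
      rewrite /N natrX -exprM.
      have -> : (2 * d * 2 = 4 * d)%N by rewrite mulnAC.
      have -> : 16 ^+ d = 2 ^+ (4 * d) :> R by rewrite exprM; congr (_ ^+ d); rewrite -natrX.
      by rewrite -exprMn lerXn2r ?nnegrE // -natrM ler_nat; move: K1; clear; lia.
    have K4 : 0 < K%:R ^+ (4 * d) :> R by rewrite exprn_gt0 // ltr0n.
    rewrite wK; set A := F; set X := (2 * M) ^+ _; set k4 := K%:R ^+ (4 * d) in NK K4 *.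
    have AX : 0 <= F * w0 * X.
      by rewrite !mulr_ge0 // ?exprn_ge0 ?mulr_ge0 // ltW.
    have -> : d%:R * (N K.+1)%:R ^+ 2 * (A * (w0 / (k4 * K%:R ^+ 2)) * X) =
      (d%:R * (F * w0 * X) / K%:R ^+ 2) * ((N K.+1)%:R ^+ 2 / k4).
      by rewrite /A; move: K4 => /lt0r_neq0 k40; field; rewrite ?k40 ?Kn0.
    have -> : d%:R * 16 ^+ d * (F * w0 * X) / K%:R ^+ 2 =
      (d%:R * (F * w0 * X) / K%:R ^+ 2) * 16 ^+ d by ring.
    apply: ler_wpM2l; first by apply: divr_ge0; [exact: mulr_ge0|exact: ltW].
    by rewrite ler_pdivrMr.
  have hpos : 0 < 2 * M / (w K * q * m)%:R by rewrite divr_gt0 ?mulr_gt0 // ltr0n.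
  have up1 := prob_bad_upper d_gt0 w8 q_gt0 GK M_gt0 F_ge0 eps_ge0 iid1 iid2 cube1 cube2
    box1 box2 e_le (fun kk lo lo' => @box_shift _ kk lo lo' hpos hh) hbs hbN hb lam0
    (scale_cond (ltW bs_gt0) (leqnn _) ksP) (scale_cond bN_ge0 (leqnn _) kNP)
    (scale_cond b_ge0 (leqnn _) kGP).
  have low1 := prob_bad_lower d_gt0 w8 GK M_gt0 F_ge0 iid2 cube2 box2 hbs hb lam0
    (scale_cond (ltW bs_gt0) (leqnSn _) ksP) (scale_cond b_ge0 (leqnSn _) kGP).
  apply: le_trans (lerD up1 low1) _.
  apply: (@le_trans _ _ (C / K%:R ^+ 2)); last first.
    by rewrite -mulrA; apply: ler_wpM2l => //; apply: inv_sqr.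
  have Y0 : 0 <= Y by apply: ler0n.
  have D0 : 0 <= D by apply: ler0n.
  have -> : C / K%:R ^+ 2 = Y * (D * (2 / K%:R ^+ 2) + 2 / K%:R ^+ 2 + V / K%:R ^+ 2) +
      d%:R * 16 ^+ d * (F * w0 * (2 * M) ^+ d.-1) / K%:R ^+ 2 +
      (Y * (V / K%:R ^+ 2) + D * (2 / K%:R ^+ 2)) by rewrite /C; ring.
  have hks : 2^-1 ^+ (ks K).+1 <= 2 / K%:R ^+ 2 :> R by apply: half; apply: leq_addl.
  have hkN : 2^-1 ^+ (kN K).+1 <= 2 / K%:R ^+ 2 :> R by apply: half; apply: leq_addl.
  apply: lerD; apply: lerD => //.
  - by apply: ler_wpM2l => //; apply: lerD => //; apply: lerD => //; apply: ler_wpM2l.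
  - exact: ler_wpM2l.
  - exact: ler_wpM2l.
apply: filterS (borel_cantelli mbad (mulr_ge0 C0 (ler0n _ 2)) Pbad) => t [k1 hk].
exists (N (k1 + K0)) => n hn x.
(* The largest k with N (k + K0) <= n places n between two consecutive sample sizes. *)
have [k [k1k N2n nN1]] : exists k, [/\ (k1 <= k)%N, (N (k + K0) <= n)%N & (n <= N (k + K0).+1)%N].
  have bnd k : (N (k + K0) <= n -> k <= n)%N.
    apply: leq_trans; rewrite /N; apply: leq_trans (leq_addr K0 k) _.
    rewrite -{1}[(k + K0)%N]expn1; apply: leq_pexp2l; last by rewrite muln_gt0.
    by rewrite addn_gt0 K0_gt0 orbT.
  case: (ex_maxnP (ex_intro (fun k => N (k + K0) <= n)%N k1 hn) bnd) => k kn kmax.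
  exists k; split => //; first exact: kmax.
  by rewrite leqNgt; apply/negP => /ltnW; rewrite -addSn => /kmax; rewrite ltnn.
have := hk k k1k; rewrite /bad; set K := (k + K0)%N; set GK := G_gt0 _.
rewrite not_orE => -[/negP badA /negP badB].
have [K3 _ bsK b32] := large k; have [K1 w8 _ _] := hK k; rewrite -/K in K3 bsK b32 K1 w8 N2n nN1.
apply: le_trans (block_comparison d_gt0 w8 M_gt0 F_ge0 iid2 cube2 box2 hb N2n nN1
  (kD_cond K1 b32) badA badB x) _.
rewrite lerD2l.
have K2 : 0 < K%:R ^+ 2 :> R by rewrite exprn_gt0 // ltr0n.
have root : K%:R ^+ 2 <= n%:R `^ (d%:R)^-1 :> R.
  have -> : K%:R ^+ 2 = (N K)%:R `^ (d%:R)^-1 :> R.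
    rewrite /N natrX exprM -[K%:R ^+ 2 ^+ d]powR_mulrn ?exprn_ge0 // -powRrM mulfV ?powRr1 ?exprn_ge0 //.
    by rewrite pnatr_eq0 -lt0n.
  by apply: ge0_ler_powR; rewrite ?nnegrE ?invr_ge0 // ler_nat.
have KK : K.+1%:R ^+ 2 <= 2 * K%:R ^+ 2 :> R.
  by rewrite -!natrX -natrM ler_nat; move: K3; clear; nia.
have Ks : K%:R + 1 <= bs * K%:R ^+ 2.
  have K1' : 1 <= K%:R :> R by rewrite ler1n.
  rewrite expr2 mulrA; apply: (@le_trans _ _ (2 * K%:R)); first by lra.
  by rewrite ler_wpM2r.
have ksle : (ks K)%:R <= 17 * (bs * K%:R ^+ 2).
  have -> : (ks K)%:R = (up (8 * bs * K.+1%:R ^+ 2))%:R + K%:R :> R by rewrite -natrD.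
  have := up_le (mulr_ge0 (mulr_ge0 (ler0n R 8) (ltW bs_gt0)) (exprn_ge0 2 (ler0n R K.+1))).
  have := ler_wpM2l (ltW bs_gt0) KK; lra.
have kNle : (kN K)%:R <= 16 * (bN * K%:R ^+ 2) + bs * K%:R ^+ 2.
  have -> : (kN K)%:R = (up (8 * bN * K.+1%:R ^+ 2))%:R + K%:R :> R by rewrite -natrD.
  have := up_le (mulr_ge0 (mulr_ge0 (ler0n R 8) bN_ge0) (exprn_ge0 2 (ler0n R K.+1))).
  have := ler_wpM2l bN_ge0 KK; lra.
have kDle : (kD K)%:R + 1 <= 2 * (bs * K%:R ^+ 2).
  have := up_le (mulr_ge0 (ltW bs_gt0) (exprn_ge0 2 (ler0n R K))).
  have K1' : 1 <= K%:R :> R by rewrite ler1n.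
  by rewrite /kD; lra.
have cnt : (chain_loss d m (ks K) (kN K))%:R + (d * ks K)%:R = loss_count%:R * (ks K)%:R + (kN K)%:R :> R.
  rewrite -natrM -!natrD; congr _%:R; rewrite /chain_loss /loss_count; move: (ks K) (kN K); clear; nia.
have L0 : 0 <= loss_count%:R :> R by [].
have lks := ler_wpM2l L0 ksle.
have bb : 0 <= bN * K%:R ^+ 2 by rewrite mulr_ge0 // ltW.
have bb' : 0 <= bs * K%:R ^+ 2 by rewrite mulr_ge0 // ltW.
have Lb : 0 <= loss_count%:R * (bN * K%:R ^+ 2) by rewrite mulr_ge0.
apply: (@le_trans _ _ (loss_const * (bs + bN) * K%:R ^+ 2)); last first.
  apply: ler_wpM2l => //; apply: mulr_ge0; last by rewrite addr_ge0 // ltW.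
  by rewrite /loss_const addr_ge0 ?mulr_ge0.
have -> : loss_const * (bs + bN) * K%:R ^+ 2 = 17 * (loss_count%:R * (bs * K%:R ^+ 2)) +
   17 * (loss_count%:R * (bN * K%:R ^+ 2)) + 21 * (bs * K%:R ^+ 2) + 21 * (bN * K%:R ^+ 2).
  by rewrite /loss_const; ring.
rewrite /lam; move: lks cnt kNle kDle bb bb' Lb.
move: (bs * _) (bN * _) => u v.
have -> : loss_count%:R * (17 * u) = 17 * (loss_count%:R * u) by ring.
move: (_ * (ks K)%:R) (loss_count%:R * u) (loss_count%:R * v) => a1 a2 a3.
lra.
Qed.

End AlmostSure.

(** * Densities *)

Section IteratedIntegral.
Variable R : realType.
Notation leb := (@lebesgue_measure R).

(** Read off from the definition as a supremum over simple functions below the integrand; the inner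
    layers of [iint] can thus be compared without proving them measurable. *)
Lemma le_integral_nonneg (f g : R -> \bar R) :
  (forall x, 0 <= f x)%E -> (forall x, f x <= g x)%E ->
  (\int[leb]_x f x <= \int[leb]_x g x)%E.
Proof.
move=> f0 fg; rewrite !ge0_integralTE //; last by move=> x; exact: le_trans (fg x).
by apply: le_ereal_sup => _ [h hf <-]; exists h => // x; apply: le_trans (fg x).
Qed.

Lemma iint_ge0 n (f : n.-tuple R -> \bar R) : (forall x, 0 <= f x)%E -> (0 <= iint f)%E.
Proof.
elim: n f => [|n IH] f f0 /=; first exact: f0.
by apply: integral_ge0 => t _; apply: IH.
Qed.

Lemma le_iint n (f g : n.-tuple R -> \bar R) :
  (forall x, 0 <= f x)%E -> (forall x, f x <= g x)%E -> (iint f <= iint g)%E.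
Proof.
elim: n f g => [|n IH] f g f0 fg /=; first exact: fg.
by apply: le_integral_nonneg => t; [apply: iint_ge0|apply: IH].
Qed.

Lemma eq_iint n (f g : n.-tuple R -> \bar R) : f =1 g -> iint f = iint g.
Proof. by move=> fg; congr iint; apply/funext. Qed.

Lemma iint0 n : iint (fun _ : n.-tuple R => 0%E : \bar R) = 0%E.
Proof.
elim: n => // n IH /=; rewrite (eq_integral (fun=> 0%E)) ?integral0 //.
Qed.

Lemma iint_rbox n (lo : 'I_n -> R) (h K : R) : 0 <= h -> 0 <= K ->
  iint (fun x => (\1_(rbox lo h) x)%:E * K%:E)%E = (K * h ^+ n)%:E.
Proof.
move=> h0 K0; elim: n lo => [|n IH] lo /=.
  rewrite indicE mem_set ?mul1e ?mulr1 //; by case.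
pose A : set R := [set` `[lo ord0, lo ord0 + h[].
apply: (@etrans _ _ (\int[leb]_t ((\1_A t)%:E * (K * h ^+ n)%:E))%E).
  apply: eq_integral => t _; rewrite -(IH (fun i => lo (lift ord0 i))).
  rewrite (@eq_iint _ _ (fun x => (\1_A t)%:E * ((\1_(rbox (fun i => lo (lift ord0 i)) h) x)%:E * K%:E))%E).
    rewrite indicE; case: (t \in A).
      by rewrite mul1e; apply: eq_iint => x; rewrite mul1e.
    by rewrite mul0e -[RHS](iint0 n); apply: eq_iint => x; rewrite mul0e.
  move=> x; rewrite -!EFinM; congr _%:E; rewrite mulrA; congr (_ * _); rewrite !indicE.
  rewrite -natrM mulnb; congr (nat_of_bool _)%:R; apply/idP/andP.
    move=> /set_mem hx; split; apply/mem_set.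
      by have := hx ord0; rewrite /A /= in_itv.
    by move=> i; have := hx (lift ord0 i); rewrite tnthS.
  move=> [/set_mem + /set_mem hx]; rewrite /A /= in_itv /= => ht.
  apply/mem_set => i; case: (unliftP ord0 i) => [j ->|->] //.
  by rewrite tnthS.
have mA : measurable (A : set (measurableTypeR R)) by exact: measurable_itv.
rewrite ge0_integralZr //.
- have eA : leb A = h%:E.
    apply: (etrans (lebesgue_measure_itv _)); rewrite /= lte_fin ltrDl; case: ltrP => h1.
      by rewrite -EFinD; congr _%:E; ring.
    by congr _%:E; apply/eqP; rewrite eq_le h0 h1.
  have := integral_indic leb measurableT mA; rewrite setIT => e1.
  apply: (etrans (congr1 (fun z => z * (K * h ^+ n)%:E)%E (etrans e1 eA))).
  by rewrite -EFinM exprS; congr _%:E; ring.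
- by apply: measurableT_comp => //; exact: measurable_indic.
- by rewrite lee_fin mulr_ge0 ?exprn_ge0.
Qed.
End IteratedIntegral.

Section DensityBounds.
Variables (R : realType) (d : nat) (dT : measure_display) (T : measurableType dT).
Variables (P : probability T R) (X : T -> d.-tuple R) (f : d.-tuple R -> R).
Hypotheses (hX : has_density P X f) (f_ge0 : forall x, 0 <= f x).

Let ind_ge0 (A : set (d.-tuple R)) x : (0 <= (\1_A x)%:E * (f x)%:E)%E.
Proof. by rewrite -EFinM lee_fin mulr_ge0. Qed.

Lemma density_null (A : set (d.-tuple R)) : measurable A -> (forall x, A x -> f x = 0) ->
  P (X @^-1` A) = 0%E.
Proof.
move=> mA fA; have [_ ->] // := hX.
rewrite -(iint0 R d); apply: eq_iint => x; rewrite indicE.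
by case: (boolP (x \in A)) => [/set_mem/fA ->|_]; rewrite ?mule0 ?mul0e.
Qed.

Lemma density_box_le lo (h K : R) : 0 <= h -> 0 <= K -> (forall x, rbox lo h x -> f x <= K) ->
  (P (X @^-1` rbox lo h) <= (K * h ^+ d)%:E)%E.
Proof.
move=> h0 K0 fK; have [_ ->] := hX; last exact: measurable_rbox.
rewrite -(iint_rbox lo) //; apply: le_iint => // x; rewrite indicE.
case: (boolP (x \in _)) => [/set_mem/fK|_]; last by rewrite !mul0e.
by rewrite !mul1e lee_fin.
Qed.

Lemma density_box_ge lo (h K : R) : 0 <= h -> 0 <= K -> (forall x, rbox lo h x -> K <= f x) ->
  ((K * h ^+ d)%:E <= P (X @^-1` rbox lo h))%E.
Proof.
move=> h0 K0 fK; have [_ ->] := hX; last exact: measurable_rbox.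
rewrite -(iint_rbox lo) //; apply: le_iint => x; rewrite indicE.
  by rewrite -EFinM lee_fin mulr_ge0.
case: (boolP (x \in _)) => [/set_mem/fK|_]; last by rewrite !mul0e.
by rewrite !mul1e lee_fin.
Qed.

End DensityBounds.

(** * Laws on a product space, determined on rectangles *)

Section ProductLaws.
Variables (R : realType) (d1 d2 : measure_display).
Variables (T1 : measurableType d1) (T2 : measurableType d2).

Lemma eq_measure_rectangles (m1 m2 : {measure set (T1 * T2) -> \bar R}) :
  (m1 setT < +oo)%E ->
  (forall A B, measurable A -> measurable B -> m1 (A `*` B) = m2 (A `*` B)) ->
  forall S, measurable S -> m1 S = m2 S.
Proof.
move=> m1oo m12.
pose C : set (set (T1 * T2)) := [set A `*` B | A in measurable & B in measurable].
move=> S mS; apply: (measure_unique C (fun=> setT)) => //.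
- exact: measurable_prod_measurableType.
- move=> _ _ [A1 mA1 [B1 mB1 <-]] [A2 mA2 [B2 mB2 <-]].
  by rewrite -setXI; exists (A1 `&` A2); [exact: measurableI|exists (B1 `&` B2) => //; exact: measurableI].
- by move=> _; exists setT => //; exists setT => //; rewrite setXTT.
- by rewrite bigcup_const.
- by move=> _ [A mA [B mB <-]]; apply: m12.
Qed.

Variables (dT : measure_display) (T : measurableType dT) (P : probability T R).

Lemma law_rectangles (U V : T -> T1 * T2) : measurable_fun setT U -> measurable_fun setT V ->
  (forall A B, measurable A -> measurable B -> P (U @^-1` (A `*` B)) = P (V @^-1` (A `*` B))) ->
  forall S, measurable S -> P (U @^-1` S) = P (V @^-1` S).
Proof.
move=> mU mV UV S mS.
apply: (@eq_measure_rectangles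
  (measure_function_pushforward__canonical__measure_function_Measure P mU)
  (measure_function_pushforward__canonical__measure_function_Measure P mV)) => //.
by rewrite /= /pushforward preimage_setT probability_setT ltry.
Qed.

(** Both sides are finite measures in S: the image under U of P restricted to D, and the law of U
    scaled by P D. They agree on rectangles. *)
Lemma indep_rectangles (U : T -> T1 * T2) (D : set T) :
  measurable_fun setT U -> measurable D ->
  (forall A B, measurable A -> measurable B ->
     P (D `&` U @^-1` (A `*` B)) = (P D * P (U @^-1` (A `*` B)))%E) ->
  forall S, measurable S -> P (D `&` U @^-1` S) = (P D * P (U @^-1` S))%E.
Proof.
move=> mU mD DU S mS.
have PD : P D = (fine (P D))%:E by rewrite fineK // fin_num_measure.
have r0 : 0 <= fine (P D) by apply: fine_ge0.
pose m1 := measure_function_pushforward__canonical__measure_function_Measure (mrestr P mD) mU.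
pose m2 := measure_function_pushforward__canonical__measure_function_Measure P mU.
have := @eq_measure_rectangles m1 (mscale (NngNum r0) m2).
rewrite /= /pushforward /mrestr /mscale /= -PD => h.
rewrite setIC; apply: h => //.
  by rewrite setTI; apply: le_lt_trans (probability_le1 P mD) (ltry _).
by move=> A B mA mB; rewrite setIC; apply: DU.
Qed.

End ProductLaws.

Lemma measurable_vadd_scale (R : realType) (d : nat) (delta : R) :
  measurable_fun setT (fun p : d.-tuple R * d.-tuple R => vadd p.1 (vscale delta p.2)).
Proof.
apply/measurable_fun_tnthP => i.
rewrite (_ : _ \o _ = (fun p : d.-tuple R * d.-tuple R => tnth p.1 i + delta * tnth p.2 i)); last first.
  by apply/funext => p /=; rewrite !tnth_mktuple.
apply: measurable_funD.
  exact: (measurableT_comp (measurable_tnth i)).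
apply: measurable_funM => //.
exact: (measurableT_comp (measurable_tnth i)).
Qed.

Section SumBounds.
Variables (R : realType) (d : nat) (dT : measure_display) (T : measurableType dT).
Variables (P : probability T R) (X Y : T -> d.-tuple R).
Hypotheses (mX : measurable_fun setT X) (mY : measurable_fun setT Y).
Hypothesis XY : forall A B, measurable A -> measurable B ->
  P (X @^-1` A `&` Y @^-1` B) = (P (X @^-1` A) * P (Y @^-1` B))%E.
Variables (delta : R) (S B0 : set (d.-tuple R)).
Hypotheses (mS : measurable S) (mB0 : measurable B0) (YB0 : P (Y @^-1` ~` B0) = 0%E).

Let E : set (d.-tuple R * d.-tuple R) := [set p | S (vadd p.2 (vscale delta p.1))].
Let fiber (y : d.-tuple R) : set (d.-tuple R) := [set x | S (vadd x (vscale delta y))].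

Let X' : {mfun T >-> d.-tuple R} := HB.pack X (isMeasurableFun.Build _ _ _ _ X mX).
Let Y' : {mfun T >-> d.-tuple R} := HB.pack Y (isMeasurableFun.Build _ _ _ _ Y mY).

Let mE : measurable E.
Proof.
have m2 : measurable_fun setT (fun p : d.-tuple R * d.-tuple R => (p.2, p.1)).
  by apply: measurable_fun_pair; [exact: measurable_snd|exact: measurable_fst].
have := measurableT_comp (measurable_vadd_scale delta) m2.
by move=> /(_ measurableT _ mS); rewrite setTI.
Qed.

(** Independence makes the law of (Y, X) a product measure, whose value is the integral of the
    sections over y. *)
Let sum_lawE : P ((fun t => vadd (X t) (vscale delta (Y t))) @^-1` S) =
  (\int[distribution P Y']_y P (X @^-1` fiber y))%E.
Proof.
have mYX : measurable_fun setT (fun t => (Y t, X t)) by apply: measurable_fun_pair.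
have u := @product_measure_unique _ _ _ _ R (distribution P Y') (distribution P X')
  (measure_function_pushforward__canonical__measure_function_Measure P mYX).
have {}u := u _ E mE; apply: (etrans (esym (u _))).
  move=> A B mA mB; rewrite /= /distribution /pushforward /=.
  by rewrite muleC -XY // setIC.
rewrite /product_measure1; apply: eq_integral => y _ /=.
by rewrite /distribution /pushforward /=; congr (P _); apply/seteqP; split => t /=;
  rewrite /xsection /= ?inE.
Qed.

Let mfib : measurable_fun setT (fun y => P (X @^-1` fiber y)).
Proof.
have := measurable_fun_xsection (distribution P X') mE.
apply: eq_measurable_fun => y _ /=; rewrite /distribution /pushforward /=.
by congr (P _); apply/seteqP; split => t /=; rewrite /xsection /= ?inE.
Qed.

Let PB0 : distribution P Y' B0 = 1%E.
Proof.
rewrite /distribution /pushforward /=.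
have := YB0; rewrite preimage_setC probability_setC; last first.
  by rewrite -[X in measurable X]setTI; exact: mY.
have : P (Y @^-1` B0) \is a fin_num by rewrite fin_num_measure // -[X in measurable X]setTI; exact: mY.
case: (P _) => // r _ /eqP; rewrite -EFinB eqe subr_eq0 => /eqP <- //.
Qed.

Let sum_law_on : P ((fun t => vadd (X t) (vscale delta (Y t))) @^-1` S) =
  (\int[distribution P Y']_(y in B0) P (X @^-1` fiber y))%E.
Proof.
rewrite sum_lawE (ge0_negligible_integral (N := ~` B0)) //; last exact: measurableC.
by rewrite setTD setCK.
Qed.

Let mfibB0 : measurable_fun B0 (fun y => P (X @^-1` fiber y)).
Proof. exact: measurable_funS mfib. Qed.

(** Averaging over y: a bound valid for every noise value in the support passes to the sum, so no
    density of X + delta Y is ever computed. *)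
Lemma sum_law_le (hi : \bar R) : (0 <= hi)%E -> (forall y, B0 y -> (P (X @^-1` fiber y) <= hi)%E) ->
  (P ((fun t => vadd (X t) (vscale delta (Y t))) @^-1` S) <= hi)%E.
Proof.
move=> hi0 h; rewrite sum_law_on -[leRHS]mule1 -PB0 -integral_cst //.
by apply: ge0_le_integral => //; exact: measurable_cst.
Qed.

Lemma sum_law_ge (lo : \bar R) : (0 <= lo)%E -> (forall y, B0 y -> (lo <= P (X @^-1` fiber y))%E) ->
  (lo <= P ((fun t => vadd (X t) (vscale delta (Y t))) @^-1` S))%E.
Proof.
move=> lo0 h; rewrite sum_law_on -[leLHS]mule1 -PB0 -integral_cst //.
by apply: ge0_le_integral => //; exact: measurable_cst.
Qed.

End SumBounds.

Section NoisySample.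
Variables (R : realType) (d : nat) (dT : measure_display) (T : measurableType dT).
Variables (P : probability T R) (X Y : nat -> T -> d.-tuple R) (f g : d.-tuple R -> R).
Let V (k : nat + nat) : T -> d.-tuple R := match k with inl i => X i | inr i => Y i end.
Hypotheses (hX : forall i, has_density P (X i) f) (hY : forall i, has_density P (Y i) g).
Hypothesis hind : mutually_independent P V.
Variable delta : R.
Let Z i t := vadd (X i t) (vscale delta (Y i t)).

Let mX i : measurable_fun setT (X i). Proof. by have [] := hX i. Qed.
Let mY i : measurable_fun setT (Y i). Proof. by have [] := hY i. Qed.
Let mV k : measurable_fun setT (V k). Proof. by case: k. Qed.
Let mXY i : measurable_fun setT (fun t => (X i t, Y i t)).
Proof. exact: measurable_fun_pair. Qed.
Let mZ i : measurable_fun setT (Z i).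
Proof. exact: (measurableT_comp (measurable_vadd_scale delta) (mXY i)). Qed.

Let mpre (W : T -> d.-tuple R) A : measurable_fun setT W -> measurable A -> measurable (W @^-1` A).
Proof. by move=> mW mA; rewrite -[X in measurable X]setTI; apply: mW. Qed.

Lemma indep_pair i A B : measurable A -> measurable B ->
  P (X i @^-1` A `&` Y i @^-1` B) = (P (X i @^-1` A) * P (Y i @^-1` B))%E.
Proof.
move=> mA mB.
have := @hind [:: inl i; inr i] (fun k => match k with inl _ => A | inr _ => B end) isT.
rewrite !big_cons big_nil mule1 /= => <-; last by case.
congr (P _); apply/seteqP; split => [t [h1 h2] [j|j] /=|t h].
- by rewrite !inE => /orP[/eqP[->]|] //.
- by rewrite !inE => /eqP[->].
- by split; [apply: (h (inl i))|apply: (h (inr i))]; rewrite /= !inE eqxx ?orbT.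
Qed.

Lemma iid_sample : iid P X.
Proof.
split => // [i A mA|n A mA]; first by rewrite (hX i).2 // (hX 0%N).2.
have := @hind (map inl (iota 0 n)) (fun k => match k with inl i => A i | inr _ => setT end).
rewrite map_inj_uniq ?iota_uniq; last by move=> a b [].
move=> /(_ isT); rewrite big_map => h.
rewrite -(big_mkord predT (fun i => P (X i @^-1` A i))) /index_iota subn0 -h; last by case.
congr (P _); apply/seteqP; split => t ht.
  by move=> _ /= /mapP[i + ->]; rewrite mem_iota => /andP[_ ilt]; apply: ht.
by move=> i /= ilt; apply: (ht (inl i)); rewrite /= map_f // mem_iota.
Qed.

Let idx (k : nat + nat) : nat := match k with inl i => i | inr i => i end.

(* The pairs (X_i, Y_i) with i < k are replaced one at a time by their sums; the
   remaining variables are kept as rectangles, so that the pi-system argument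
   applies to one pair at each step. *)
Lemma noisy_indep_prefix k (J : seq (nat + nat)) (A : nat -> set (d.-tuple R))
    (B : nat + nat -> set (d.-tuple R)) :
  uniq J -> (forall j, j \in J -> (k <= idx j)%N) ->
  (forall i, measurable (A i)) -> (forall j, measurable (B j)) ->
  P (\bigcap_(i < k) (Z i @^-1` A i) `&` \bigcap_(j in [set j | j \in J]) (V j @^-1` B j)) =
  ((\prod_(i < k) P (Z i @^-1` A i)) * \prod_(j <- J) P (V j @^-1` B j))%E.
Proof.
elim: k J B => [|k IH] J B uJ kJ mA mB.
  rewrite big_ord0 mul1e -hind //; congr (P _); apply/seteqP; split => [t [] //|t ht].
  by split.
have kJ' j : j \in J -> (k <= idx j)%N by move/kJ/ltnW.
pose D := \bigcap_(i < k) (Z i @^-1` A i) `&` \bigcap_(j in [set j | j \in J]) (V j @^-1` B j).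
have mD : measurable D.
  apply: measurableI; first by apply: bigcap_measurableType => i _; exact: mpre.
  apply: fin_bigcap_measurable => [|j _]; last exact: mpre.
  exact: finite_seq.
pose S := (fun p : d.-tuple R * d.-tuple R => vadd p.1 (vscale delta p.2)) @^-1` A k.
have mS : measurable S.
  by rewrite -[S]setTI; apply: measurable_vadd_scale.
have nk : inl k \notin J /\ inr k \notin J.
  by split; apply/negP => /kJ /=; rewrite ltnn.
have rect A1 B1 : measurable A1 -> measurable B1 ->
    P (D `&` (fun t => (X k t, Y k t)) @^-1` (A1 `*` B1)) =
    (P D * P ((fun t => (X k t, Y k t)) @^-1` (A1 `*` B1)))%E.
  move=> mA1 mB1.
  (* The rectangle for the k-th pair joins the untouched variables, so that the induction hypothesis
     applies to the family J enlarged by these two indices. *)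
  pose B' j := if j == inl k then A1 else if j == inr k then B1 else B j.
  have BB' j : j \in J -> B' j = B j.
    move=> jJ; rewrite /B'; case: eqP => [e|_]; first by move: (nk.1); rewrite -e jJ.
    by case: eqP => [e|//]; move: (nk.2); rewrite -e jJ.
  have := IH [:: inl k, inr k & J] B'.
  rewrite /= !inE negb_or uJ (nk.1) (nk.2) /= => /(_ isT).
  have kJ2 j : [|| j == inl k, j == inr k | j \in J] -> (k <= idx j)%N.
    by case/or3P => [/eqP ->|/eqP ->|/kJ'].
  have mB' j : measurable (B' j) by rewrite /B'; case: ifP => // _; case: ifP.
  move=> /(_ kJ2 mA mB') e1.
  have -> : (fun t => (X k t, Y k t)) @^-1` (A1 `*` B1) = X k @^-1` A1 `&` Y k @^-1` B1 by [].
  rewrite indep_pair // IH //.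
  transitivity (P (\bigcap_(i < k) (Z i @^-1` A i) `&`
    \bigcap_(j in [set j | j \in [:: inl k, inr k & J]]) (V j @^-1` B' j))).
    congr (P _); apply/seteqP; split => t.
      move=> [[h1 h2] [h3 h4]]; split => // j /=; rewrite !inE /B'.
      case: eqP => [->//|_] /=; case: eqP => [->//|_] /=; exact: h2.
    move=> [h1 h2]; split.
      split => // j /= jJ; have := h2 j; rewrite /= !inE jJ !orbT BB' //; exact.
    by split; [have := h2 (inl k)|have := h2 (inr k)]; rewrite /= !inE eqxx ?orbT /B' ?eqxx; exact.
  rewrite e1 !big_cons /B' /= !eqxx.
  have -> : (\prod_(j <- J) P (V j @^-1` B' j) = \prod_(j <- J) P (V j @^-1` B j))%E.
    by apply: eq_big_seq => j jJ; rewrite BB'.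
  rewrite -!muleA; congr (_ * _)%E.
  by rewrite [RHS]muleC -muleA.
have := indep_rectangles (mXY k) mD rect mS => e1.
rewrite big_ord_recr /= -muleA [(P (Z k @^-1` _) * _)%E]muleC muleA -IH // -/D.
transitivity (P (D `&` (fun t => (X k t, Y k t)) @^-1` S)); last by rewrite e1.
congr (P _); apply/seteqP; split => t.
  move=> [h1 h2]; split; last exact: (h1 k (ltnSn k)).
  by split => // i /= ik; apply: h1; rewrite /= ltnS ltnW.
move=> [[h1 h2] h3]; split => // i /=; rewrite ltnS leq_eqVlt => /orP[/eqP ->//|]; exact: h1.
Qed.

Lemma iid_noisy : iid P Z.
Proof.
split => // [i A mA|n A mA].
  apply: (law_rectangles (mXY i) (mXY 0%N) _ (_ : measurable
    ((fun p : d.-tuple R * d.-tuple R => vadd p.1 (vscale delta p.2)) @^-1` A))) => [A1 B1 mA1 mB1|].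
    have e j : (fun t => (X j t, Y j t)) @^-1` (A1 `*` B1) = X j @^-1` A1 `&` Y j @^-1` B1 by [].
    by rewrite !e !indep_pair // (hX i).2 // (hX 0%N).2 // (hY i).2 // (hY 0%N).2.
  by rewrite -[X in measurable X]setTI; apply: measurable_vadd_scale.
have := @noisy_indep_prefix n [::] A (fun=> setT) isT.
rewrite big_nil mule1 => <- //; congr (P _); apply/seteqP; split => [t ht|t [] //].
by split.
Qed.

End NoisySample.

(** * Inward shifts of a Lipschitz domain *)

Section InwardShift.
Variables (R : realType) (d : nat).
Hypothesis d_gt0 : (0 < d)%N.
Implicit Types (x y p e v : d.-tuple R) (Omega : set (d.-tuple R)).

Lemma norm_tnth_le_enorm v i : `|tnth v i| <= enorm v.
Proof.
rewrite /enorm -sqrtr_sqr ler_wsqrtr // /dot (bigD1 i) //= expr2 lerDl.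
by apply: sumr_ge0 => j _; rewrite -expr2 sqr_ge0.
Qed.

Lemma enorm_le v (s : R) : 0 <= s -> (forall i, `|tnth v i| <= s) -> enorm v <= d%:R * s.
Proof.
move=> s0 vs; rewrite /enorm -[leRHS]ger0_norm ?mulr_ge0 // -sqrtr_sqr ler_wsqrtr //.
rewrite /dot; apply: (@le_trans _ _ (\sum_(i < d) s ^+ 2)).
  apply: ler_sum => i _; rewrite -expr2 -[X in X <= _]real_normK ?num_real //.
  by rewrite lerXn2r ?nnegrE.
rewrite sumr_const card_ord -[leLHS]mulr_natl exprMn ler_wpM2r ?sqr_ge0 //.
by rewrite -natrX ler_nat -{1}[d]expn1 leq_pexp2l.
Qed.

Lemma norm_dot_le v e (s : R) : (forall i, `|tnth v i| <= s) -> (forall i, `|tnth e i| <= 1) ->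
  `|dot v e| <= d%:R * s.
Proof.
move=> vs e1; apply: le_trans (ler_norm_sum _ _ _) _.
apply: (@le_trans _ _ (\sum_(i < d) s)); last by rewrite sumr_const card_ord mulr_natl.
apply: ler_sum => i _; rewrite normrM; apply: le_trans (vs i).
by rewrite ler_piMr.
Qed.

(* Near p, the vector e points into Omega: translating by s e keeps points of
   Omega inside Omega, with room rho as soon as s >= j rho. *)
Definition inward (Omega : set (d.-tuple R)) (j : nat) p := exists e,
  (forall i, `|tnth e i| <= 1) /\
  forall s rho : R, 0 < rho -> j%:R * rho <= s -> j%:R * s <= 1 ->
  forall x, Omega x -> (forall i, j%:R * `|tnth x i - tnth p i| <= 1) ->
  forall y, (forall i, `|tnth y i - tnth x i - s * tnth e i| <= rho) -> Omega y.

Lemma inward_le Omega j j' p : (j <= j')%N -> inward Omega j p -> inward Omega j' p.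
Proof.
move=> jj [e [e1 H]]; exists e; split => // s rho r0 h1 h2 x Ox h3 y h4.
have jjR : j%:R <= j'%:R :> R by rewrite ler_nat.
have s0 : 0 <= s by apply: le_trans h1; rewrite mulr_ge0 // ltW.
apply: (H s rho r0 _ _ x Ox) => //.
- by apply: le_trans h1; rewrite ler_wpM2r // ltW.
- by apply: le_trans h2; rewrite ler_wpM2r.
- by move=> i; apply: le_trans (h3 i); rewrite ler_wpM2r.
Qed.

(** Triangle inequality: each half of the radius 1 / j is used once. This makes the property locally
    uniform in p, ready for compactness. *)
Lemma inward_near Omega j p p' : (forall i, (2 * j)%:R * `|tnth p' i - tnth p i| <= 1) ->
  inward Omega j p -> inward Omega (2 * j) p'.
Proof.
move=> pp [e [e1 H]]; exists e; split => // s rho r0; rewrite natrM => h1 h2 x Ox h3 y h4.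
have j0 : 0 <= j%:R :> R by [].
have jr : 0 <= j%:R * rho by rewrite mulr_ge0 // ltW.
have s0 : 0 <= s by lra.
have js : 0 <= j%:R * s by rewrite mulr_ge0.
apply: (H s rho r0 _ _ x Ox) => //; [lra|lra|move=> i].
have := pp i; rewrite natrM; have := h3 i.
have := ler_wpM2l j0 (ler_distD (tnth p' i) (tnth x i) (tnth p i)); lra.
Qed.

(** Inside Omega the zero vector serves, and away from the closure the claim is vacuous. At the
    boundary e is the vertical direction of the chart: the shift raises the height by s, whereas the
    error rho changes height and graph by at most a multiple of rho. *)
Lemma inward_ex Omega p : is_open_set Omega -> lipschitz_boundary Omega ->
  exists2 j, (0 < j)%N & inward Omega j p.
Proof.
move=> Oo Ol.
have natgt (a : R) : exists j, (0 < j)%N /\ a < j%:R.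
  by exists (Num.truncn a).+1; split => //; apply: truncnS_gt.
have near_le (r : R) (j : nat) (v : d.-tuple R) (c : R) : 0 <= c -> (0 < j)%N ->
    c * d%:R < r * j%:R -> (forall i, j%:R * `|tnth v i| <= c) -> enorm v < r.
  move=> c0 j0 cr vj; have jR : 0 < j%:R :> R by rewrite ltr0n.
  apply: (@le_lt_trans _ _ (d%:R * (c / j%:R))).
    by apply: enorm_le => [|i]; rewrite ?divr_ge0 // ler_pdivlMr // mulrC.
  by rewrite mulrA ltr_pdivrMr // mulrC.
have pt (c r : R) : 0 < r -> exists j, (0 < j)%N /\ c * d%:R < r * j%:R.
  move=> r0; have [j [j0 jc]] := natgt (c * d%:R / r); exists j; split => //.
  by rewrite [ltRHS]mulrC -ltr_pdivrMr.
have [Op|nOp] := pselect (Omega p).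
  have [r r0 Or] := Oo p Op; have [j [j0 jr]] := pt 2 r r0; exists j => //.
  have jR : 1 <= j%:R :> R by rewrite ler1n.
  exists [tuple of nseq d 0]; split => [i|s rho rho0 h1 h2 x Ox h3 y h4].
    by rewrite tnth_nseq normr0.
  apply: Or; apply: (near_le r j _ 2) => // i; rewrite tnth_mktuple.
  have := h4 i; rewrite tnth_nseq mulr0 subr0 => h4i.
  have := ler_distD (tnth x i) (tnth y i) (tnth p i) => t.
  have {}t := ler_wpM2l (ler0n R j) (le_trans t (lerD h4i (lexx _))).
  have := h3 i; rewrite mulrDr in t.
  have s0 : 0 <= s by apply: le_trans h1; rewrite mulr_ge0 // ltW.
  have : j%:R * rho <= 1 by apply: le_trans h1 _; apply: le_trans h2; rewrite ler_peMl.
  lra.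
have [[r [r0 Or]]|bd] := pselect (exists r : R, 0 < r /\ forall x, Omega x -> r <= enorm (vsub x p)).
  have [j [j0 jr]] := pt 1 r r0; exists j => //.
  exists [tuple of nseq d 0]; split => [i|s rho rho0 h1 h2 x Ox h3 y h4].
    by rewrite tnth_nseq normr0.
  have := Or x Ox; rewrite leNgt (near_le r j _ 1) // => i.
  by rewrite tnth_mktuple.
have /Ol : bdry_point Omega p.
  split => // r r0; apply: contrapT => nx; apply: bd; exists r; split => // x Ox.
  by rewrite leNgt; apply/negP => lt; apply: nx; exists x.
move=> [r r0 [e [en [gamma [L [gL Og]]]]]].
(* The first term bounds the change of [gamma] caused by the perpendicular error, the second the
   vertical error, both per unit of rho. *)
pose C : R := `|L| * (d%:R * (1 + d%:R)) + d%:R.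
have [j1 [j10 j1r]] := pt 3 r r0; have [j2 [j20 j2C]] := natgt C.
pose j := (j1 + j2)%N; have j0 : (0 < j)%N by rewrite addn_gt0 j10.
exists j => //; exists e.
have e1 i : `|tnth e i| <= 1 by rewrite -en norm_tnth_le_enorm.
have ee : dot e e = 1.
  have d0 : 0 <= dot e e by apply: sumr_ge0 => i _; rewrite -expr2 sqr_ge0.
  by rewrite -[LHS]sqr_sqrtr // -/(enorm e) en expr1n.
split => // s rho rho0 h1 h2 x Ox h3 y h4.
have jr : 3 * d%:R < r * j%:R.
  apply: lt_le_trans j1r _; rewrite ler_pM2l // ler_nat; exact: leq_addr.
have jC : C <= j%:R.
  by apply: le_trans (ltW j2C) _; rewrite ler_nat leq_addl.
have jR : 1 <= j%:R :> R by rewrite ler1n.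
have s0 : 0 <= s by apply: le_trans h1; rewrite mulr_ge0 // ltW.
have jrho : j%:R * rho <= 1 by apply: le_trans h1 _; apply: le_trans h2; rewrite ler_peMl.
have xr : enorm (vsub x p) < r.
  apply: (near_le r j _ 3) => // i; rewrite tnth_mktuple; have := h3 i; lra.
have yr : enorm (vsub y p) < r.
  apply: (near_le r j _ 3) => // i; rewrite tnth_mktuple.
  have -> : tnth y i - tnth p i = (tnth y i - tnth x i - s * tnth e i) +
    (s * tnth e i + (tnth x i - tnth p i)) by ring.
  have t1 := ler_normD (tnth y i - tnth x i - s * tnth e i) (s * tnth e i + (tnth x i - tnth p i)).
  have t2 := ler_normD (s * tnth e i) (tnth x i - tnth p i).
  have t3 : `|s * tnth e i| <= s by rewrite normrM (ger0_norm s0) ler_piMr.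
  have t4 := h4 i; have t5 := h3 i.
  have {}t1 := le_trans t1 (lerD t4 (le_trans t2 (lerD t3 (lexx _)))).
  have := ler_wpM2l (ler0n R j) t1; rewrite !mulrDr; lra.
apply/(Og y yr); have := (Og x xr).1 Ox.
pose v := [tuple tnth y i - tnth x i - s * tnth e i | i < d].
have vr i : `|tnth v i| <= rho by rewrite tnth_mktuple.
have dv := norm_dot_le vr e1.
have dy : dot (vsub y p) e = dot (vsub x p) e + s + dot v e.
  have sE : s = s * dot e e by rewrite ee mulr1.
  rewrite [X in _ + X + _]sE /dot mulr_sumr -!big_split /=; apply: eq_bigr => i _.
  by rewrite !tnth_mktuple; ring.
(* The shift s e is invisible to the perpendicular projection; only the error v remains. *)
have pe : enorm (vsub (proj_perp e (vsub y p)) (proj_perp e (vsub x p))) <= d%:R * ((1 + d%:R) * rho).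
  apply: enorm_le => [|i]; first by rewrite mulr_ge0 ?addr_ge0 // ltW.
  rewrite !tnth_mktuple dy.
  have -> : tnth y i - tnth p i - (dot (vsub x p) e + s + dot v e) * tnth e i -
    (tnth x i - tnth p i - dot (vsub x p) e * tnth e i) = tnth v i - dot v e * tnth e i.
    by rewrite tnth_mktuple; ring.
  apply: le_trans (ler_normB _ _) _; rewrite mulrDl mul1r; apply: lerD => //.
  by rewrite normrM; apply: le_trans dv; rewrite ler_piMr.
have gy := gL (proj_perp e (vsub y p)) (proj_perp e (vsub x p)).
have {}gy : gamma (proj_perp e (vsub y p)) - gamma (proj_perp e (vsub x p)) <=
    `|L| * (d%:R * ((1 + d%:R) * rho)).
  apply: le_trans (ler_norm _) _; apply: le_trans gy _.
  apply: (@le_trans _ _ (`|L| * enorm (vsub (proj_perp e (vsub y p)) (proj_perp e (vsub x p))))).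
    by rewrite ler_wpM2r ?sqrtr_ge0 // ler_norm.
  exact: ler_wpM2l.
have sC : C * rho <= s by apply: le_trans h1; rewrite ler_wpM2r // ltW.
rewrite dy; move: dv; rewrite ler_norml => /andP[dv _] gx.
have CE : C * rho = `|L| * (d%:R * ((1 + d%:R) * rho)) + d%:R * rho by rewrite /C; ring.
move: gy sC CE dv gx; move: (gamma _) (gamma _) (`|L| * _) (C * rho) (d%:R * rho) (dot v e) (dot (vsub x p) e).
move=> a1 a2 a3 a4 a5 a6 a7; lra.
Qed.

(** Compactness of the cube in its near-covering form: by [inward_le] the property persists for
    larger j, so local uniformity gives one j for the whole cube. *)
Lemma inward_uniform Omega (M : R) : is_open_set Omega -> lipschitz_boundary Omega ->
  exists2 j, (0 < j)%N & forall p, (forall i, `|tnth p i| <= M) -> inward Omega j p.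
Proof.
move=> Oo Ol.
pose K := [set u : 'rV[R]_d | forall i, `[- M, M]%classic (u ord0 i)].
pose tup (u : 'rV[R]_d) : d.-tuple R := [tuple u ord0 i | i < d].
have cK : compact K by apply: (@rV_compact R d (fun=> `[- M, M]%classic)) => i; exact: segment_compact.
have ncK := (compact_near_coveringP K).1 cK.
have H : \forall j \near \oo, K `<=` (fun u => inward Omega j (tup u)).
  apply: (ncK _ _ (fun j u => inward Omega j (tup u))) => u _; have [j j0 jv] := inward_ex (tup u) Oo Ol.
  have e0 : 0 < ((2 * j)%:R)^-1 :> R by rewrite invr_gt0 ltr0n muln_gt0.
  exists (ball u (((2 * j)%:R)^-1 : R), [set k | (2 * j <= k)%N]).
    split; first exact: nbhsx_ballx.
    by exists (2 * j)%N.
  move=> [u' k] /= [bv jk]; apply: inward_le jk _; apply: inward_near jv => i.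
  rewrite !tnth_mktuple; have := bv.2 ord0 i; rewrite /ball /= => /ltW.
  by rewrite distrC -ler_pdivlMl ?mulr1 // ltr0n muln_gt0.
have [k [k0 Hk]] : exists k, (0 < k)%N /\ K `<=` (fun u => inward Omega k (tup u)).
  by case: H => k _ hk; exists k.+1; split => //; apply: hk => /=; exact: leqnSn.
exists k => // p pM.
have := Hk (\row_i tnth p i); rewrite (_ : tup _ = p); last first.
  by apply: eq_from_tnth => i; rewrite tnth_mktuple mxE.
by apply => i; rewrite /= mxE in_itv /= -ler_norml.
Qed.

End InwardShift.

(** * Samples and noisy samples *)

Lemma limn_esup_le_near (R : realType) (u : nat -> \bar R) (c : \bar R) n0 :
  (forall n, (n0 <= n)%N -> (u n <= c)%E) -> (limn_esup u <= c)%E.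
Proof.
move=> uc; rewrite limn_esup_lim; apply: lime_le; first exact: is_cvg_esups.
exists n0 => // n /= n0n; apply: ge_ereal_sup => _ [k /= nk <-].
by apply: uc; apply: leq_trans nk.
Qed.

Section NoisyLaw.
Variables (R : realType) (d : nat) (d_gt0 : (0 < d)%N).
Variables (f g : d.-tuple R -> R) (F M0 Mg : R).
Hypotheses (f_ge0 : forall x, 0 <= f x) (f_le : forall x, f x <= F).
Hypotheses (f_out : forall x i, M0 < `|tnth x i| -> f x = 0)
  (g_out : forall x i, Mg < `|tnth x i| -> g x = 0).
Hypotheses (M0_ge0 : 0 <= M0) (Mg_ge0 : 0 <= Mg).
Variables (dT : measure_display) (T : measurableType dT) (P : probability T R).
Variables (X Y : nat -> T -> d.-tuple R).
Hypotheses (hX : forall i, has_density P (X i) f) (hY : forall i, has_density P (Y i) g).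
Hypothesis hind : mutually_independent P
  (fun k : nat + nat => match k with inl i => X i | inr i => Y i end).
Variables (delta : R) (delta_gt0 : 0 < delta).
Let Z i t := vadd (X i t) (vscale delta (Y i t)).
Let B0 := [set y : d.-tuple R | forall i, `|tnth y i| <= Mg].

Let F_ge0 : 0 <= F.
Proof. by apply: le_trans (f_le [tuple of nseq d 0]). Qed.

Let mB0 : measurable B0.
Proof.
apply: (measurable_coords (A := fun=> [set t | `|t| <= Mg])) => i.
have -> : [set t | `|t| <= Mg] = [set` `[- Mg, Mg]]; last exact: measurable_itv.
by apply/seteqP; split => t; rewrite /= in_itv /= ler_norml.
Qed.

Let YB0 : P (Y 0%N @^-1` ~` B0) = 0%E.
Proof.
have [mY Yg] := hY 0%N; rewrite Yg; last exact: measurableC.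
rewrite -(iint0 R d); apply: eq_iint => x; rewrite indicE.
case: (boolP (x \in _)) => [/set_mem|_]; last by rewrite mul0e.
move/existsNP => [i /negP]; rewrite -ltNge => /g_out ->.
by rewrite mule0.
Qed.

Let Z_le S (hi : \bar R) : measurable S -> (0 <= hi)%E ->
  (forall y, (forall i, `|tnth y i| <= Mg) ->
     (P (X 0%N @^-1` [set x | S (vadd x (vscale delta y))]) <= hi)%E) ->
  (P (Z 0%N @^-1` S) <= hi)%E.
Proof.
move=> mS hi0 h; apply: (sum_law_le (hX 0%N).1 (hY 0%N).1 _ mS mB0 YB0) => //.
by move=> A B; apply: indep_pair.
Qed.

Let Z_ge S (lo : \bar R) : measurable S -> (0 <= lo)%E ->
  (forall y, (forall i, `|tnth y i| <= Mg) ->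
     (lo <= P (X 0%N @^-1` [set x | S (vadd x (vscale delta y))]))%E) ->
  (lo <= P (Z 0%N @^-1` S))%E.
Proof.
move=> mS lo0 h; apply: (sum_law_ge (hX 0%N).1 (hY 0%N).1 _ mS mB0 YB0) => //.
by move=> A B; apply: indep_pair.
Qed.

Let fiber_rbox (lo : 'I_d -> R) (h : R) (y : d.-tuple R) :
  [set x | rbox lo h (vadd x (vscale delta y))] = rbox (fun i => lo i - delta * tnth y i) h.
Proof.
by apply/seteqP; split => x hx i; have := hx i; rewrite !tnth_mktuple => /andP[h1 h2];
  apply/andP; split; lra.
Qed.

Lemma sample_cube M : M0 < M -> P (X 0%N @^-1` ~` cube M) = 0%E.
Proof.
move=> MM; apply: (density_null (hX 0%N)); first by apply: measurableC; exact: measurable_cube.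
move=> x /existsNP[i nx]; apply: (f_out (i := i)); rewrite ltNge; apply/negP.
by rewrite ler_norml => /andP[h1 h2]; apply: nx; apply/andP; split; lra.
Qed.

Lemma noisy_cube M : M0 + delta * Mg < M -> P (Z 0%N @^-1` ~` cube M) = 0%E.
Proof.
move=> MM; apply/eqP; rewrite eq_le measure_ge0 andbT.
apply: Z_le => // [|y yM]; first by apply: measurableC; exact: measurable_cube.
rewrite (density_null (hX 0%N)) //.
  have mS : measurable (~` @cube R d M) by apply: measurableC; exact: measurable_cube.
  have m1 : measurable_fun setT (fun x : d.-tuple R => (x, y)) by apply: measurable_fun_pair.
  have := measurableT_comp (measurable_vadd_scale delta) m1.
  by move=> /(_ measurableT _ mS); rewrite setTI.
move=> x /existsNP[i nx]; apply: (f_out (i := i)); rewrite ltNge; apply/negP.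
move=> xM; apply: nx; rewrite !tnth_mktuple.
have dy : `|delta * tnth y i| <= delta * Mg.
  by rewrite normrM (gtr0_norm delta_gt0) ler_pM2l.
have := ler_normD (tnth x i) (delta * tnth y i) => t.
have {}t : `|tnth x i + delta * tnth y i| < M by lra.
by move: t; rewrite ltr_norml => /andP[t1 ->]; rewrite ltW.
Qed.

Lemma sample_box lo (h : R) : 0 < h -> (P (X 0%N @^-1` rbox lo h) <= (F * h ^+ d)%:E)%E.
Proof. by move=> h0; apply: (density_box_le (hX 0%N)) => //; apply: ltW. Qed.

Lemma noisy_box lo (h : R) : 0 < h -> (P (Z 0%N @^-1` rbox lo h) <= (F * h ^+ d)%:E)%E.
Proof.
move=> h0; apply: Z_le => [||y yM]; first exact: measurable_rbox.
  by rewrite lee_fin mulr_ge0 // exprn_ge0 // ltW.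
by rewrite fiber_rbox; apply: sample_box.
Qed.

Lemma comparison_limsup (M eps h0 bs bN b : R) (q m : nat) (e : {ffun 'I_d -> nat} -> 'I_d -> R) :
  let w0 := 2 * M / (q * m)%:R in
  (0 < q)%N -> (0 < m)%N -> M0 + delta * Mg < M -> 0 <= eps -> 0 < h0 ->
  (forall k i, `|e k i| <= w0 / 8) ->
  (forall (h : R) (k : {ffun 'I_d -> nat}) (lo lo' : 'I_d -> R),
    0 < h -> h <= h0 -> (forall i, (k i < m)%N) ->
    (forall i, - M + (k i)%:R * (q%:R * w0) <= lo i /\
               lo i + h <= - M + (k i).+1%:R * (q%:R * w0)) ->
    (forall i, `|lo' i - lo i - e k i| <= h) ->
    (P (X 0%N @^-1` rbox lo h) <= P (Z 0%N @^-1` rbox lo' h) + (eps * h ^+ d)%:E)%E /\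
    (P (Z 0%N @^-1` rbox lo h) <= P (X 0%N @^-1` rbox lo' h) + (eps * h ^+ d)%:E)%E) ->
  0 < bs -> 0 <= bN -> 0 <= b ->
  F * w0 * (2 * M) ^+ d.-1 <= bs ^+ d -> eps * (2 * M) ^+ d <= bN ^+ d ->
  F * (2 * M) ^+ d <= b ^+ d ->
  {ae P, forall t : T,
    (limn_esup (fun n : nat => ((n%:R `^ (d%:R)^-1)^-1)%:E *
       supdiff (chain_count (fun i => vadd (X i t) (vscale delta (Y i t))) n)
         (chain_count (fun i => X i t) n)) <= (loss_const R d m * (bs + bN))%:E)%E}.
Proof.
move=> w0 q0 m0 MM eps0 h00 ee sh bs0 bN0 b0 hbs hbN hb.
have dM : 0 <= delta * Mg by rewrite mulr_ge0 // ltW.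
have M_gt0 : 0 < M by apply: le_lt_trans MM; rewrite addr_ge0.
have MM0 : M0 < M by apply: le_lt_trans MM; rewrite lerDl.
have iX := iid_sample hX hind; have iZ := iid_noisy hX hY hind delta.
have cX := sample_cube MM0; have cZ := noisy_cube MM.
have H1 := chain_count_comparison d_gt0 q0 m0 M_gt0 F_ge0 eps0 iX iZ cX cZ sample_box noisy_box
  ee h00 (fun h k lo lo' h1 h2 h3 h4 h5 => (sh h k lo lo' h1 h2 h3 h4 h5).1) bs0 bN0 b0 hbs hbN hb.
have H2 := chain_count_comparison d_gt0 q0 m0 M_gt0 F_ge0 eps0 iZ iX cZ cX noisy_box sample_box
  ee h00 (fun h k lo lo' h1 h2 h3 h4 h5 => (sh h k lo lo' h1 h2 h3 h4 h5).2) bs0 bN0 b0 hbs hbN hb.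
apply: filterS2 H1 H2 => t [n1 h1] [n2 h2].
apply: (@limn_esup_le_near _ _ _ (maxn (maxn n1 n2) 1)) => n.
rewrite !geq_max => /andP[/andP[n1n n2n] n0].
have r0 : 0 < n%:R `^ (d%:R)^-1 :> R by rewrite powR_gt0 // ltr0n.
set r := n%:R `^ _ in r0 *; set c := loss_const _ _ _ * _.
have : (supdiff (chain_count (fun i => vadd (X i t) (vscale delta (Y i t))) n)
         (chain_count (fun i => X i t) n) <= (c * r)%:E)%E.
  apply: ge_ereal_sup => _ [x _ <-]; rewrite lee_fin ler_norml.
  have := h1 n n1n x; have := h2 n n2n x; rewrite -/r -/c => a1 a2.
  by apply/andP; split; lra.
move=> /(lee_wpmul2l (_ : (0 <= (r^-1)%:E)%E)) => /(_ _)/le_trans; apply.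
  by rewrite lee_fin invr_ge0 ltW.
by rewrite -EFinM lee_fin mulrCA mulVf ?mulr1 // gt_eqF.
Qed.

(** Upper bound on the source box, lower bound on the target box, both within eps / 2 of one value
    of f. Where the source leaves Omega, f = 0 only helps; the inward shift keeps the target, noise
    included, inside Omega, where the modulus controls f. Only the target has to be inside, so one
    shift serves both directions. *)
Lemma box_shift_both (Omega : set (d.-tuple R)) (eps eta s rho h : R) (ev lo lo' : 'I_d -> R) :
  (forall x, ~ Omega x -> f x = 0) -> 0 <= eps ->
  (forall x y, Omega x -> Omega y -> (forall i, `|tnth x i - tnth y i| <= eta) ->
     `|f x - f y| <= eps / 2) ->
  0 < h -> delta * Mg <= rho / 2 -> 8 * h <= rho -> rho <= s -> 2 * s <= eta ->
  (forall i, `|ev i| <= s) -> (forall i, `|lo' i - lo i - ev i| <= h) ->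
  (forall x, Omega x -> (forall i, lo i - rho / 2 <= tnth x i <= lo i + h + rho / 2) ->
     forall y, (forall i, `|tnth y i - tnth x i - ev i| <= rho) -> Omega y) ->
  (P (X 0%N @^-1` rbox lo h) <= P (Z 0%N @^-1` rbox lo' h) + (eps * h ^+ d)%:E)%E /\
  (P (Z 0%N @^-1` rbox lo h) <= P (X 0%N @^-1` rbox lo' h) + (eps * h ^+ d)%:E)%E.
Proof.
move=> fO eps0 fmod h0 dMg h8 rs s2 evs lolo Hin.
have hd0 : 0 <= h ^+ d by rewrite exprn_ge0 // ltW.
have eh0 : (0 <= (eps * h ^+ d)%:E)%E by rewrite lee_fin mulr_ge0.
have dy (y : d.-tuple R) i : `|tnth y i| <= Mg -> `|delta * tnth y i| <= rho / 2.
  by move=> yM; apply: le_trans dMg; rewrite normrM (gtr0_norm delta_gt0) ler_pM2l.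
have gap c : ((c + eps / 2) * h ^+ d)%:E = ((c - eps / 2) * h ^+ d)%:E + (eps * h ^+ d)%:E :> \bar R.
  by rewrite -EFinD; congr _%:E; field.
have mass (W : T -> d.-tuple R) (c : R) S : measurable_fun setT W -> measurable S ->
    ((Num.max 0 (c - eps / 2) * h ^+ d)%:E <= P (W @^-1` S))%E ->
    (((c + eps / 2) * h ^+ d)%:E <= P (W @^-1` S) + (eps * h ^+ d)%:E)%E.
  move=> mW mS le; rewrite gap; apply: leeD => //; apply: le_trans le.
  by rewrite lee_fin ler_wpM2r // le_max lexx orbT.
have mX0 := (hX 0%N).1; have mZ0 : measurable_fun setT (Z 0%N).
  by have [mZ _ _] := iid_noisy hX hY hind delta; exact: (mZ 0%N).
have dist_abs (a b c : R) : `|a - b| <= c -> a - b <= c /\ b - a <= c.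
  by rewrite ler_norml => /andP[h1 h2]; split; lra.
split.
  have [[x0 [Ox0 bx0]]|nx] := pselect (exists x0, Omega x0 /\ rbox lo h x0); last first.
    rewrite (density_null (hX 0%N)); first by rewrite adde_ge0.
      exact: measurable_rbox.
    by move=> x bx; apply: fO => Ox; apply: nx; exists x.
  have xin i : lo i - rho / 2 <= tnth x0 i <= lo i + h + rho / 2.
    by have /andP[h1 h2] := bx0 i; apply/andP; split; lra.
  apply: (@le_trans _ _ ((f x0 + eps / 2) * h ^+ d)%:E).
    apply: (density_box_le (hX 0%N)) => //; first exact: ltW.
      by rewrite addr_ge0 // divr_ge0.
    move=> x bx; have [Ox|nO] := pselect (Omega x); last first.
      by rewrite (fO _ nO) addr_ge0 // divr_ge0.
    have : `|f x - f x0| <= eps / 2.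
      apply: fmod => // i; have /andP[h1 h2] := bx i; have /andP[h3 h4] := bx0 i.
      by rewrite ler_norml; apply/andP; split; lra.
    by move=> /dist_abs[]; lra.
  apply: mass => //; first exact: measurable_rbox.
  apply: Z_ge => [||y yM]; first exact: measurable_rbox.
    by rewrite lee_fin mulr_ge0 // le_max lexx.
  rewrite fiber_rbox; apply: (density_box_ge (hX 0%N)) => //; first exact: ltW.
    by rewrite le_max lexx.
  move=> x bx; have near i : `|tnth x i - tnth x0 i - ev i| <= rho.
    have /andP[h1 h2] := bx i; have /andP[h3 h4] := bx0 i.
    have [h5 h6] := dist_abs _ _ _ (lolo i); have := dy y i (yM i).
    by rewrite ler_norml => /andP[h7 h8']; rewrite ler_norml; apply/andP; split; lra.
  have Ox : Omega x by apply: (Hin x0).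
  have : `|f x - f x0| <= eps / 2.
    apply: fmod => // i; have := near i; have := evs i; rewrite !ler_norml.
    by move=> /andP[h1 h2] /andP[h3 h4]; apply/andP; split; lra.
  by move=> /dist_abs[h1 h2]; rewrite ge_max f_ge0 /=; lra.
have [[x0 [y0 [Ox0 [yM0 bx0]]]]|nx] := pselect (exists x0 y0, Omega x0 /\
    ((forall i, `|tnth y0 i| <= Mg) /\ rbox (fun i => lo i - delta * tnth y0 i) h x0)); last first.
  apply: (@le_trans _ _ 0%E); last by rewrite adde_ge0.
  apply: Z_le => // [|y yM]; first exact: measurable_rbox.
  rewrite fiber_rbox (density_null (hX 0%N)) //; first exact: measurable_rbox.
  by move=> x bx; apply: fO => Ox; apply: nx; exists x, y.
have xin (y x : d.-tuple R) i : `|tnth y i| <= Mg ->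
    lo i - delta * tnth y i <= tnth x i < lo i - delta * tnth y i + h ->
    lo i - rho / 2 <= tnth x i <= lo i + h + rho / 2.
  move=> /dy; rewrite ler_norml => /andP[h1 h2] /andP[h3 h4].
  by apply/andP; split; lra.
have nearO (x : d.-tuple R) : (forall i, lo' i <= tnth x i <= lo' i + h) -> Omega x.
  move=> bx; apply: (Hin x0) => // i; first exact: (xin y0 x0).
  have /andP[h1 h2] := bx i; have /andP[h3 h4] := xin _ _ _ (yM0 i) (bx0 i).
  have [h5 h6] := dist_abs _ _ _ (lolo i).
  by rewrite ler_norml; apply/andP; split; lra.
(* The corner of the target box is the reference point: it does not depend on the noise, whereas the
   source fibers move with y. *)
pose c0 : d.-tuple R := [tuple lo' i | i < d].
have Oc0 : Omega c0 by apply: nearO => i; rewrite tnth_mktuple lexx lerDl ltW.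
apply: (@le_trans _ _ ((f c0 + eps / 2) * h ^+ d)%:E).
  apply: Z_le => [||y yM]; first exact: measurable_rbox.
    by rewrite lee_fin mulr_ge0 // addr_ge0 // divr_ge0.
  rewrite fiber_rbox; apply: (density_box_le (hX 0%N)) => //; first exact: ltW.
    by rewrite addr_ge0 // divr_ge0.
  move=> x bx; have [Ox|nO] := pselect (Omega x); last first.
    by rewrite (fO _ nO) addr_ge0 // divr_ge0.
  have : `|f x - f c0| <= eps / 2.
    apply: fmod => // i; rewrite tnth_mktuple.
    have /andP[h3 h4] := xin _ _ _ (yM i) (bx i).
    have [h5 h6] := dist_abs _ _ _ (lolo i); have := evs i; rewrite ler_norml => /andP[h1 h2].
    by rewrite ler_norml; apply/andP; split; lra.
  by move=> /dist_abs[]; lra.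
apply: mass => //; first exact: measurable_rbox.
apply: (density_box_ge (hX 0%N)) => //; first exact: ltW.
  by rewrite le_max lexx.
move=> x bx; have Ox : Omega x.
  by apply: nearO => i; have /andP[-> h2] := bx i; rewrite ltW.
have : `|f x - f c0| <= eps / 2.
  apply: fmod => // i; rewrite tnth_mktuple; have /andP[h3 h4] := bx i.
  by rewrite ler_norml; apply/andP; split; lra.
by move=> /dist_abs[h1 h2]; rewrite ge_max f_ge0 /=; lra.
Qed.

End NoisyLaw.

(** Quantified over all probability spaces and samples, so that the infimum of such c depends on
    delta, f and g alone. *)
Definition noise_bound (R : realType) (d : nat) (f g : d.-tuple R -> R) (delta c : R) : Prop :=
  forall (dT : measure_display) (T : measurableType dT) (P : probability T R)
         (X Y : nat -> T -> d.-tuple R),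
    (forall i, has_density P (X i) f) ->
    (forall i, has_density P (Y i) g) ->
    mutually_independent P
      (fun k : nat + nat => match k with inl i => X i | inr i => Y i end) ->
    {ae P, forall w : T,
      (limn_esup (fun n : nat =>
         ((n%:R `^ (d%:R)^-1)^-1)%:E *
         supdiff
           (chain_count (fun i => vadd (X i w) (vscale delta (Y i w))) n)
           (chain_count (fun i => X i w) n)) <= c%:E)%E}.

(** * Admissible constants *)

Section NoiseBound.
Variables (R : realType) (d : nat) (d_gt0 : (0 < d)%N).
Variables (f g : d.-tuple R -> R) (F M0 Mg : R).
Hypotheses (f_ge0 : forall x, 0 <= f x) (f_le : forall x, f x <= F).
Hypotheses (f_out : forall x i, M0 < `|tnth x i| -> f x = 0)
  (g_out : forall x i, Mg < `|tnth x i| -> g x = 0).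
Hypotheses (M0_ge0 : 0 <= M0) (Mg_ge0 : 0 <= Mg).

Let F_ge0 : 0 <= F.
Proof. by apply: le_trans (f_le [tuple of nseq d 0]). Qed.

Lemma noise_bound_le delta c c' : c <= c' -> noise_bound f g delta c -> noise_bound f g delta c'.
Proof.
move=> cc h dT T P X Y hX hY hI; apply: filterS (h dT T P X Y hX hY hI) => t.
by move/le_trans; apply; rewrite lee_fin.
Qed.

(** Countably many almost sure events may be intersected; hence an infimum of admissible constants
    is itself admissible. *)
Lemma noise_bound_inf delta (c : R) : (forall k : nat, noise_bound f g delta (c + k.+1%:R^-1)) ->
  noise_bound f g delta c.
Proof.
move=> h dT T P X Y hX hY hI.
have := ae_foralln (fun k => h k dT T P X Y hX hY hI).
apply: filterS => t ht; apply/lee_addgt0Pr => e e0.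
pose k := Num.truncn (e^-1); apply: le_trans (ht k) _; rewrite -EFinD lee_fin lerD2l.
rewrite -[leRHS]invrK lef_pV2 ?posrE ?invr_gt0 ?ltr0n //.
exact/ltW/truncnS_gt.
Qed.

(** Gives a crude upper bound for a d-th root where its size is irrelevant. *)
Let le_exprS (a : R) : 0 <= a -> a <= (a + 1) ^+ d.
Proof.
move=> a0; apply: le_trans (_ : a + 1 <= _); first by rewrite lerDl.
by rewrite ler_eXnr // lerDr.
Qed.

(** One box, one slab, no shift and the trivial density error F. The value of c is immaterial; it
    shows that the infimum is over a nonempty set. *)
Lemma noise_bound_ex delta : 0 < delta -> exists2 c, 0 <= c & noise_bound f g delta c.
Proof.
move=> d0; pose M := M0 + delta * Mg + 1.
have dM : 0 <= delta * Mg by rewrite mulr_ge0 // ltW.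
have M1 : 0 < M by rewrite /M; have := M0_ge0; have := Mg_ge0; lra.
pose w0 := 2 * M / (1 * 1)%:R.
have w00 : 0 <= w0 by rewrite divr_ge0 // mulr_ge0 // ltW.
have MM : 0 <= 2 * M by rewrite mulr_ge0 // ltW.
pose A := F * w0 * (2 * M) ^+ d.-1; pose B := F * (2 * M) ^+ d.
have A0 : 0 <= A := mulr_ge0 (mulr_ge0 F_ge0 w00) (exprn_ge0 _ MM).
have B0 : 0 <= B := mulr_ge0 F_ge0 (exprn_ge0 _ MM).
exists (loss_const R d 1 * (A + 1 + (B + 1))).
  apply: mulr_ge0; last by lra.
  by rewrite /loss_const addr_ge0 ?mulr_ge0.
move=> dT T P X Y hX hY hI.
apply: (comparison_limsup d_gt0 f_ge0 f_le f_out g_out M0_ge0 Mg_ge0 hX hY hI d0 (M := M)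
  (eps := F) (h0 := 1) (b := B + 1) (q := 1) (e := fun _ _ => 0)) => //.
- by rewrite /M ltrDl.
- by move=> k i; rewrite normr0 divr_ge0.
- move=> h k lo lo' h0 _ _ _ _; split.
    apply: le_trans (sample_box f_ge0 f_le hX _ h0) _.
    by rewrite leeDr.
  apply: le_trans (noisy_box f_ge0 f_le g_out hX hY hI delta _ h0) _.
  by rewrite leeDr.
- by lra.
- by lra.
- by lra.
- exact: le_exprS.
- exact: le_exprS.
- exact: le_exprS.
Qed.

Variable Omega : set (d.-tuple R).
Hypotheses (Oopen : is_open_set Omega) (Olip : lipschitz_boundary Omega).
Hypothesis f_Omega : forall x, ~ Omega x -> f x = 0.
Hypothesis f_mod : forall eps : R, 0 < eps -> exists2 eta : R, 0 < eta &
  forall x y, Omega x -> Omega y -> (forall i, `|tnth x i - tnth y i| <= eta) ->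
    `|f x - f y| <= eps.

Lemma noise_bound_small (e : R) : 0 < e -> exists2 delta0 : R, 0 < delta0 &
  forall delta, 0 < delta -> delta < delta0 -> noise_bound f g delta e.
Proof.
move=> e0; pose M := M0 + Mg + 1.
have M1 : 0 < M by rewrite /M; have := M0_ge0; have := Mg_ge0; lra.
have [j j0 inw] := inward_uniform d_gt0 M Oopen Olip.
have jR : 1 <= j%:R :> R by rewrite ler1n.
(* Boxes of side at most 1 / j, so that one inward direction serves a whole box. It is fixed before
   q because [loss_const] depends on m. *)
pose m := (Num.truncn (2 * M * j%:R)).+1.
have mj : 2 * M * j%:R <= m%:R by apply/ltW/truncnS_gt.
have mR : 1 <= m%:R :> R by rewrite ler1n.
have L0 : 0 < loss_const R d m by rewrite /loss_const ltr_wpDl ?mulr_ge0.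
(* With bs = bN = beta the resulting bound [loss_const R d m * (bs + bN)] is exactly e. *)
pose beta := e / (2 * loss_const R d m).
have beta0 : 0 < beta by rewrite divr_gt0 ?mulr_gt0.
pose a := beta ^+ d; have a0 : 0 < a by rewrite exprn_gt0.
have MM : 0 < 2 * M by rewrite mulr_gt0.
pose eps := a / (2 * M) ^+ d.
have eps0 : 0 < eps by rewrite divr_gt0 ?exprn_gt0.
have [eta eta0 fmod] := f_mod (divr_gt0 eps0 (ltr0Sn R 1)).
(* Three demands on the slab width w0: slab mass at most beta^d ([Q1]), w0 <= eta for the modulus of
   f ([Q2]), and j w0 <= 1 for the inward shift ([Q3]). *)
pose Q1 := F * (2 * M) * (2 * M) ^+ d.-1 / a.
have Q10 : 0 <= Q1 by rewrite divr_ge0 ?mulr_ge0 ?exprn_ge0 // ltW.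
pose Q2 := 2 * M / eta; have Q20 : 0 <= Q2 by rewrite divr_ge0 // ltW.
pose Q3 := 2 * M * j%:R; have Q30 : 0 <= Q3 by rewrite mulr_ge0 // ltW.
pose q := (Num.truncn (Q1 + Q2 + Q3)).+1.
have qm : Q1 + Q2 + Q3 <= (q * m)%:R.
  apply: le_trans (_ : q%:R <= _); first exact/ltW/truncnS_gt.
  by rewrite natrM ler_peMr.
have qm0 : 0 < (q * m)%:R :> R by rewrite ltr0n.
pose w0 := 2 * M / (q * m)%:R; have w00 : 0 < w0 by rewrite divr_gt0.
have w0eta : w0 <= eta.
  rewrite /w0 ler_pdivrMr // [leRHS]mulrC -ler_pdivrMr // -/Q2; lra.
have w0j : j%:R * w0 <= 1.
  rewrite /w0 mulrA ler_pdivrMr // mul1r; have -> : j%:R * (2 * M) = Q3 by exact: mulrC.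
  lra.
have hbs : F * w0 * (2 * M) ^+ d.-1 <= a.
  have -> : F * w0 * (2 * M) ^+ d.-1 = F * (2 * M) * (2 * M) ^+ d.-1 / (q * m)%:R.
    by rewrite /w0; ring.
  rewrite ler_pdivrMr // [leRHS]mulrC -ler_pdivrMr // -/Q1; lra.
(* The longest shift that the comparison allows; [rho], the room it creates, is then the largest one
   permitted by [inward]. *)
pose s := w0 / 8; have s0 : 0 < s by rewrite divr_gt0.
have j1 : 0 < j%:R :> R by rewrite ltr0n.
pose rho := s / j%:R; have rho0 : 0 < rho by rewrite divr_gt0.
have rs : rho <= s by rewrite ler_pdivrMr // ler_peMr // ltW.
have jrho : j%:R * rho = s by rewrite /rho mulrC divfK // gt_eqF.
have Mg1 : 0 < 2 * (Mg + 1) by rewrite mulr_gt0 // ltr_wpDl.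
(* The bound 1 keeps the noisy sample in the fixed cube; the other makes the noise at most rho / 2,
   and Mg + 1 avoids dividing by zero. *)
exists (Num.min 1 (rho / (2 * (Mg + 1)))); first by rewrite lt_min ltr01 divr_gt0.
move=> delta d0; rewrite lt_min => /andP[d1 drho].
have dMg : delta * Mg <= rho / 2.
  move: drho; rewrite ltr_pdivlMr // => dr.
  have : delta * (2 * (Mg + 1)) = 2 * (delta * Mg) + 2 * delta by ring.
  lra.
have dMg1 : delta * Mg <= Mg by rewrite ler_piMl // ltW.
(* The inward direction of a box is the one at its centre, picked by choice; the zero vector is the
   value of [dir] where no direction exists. *)
pose ctr (k : {ffun 'I_d -> nat}) : d.-tuple R :=
  [tuple - M + ((k i)%:R + 1 / 2) * (q%:R * w0) | i < d].
pose dir (p : d.-tuple R) : d.-tuple R :=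
  if pselect (inward Omega j p) is left h then projT1 (cid h) else [tuple of nseq d 0].
have dir1 p i : `|tnth (dir p) i| <= 1.
  rewrite /dir; case: pselect => [h|_]; last by rewrite tnth_nseq normr0.
  by case: (cid h) => v [v1 _] /=.
have r_m : q%:R * w0 * m%:R = 2 * M.
  by rewrite /w0 natrM; field; rewrite !pnatr_eq0.
have r0 : 0 < q%:R * w0 by rewrite mulr_gt0 // ltr0n.
have rj : j%:R * (q%:R * w0) <= 1.
  have m0 : 0 < m%:R :> R by rewrite ltr0n.
  by rewrite -(ler_pM2r m0) -mulrA r_m mul1r mulrC.
move=> dT T P X Y hX hY hI.
apply: filterS; last apply: (comparison_limsup d_gt0 f_ge0 f_le f_out g_out M0_ge0 Mg_ge0 hX hY hI d0 (M := M)
  (eps := eps) (h0 := rho / 8) (bs := beta) (bN := beta) (b := F * (2 * M) ^+ d + 1) (q := q) (m := m)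
  (e := fun k i => s * tnth (dir (ctr k)) i)).
- move=> t /le_trans; apply; rewrite lee_fin /beta.
  by rewrite le_eqVlt; apply/orP; left; apply/eqP; field; rewrite gt_eqF.
- by [].
- by [].
- by rewrite /M; have := M0_ge0; lra.
- exact: ltW.
- by rewrite divr_gt0.
- move=> k i; rewrite normrM (gtr0_norm s0) -/w0 -/s ler_piMr //; exact: ltW.
- move=> h k lo lo' h0 h8 km inbox lolo.
  apply: (box_shift_both f_ge0 g_out hX hY hI d0 (Omega := Omega) (eta := eta)
    (s := s) (rho := rho) (ev := fun i => s * tnth (dir (ctr k)) i)) => //.
  + exact: ltW.
  + by lra.
  + by rewrite /s; lra.
  + by move=> i; rewrite normrM (gtr0_norm s0) ler_piMr // ltW.
  have pM i : `|tnth (ctr k) i| <= M.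
    rewrite tnth_mktuple -/w0.
    have kr0 : 0 <= (k i)%:R * (q%:R * w0) by rewrite mulr_ge0 // ltW.
    have kr1 : (k i)%:R * (q%:R * w0) + q%:R * w0 <= 2 * M.
      rewrite -r_m -[X in _ + X]mul1r -mulrDl natr1 [leRHS]mulrC ler_wpM2r ?ler_nat //.
      exact: ltW.
    by rewrite mulrDl ler_norml; apply/andP; split; lra.
  have := inw (ctr k) pM => hin x Ox xlo y yx.
  have [_ H] : (forall i, `|tnth (dir (ctr k)) i| <= 1) /\
    forall s rho : R, 0 < rho -> j%:R * rho <= s -> j%:R * s <= 1 ->
    forall x, Omega x -> (forall i, j%:R * `|tnth x i - tnth (ctr k) i| <= 1) ->
    forall y, (forall i, `|tnth y i - tnth x i - s * tnth (dir (ctr k)) i| <= rho) -> Omega y.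
    rewrite /dir; case: pselect => [h'|/(_ hin)//].
    by case: (cid h') => v /=.
  apply: (H s rho rho0 _ _ x Ox _ y yx); first by rewrite jrho.
    by rewrite /s mulrA ler_pdivrMr //; lra.
  move=> i; rewrite tnth_mktuple -/w0; have [b1 b2] := inbox i; have /andP[b3 b4] := xlo i.
  move: b1 b2 rj; rewrite -/w0 -natr1; move: (q%:R * w0) => r b1 b2 rj.
  have : `|tnth x i - (- M + ((k i)%:R + 1 / 2) * r)| <= r / 2 + rho / 2.
    by rewrite mulrDl ler_norml; apply/andP; split; lra.
  move=> t; have := ler_wpM2l (ltW j1) t; rewrite mulrDr => {}t.
  have e2 : j%:R * (rho / 2) = s / 2 by rewrite mulrA jrho.
  have sj : s <= 1 by rewrite /s; have := ler_wpM2r (ltW w00) jR; lra.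
  by have := rj; rewrite /s in e2 sj *; lra.
- by [].
- exact: ltW.
- by rewrite addr_ge0 // mulr_ge0 // exprn_ge0 // ltW.
- exact: hbs.
- by rewrite /eps divfK // gt_eqF // exprn_gt0.
- by apply: le_exprS; rewrite mulr_ge0 // exprn_ge0 // ltW.
Qed.

End NoiseBound.

Theorem theorem3p7 (R : realType) (d : nat) (hd : (2 <= d)%N)
  (Omega : set (d.-tuple R))
  (Hpos : in_pos_orthant Omega) (Hopen : is_open_set Omega)
  (Hbdd : is_bounded_set Omega) (Hlip : lipschitz_boundary Omega)
  (f : d.-tuple R -> R)
  (Hf0 : forall x, 0 <= f x)
  (Hfmeas : measurable_fun [set: d.-tuple R] f)
  (Hfint : iint (fun x => (f x)%:E) = 1%E)
  (m : R -> R)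
  (Hmcont : {within [set t : R | 0 <= t], continuous m})
  (Hmmono : forall s t : R, 0 <= s -> s <= t -> m s <= m t)
  (Hmpos : forall t : R, 0 <= t -> 0 <= m t)
  (Hm0 : m 0 = 0)
  (Hfmod : forall x y, Omega x -> Omega y -> `|f x - f y| <= m (enorm (vsub x y)))
  (Hfout : forall x, ~ Omega x -> f x = 0)
  (g : d.-tuple R -> R)
  (Hg0 : forall x, 0 <= g x)
  (Hgcont : continuous_Rd g) (Hgsupp : compact_support g) :
  exists C : R -> R,
    (C delta @[delta --> 0^'+] --> 0) /\
    forall (dT : measure_display) (T : measurableType dT) (P : probability T R)
           (X Y : nat -> T -> d.-tuple R),
      (forall i, has_density P (X i) f) ->
      (forall i, has_density P (Y i) g) ->
      mutually_independent P
        (fun k : nat + nat => match k with inl i => X i | inr i => Y i end) ->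
      forall delta : R, 0 < delta ->
        {ae P, forall w : T,
          (limn_esup (fun n : nat =>
             ((n%:R `^ (d%:R)^-1)^-1)%:E *
             supdiff
               (chain_count (fun i => vadd (X i w) (vscale delta (Y i w))) n)
               (chain_count (fun i => X i w) n)) <= (C delta)%:E)%E}.
Proof.
have d_gt0 : (0 < d)%N by apply: leq_trans hd.
have [M HM] := Hbdd; have [N HN] := Hgsupp.
have xM x i : Omega x -> `|tnth x i| <= `|M|.
  move=> Ox; apply: le_trans (norm_tnth_le_enorm x i) _.
  exact: le_trans (HM x Ox) (ler_norm M).
have f_out x i : `|M| < `|tnth x i| -> f x = 0.
  move=> Mx; apply: Hfout => Ox; have := xM x i Ox.
  by rewrite leNgt Mx.
have g_out x i : `|N| < `|tnth x i| -> g x = 0.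
  move=> Nx; apply: HN; apply: le_lt_trans (ler_norm N) _.
  exact: lt_le_trans Nx (norm_tnth_le_enorm x i).
have enorm_ge0 (x : d.-tuple R) : 0 <= enorm x := sqrtr_ge0 _.
(* Omega has finite diameter and m is monotone, so f varies by a bounded amount on Omega. *)
have [F f_le] : exists F, forall x, f x <= F.
  have [[x0 Ox0]|noO] := pselect (exists x, Omega x); last first.
    by exists 0 => x; rewrite Hfout // => Ox; apply: noO; exists x.
  exists (f x0 + m (d%:R * (`|M| + `|M|))) => x.
  have [Ox|/Hfout ->] := pselect (Omega x); last first.
    by rewrite addr_ge0 // Hmpos // mulr_ge0 // addr_ge0.
  rewrite -lerBlDl; apply: le_trans (ler_norm _) _; apply: le_trans (Hfmod _ _ Ox Ox0) _.
  apply: Hmmono => //; apply: enorm_le => // i.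
  by rewrite tnth_mktuple; apply: le_trans (ler_normB _ _) _; rewrite lerD // xM.
have f_mod eps : 0 < eps -> exists2 eta : R, 0 < eta & forall x y, Omega x -> Omega y ->
    (forall i, `|tnth x i - tnth y i| <= eta) -> `|f x - f y| <= eps.
  (* Continuity of m at 0 within the half-line, evaluated at r / 2 to stay inside the open ball;
     monotonicity covers the smaller distances. *)
  move=> e0; have le00 : (0 : R) <= 0 by [].
  have /subspace_continuousP/(_ 0 le00)/cvgrPdist_le/(_ eps e0) := Hmcont.
  move=> /nbhs_ballP[r /= r0 hr].
  have dR : 0 < d%:R :> R by rewrite ltr0n.
  exists (r / 2 / d%:R); first by rewrite !divr_gt0.
  move=> x y Ox Oy xy; apply: le_trans (Hfmod x y Ox Oy) _.
  have sxy : enorm (vsub x y) <= r / 2.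
    have -> : r / 2 = d%:R * (r / 2 / d%:R) by rewrite [RHS]mulrC divfK // gt_eqF.
    apply: enorm_le => // [|i]; first by rewrite !divr_ge0 // ltW.
    by rewrite tnth_mktuple.
  apply: le_trans (Hmmono _ _ (enorm_ge0 _) sxy) _.
  have r2 : 0 <= r / 2 by rewrite divr_ge0 // ltW.
  have r2r : ball 0 r (r / 2) by rewrite /ball /= sub0r normrN ger0_norm //; lra.
  have : `|m 0 - m (r / 2)| <= eps := hr (r / 2) r2r r2.
  by rewrite Hm0 sub0r normrN; apply: le_trans; exact: ler_norm.
(* Bounded below by construction and nonempty for delta > 0, so that [inf] is a genuine infimum
   there. *)
pose S delta := [set c : R | 0 <= c /\ noise_bound f g delta c].
have S0 delta : lbound (S delta) 0 by move=> c [].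
have infS delta : has_inf (S delta) \/ ~ 0 < delta.
  have [dl|] := pselect (0 < delta); last by right.
  left; split; last by exists 0.
  have [c c0 hc] := noise_bound_ex d_gt0 Hf0 f_le f_out g_out (normr_ge0 M) (normr_ge0 N) dl.
  by exists c.
exists (fun delta => inf (S delta)); split.
  apply/cvgrPdist_le => e e0.
  have [d0 d00 hd0] := noise_bound_small d_gt0 Hf0 f_le f_out g_out (normr_ge0 M) (normr_ge0 N)
    Hopen Hlip Hfout f_mod e0.
  near=> delta.
  have dl : 0 < delta by [].
  have Se : S delta e by split; [exact: ltW|exact: hd0].
  rewrite sub0r normrN ger0_norm; first by apply: ge_inf => //; exists 0.
  by apply: lb_le_inf => //; exists e.
move=> dT T P X Y hX hY hI delta dl.
have [hS|//] := infS delta.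
have nb : noise_bound f g delta (inf (S delta)).
  apply: noise_bound_inf => k.
  have k0 : 0 < k.+1%:R^-1 :> R by rewrite invr_gt0.
  have [c [_ hc] /ltW ch] := inf_adherent k0 hS.
  exact: noise_bound_le ch hc.
exact: nb.
Unshelve. all: end_near.
Qed.
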